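(* Let $\mathcal{I} \subset \mathbb{N}$ be a finite index set with $m = |\mathcal{I}|$, let $\mathcal{I}' \subset \mathcal{I}$ be a subset, and let $(\hat{v},\hat{w})$ be the solution, with $\hat{v}(0)=0$ and scalar input $u \in \mathcal{L}^2[0,\infty)$, of the stochastic Galerkin system $$\hat{E}\,\dot{\hat{v}}(t) = \hat{A}\hat{v}(t) + \hat{B}u(t), \qquad \hat{w}(t) = \hat{C}\hat{v}(t), \qquad t \ge 0,$$ associated with $\mathcal{I}$, where $\hat{w} = (\hat{w}_i)_{i \in \mathcal{I}}$. Let $\hat{H} = (\hat{H}_i)_{i\in\mathcal{I}}$, $\hat{H}(s) = \hat{C}(s\hat{E}-\hat{A})^{-1}\hat{B}$, be its transfer function. Define $$\hat{y}^{(\mathcal{I})}(t,p) = \sum_{i\in\mathcal{I}} \hat{w}_i(t)\Phi_i(p), \qquad \tilde{y}^{(\mathcal{I}')}(t,p) = \sum_{i\in\mathcal{I}'} \hat{w}_i(t)\Phi_i(p).$$ (i) If the Galerkin system is stable and strictly proper, then $$\sup_{t\ge 0} \left\| \hat{y}^{(\mathcal{I})}(t,\cdot) - \tilde{y}^{(\mathcal{I}')}(t,\cdot) \right\|_{\mathcal{L}^2(\Omega)} \le \sqrt{\sum_{i\in\mathcal{I}\setminus\mathcal{I}'} \left\| \hat{H}_i \right\|_{\mathcal{H}_2}^2}\;\; \|u\|_{\mathcal{L}^2[0,\infty)} .$$ (ii) If the Galerkin system is stable and proper, then $$\left\| \hat{y}^{(\mathcal{I})} - \tilde{y}^{(\mathcal{I}')}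 \right\|_{\mathcal{L}^2(\Omega)\times\mathcal{L}^2[0,\infty)} \le \sqrt{\sum_{i\in\mathcal{I}\setminus\mathcal{I}'} \left\| \hat{H}_i \right\|_{\mathcal{H}_\infty}^2}\;\; \|u\|_{\mathcal{L}^2[0,\infty)} .$$
   Context: Random parameters. $\Pi \subseteq \mathbb{R}^q$ is the parameter domain and $\rho : \Pi \to \mathbb{R}$ a probability density. $\mathcal{L}^2(\Pi,\rho)$ is the Hilbert space of measurable $f:\Pi\to\mathbb{R}$ with $\mathbb{E}[f^2]<\infty$, where $\mathbb{E}[f] = \int_\Pi f(p)\rho(p)\,dp$, with inner product $\langle f,g\rangle = \mathbb{E}[fg]$ and norm $\|f\|_{\mathcal{L}^2(\Omega)} = \sqrt{\langle f,f\rangle}$. $(\Phi_i)_{i\in\mathbb{N}} \subset \mathcal{L}^2(\Pi,\rho)$ is a complete orthonormal system with $\Phi_1 \equiv 1$. Underlying system. For each $p\in\Pi$ there is a single-input-single-output linear system $E(p)\dot{x}(t,p) = A(p)x(t,p)+B(p)u(t)$, $y(t,p)=C(p)x(t,p)$, $x(0,p)=0$, with $A(p),E(p)\in\mathbb{R}^{n\times n}$ ($E(p)$ possibly singular), $B(p)\in\mathbb{R}^{n\times 1}$, $C(p)\in\mathbb{R}^{1\times n}$; the pencil $\lambda E(p)-A(p)$ is regular and all its finite eigenvalues have negative real part, for every $p \in \Pi$. Stochastic Galerkin system. For a finite index set $\mathcal{I}$ with $m=|\mathcal{I}|$, the constant matrices $\hat{A},\hat{E}\in\mathbb{R}^{mn\times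 mn}$, $\hat{B}\in\mathbb{R}^{mn}$, $\hat{C}\in\mathbb{R}^{m\times mn}$ are obtained by Galerkin projection: they consist of blocks indexed by $i,j\in\mathcal{I}$, the $(i,j)$ blocks of $\hat{A},\hat{E},\hat{C}$ being $\mathbb{E}[\Phi_i\Phi_j A]$, $\mathbb{E}[\Phi_i\Phi_j E]$, $\mathbb{E}[\Phi_i\Phi_j C]$ and the $i$-th block of $\hat{B}$ being $\mathbb{E}[\Phi_i B]$ (expectations taken entrywise and assumed to exist). The state is $\hat{v}(t)\in\mathbb{R}^{mn}$, the output $\hat{w}(t)\in\mathbb{R}^m$. The components of $\hat{w}$ and $\hat{H}$ are indexed by $i\in\mathcal{I}$. The pencil $\lambda\hat{E}-\hat{A}$ is regular, so that $\hat{H}(s)\in\mathbb{C}^m$ is a vector of rational functions defined outside a finite set of poles. Stability and properness. A linear system is stable if all finite eigenvalues of its matrix pencil have negative real part; it is proper if its transfer function has a finite limit as $s\to\infty$, and strictly proper if this limit is zero. Norms. For a scalar transfer function $G$, $\|G\|_{\mathcal{H}_\infty} = \sup_{\omega\in\mathbb{R}} |G(\mathrm{i}\omega)|$ and $\|G\|_{\mathcal{H}_2} = \sqrt{\frac{1}{2\pi}\int_{-\infty}^{\infty} |G(\mathrm{i}\omega)|^2\,d\omega}$. Further, $\|u\|_{\mathcal{L}^2[0,\infty)} = \sqrt{\int_0^\infty u(t)^2\,dt}$ and $\|z\|_{\mathcal{L}^2(\Omega)\times\mathcal{L}^2[0,\infty)} = \sqrt{\int_0^\infty\int_\Pi z(t,p)^2\rho(p)\,dp\,dt}$.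 *)

(* Defs.v *)
From HB Require Import structures.
From mathcomp Require Import all_boot all_order all_algebra.
From mathcomp Require Import finmap.
From mathcomp Require Import all_classical all_reals all_analysis.
From mathcomp Require Import complex.

Set Implicit Arguments.
Unset Strict Implicit.
Unset Printing Implicit Defensive.

Import Order.TTheory GRing.Theory Num.Theory.
Import numFieldNormedType.Exports.

Local Open Scope classical_set_scope.
Local Open Scope ring_scope.

(* Lebesgue measure on R^q = q.-tuple R (Borel sigma-algebra), as an iterated
   product; lebesgue_tuple_box checks the normalisation. *)
Section LebesgueTuple.
Context {R : realType}.

Definition consT q (z : measurableTypeR R * q.-tuple R) : q.+1.-tuple R :=
  [the q.+1.-tuple R of z.1 :: z.2].

Lemma measurable_consT q :
  measurable_fun [set: measurableTypeR R * q.-tuple R] (@consT q).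
Proof.
apply: (@measurable_cons _ _ (measurableTypeR R * q.-tuple R)%type R fst q snd).
  exact: (@measurable_fst _ _ (measurableTypeR R) (q.-tuple R)).
exact: measurable_snd.
Qed.

Section Step.
Variables (q : nat) (mu : {sigma_finite_measure set (q.-tuple R) -> \bar R}).

Definition lebesgue_cons : set (q.+1.-tuple R) -> \bar R :=
  pushforward (@lebesgue_measure R \x mu)%E (@consT q).

Let lebesgue_cons0 : lebesgue_cons set0 = 0%E.
Proof. by rewrite /lebesgue_cons /pushforward preimage_set0 measure0. Qed.

Let lebesgue_cons_ge0 X : (0 <= lebesgue_cons X)%E.
Proof. by rewrite /lebesgue_cons /pushforward measure_ge0. Qed.

Let lebesgue_cons_sigma_additive : semi_sigma_additive lebesgue_cons.
Proof.
move=> F mF tF mUF; rewrite /lebesgue_cons /pushforward preimage_bigcup.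
apply: measure_semi_sigma_additive.
- by move=> k; rewrite -[X in measurable X]setTI; exact: measurable_consT.
- apply/trivIsetP => /= i j _ _ ij; rewrite -preimage_setI.
  by move/trivIsetP : tF => /(_ _ _ _ _ ij) ->//; rewrite preimage_set0.
- rewrite -preimage_bigcup -[X in measurable X]setTI.
  exact: measurable_consT.
Qed.

HB.instance Definition _ := isMeasure.Build _ _ _ lebesgue_cons
  lebesgue_cons0 lebesgue_cons_ge0 lebesgue_cons_sigma_additive.

Lemma sigma_finite_lebesgue_cons : sigma_finite setT lebesgue_cons.
Proof.
have /sigma_finiteP[F [TF ndF Foo]] := sigma_finiteT (@lebesgue_measure R).
have /sigma_finiteP[G [TG ndG Goo]] := sigma_finiteT mu.
pose uncons (x : q.+1.-tuple R) : R * q.-tuple R := (thead x, [tuple of behead x]).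
have unconsK x : consT (uncons x) = x.
  by apply/val_inj => /=; case: x => -[].
have consTK z : uncons (consT z) = z.
  by case: z => a t; congr pair; apply/val_inj.
have muncons : measurable_fun setT uncons.
  apply: (@measurable_fun_pair _ _ _ (q.+1.-tuple R) (measurableTypeR R)
    (q.-tuple R)); first exact: (@measurable_tnth _ R).
  exact: measurable_behead.
exists (fun k => uncons @^-1` (F k `*` G k)).
  apply/seteqP; split => // x _.
  have [i _ Fi] : (\bigcup_i F i) (uncons x).1 by rewrite -TF.
  have [j _ Gj] : (\bigcup_i G i) (uncons x).2 by rewrite -TG.
  exists (maxn i j) => //; split.
  - by move: Fi; apply/subsetPset/ndF/leq_maxl.
  - by move: Gj; apply/subsetPset/ndG/leq_maxr.
move=> k; have [mF Fk] := Foo k; have [mG Gk] := Goo k; split.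
  by rewrite -[X in measurable X]setTI; apply: muncons => //; exact: measurableX.
rewrite /lebesgue_cons /pushforward.
have -> : @consT q @^-1` (uncons @^-1` (F k `*` G k)) = F k `*` G k.
  by apply/seteqP; split => z; rewrite /preimage/mkset consTK.
by rewrite product_measure1E// lte_mul_pinfty// ge0_fin_numE.
Qed.

HB.instance Definition _ := Measure_isSigmaFinite.Build _ _ _ lebesgue_cons
  sigma_finite_lebesgue_cons.

End Step.

Fixpoint lebesgue_tuple q : {sigma_finite_measure set (q.-tuple R) -> \bar R} :=
  match q with
  | 0%N => \d_([tuple] : 0.-tuple R)
  | q'.+1 => lebesgue_cons (lebesgue_tuple q')
  end.

Lemma lebesgue_tuple_box q (a b : 'I_q -> R) : (forall i, a i <= b i) ->
  lebesgue_tuple q [set x | forall i, a i <= tnth x i <= b i] =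
  (\prod_(i < q) (b i - a i))%:E.
Proof.
elim: q a b => [|q IH] a b ab /=.
  rewrite big_ord0 diracE mem_set//=; by case.
pose box := [set x : q.-tuple R | forall i,
  a (lift ord0 i) <= tnth x i <= b (lift ord0 i)].
rewrite /lebesgue_cons /pushforward.
rewrite (_ : _ @^-1` _ = `[a ord0, b ord0] `*` box); last first.
  apply/seteqP; split => -[x t] /=.
    move=> H; split; first by have := H ord0; rewrite /= in_itv/=.
    by move=> i /=; have := H (lift ord0 i); rewrite tnthS.
  rewrite in_itv/= => -[H0 H1] i; case: (unliftP ord0 i) => [j|] -> //.
  by rewrite tnthS; exact: H1.
have mbox : measurable box.
  rewrite (_ : box = \bigcap_(i in [set: 'I_q])
    ((fun x : q.-tuple R => tnth x i) @^-1` `[a (lift ord0 i), b (lift ord0 i)])).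
    apply: fin_bigcap_measurable => // i _.
    by rewrite -[X in measurable X]setTI; apply: measurable_tnth.
  apply/seteqP; split => x /= H i; last by have := H i I; rewrite /= in_itv.
  by move=> _; have := H i; rewrite /= in_itv.
rewrite product_measure1E//= lebesgue_measure_itv/= IH//.
rewrite big_ord_recl EFinM lte_fin; congr (_ * _)%E.
case: ltP => // ba; suff -> : b ord0 = a ord0 by rewrite subrr.
by apply/eqP; rewrite eq_le ba ab.
Qed.

End LebesgueTuple.

Section RandomParameters.
Context {R : realType} (q : nat).
Variables (Pi : set (q.-tuple R)) (rho : q.-tuple R -> R).
Implicit Types f : q.-tuple R -> R.

Definition probability_density : Prop :=
  [/\ measurable_fun Pi rho, forall p, Pi p -> 0 <= rho p &
      (\int[lebesgue_tuple q]_(p in Pi) (rho p)%:E = 1)%E].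

Definition has_expectation f : Prop :=
  (lebesgue_tuple q).-integrable Pi (fun p => (f p * rho p)%:E).

Definition expectation f : R :=
  \int[lebesgue_tuple q]_(p in Pi) (f p * rho p).

Definition has_expectation_mx a b (M : q.-tuple R -> 'M[R]_(a, b)) : Prop :=
  forall i j, has_expectation (fun p => M p i j).

Definition expectation_mx a b (M : q.-tuple R -> 'M[R]_(a, b)) : 'M[R]_(a, b) :=
  \matrix_(i, j) expectation (fun p => M p i j).

Definition sqnormL2 f : \bar R :=
  (\int[lebesgue_tuple q]_(p in Pi) (f p ^+ 2 * rho p)%:E)%E.

Definition normL2 f : \bar R := sqrte (sqnormL2 f).

Definition inL2 f : Prop := measurable_fun Pi f /\ (sqnormL2 f < +oo)%E.

(* Indices start at 0: Phi 0 is the function usually written Phi_1. *)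
Definition complete_orthonormal (Phi : nat -> q.-tuple R -> R) : Prop :=
  [/\ forall i, inL2 (Phi i),
      forall i j, expectation (fun p => Phi i p * Phi j p) = (i == j)%:R &
      forall f, inL2 f -> (forall i, expectation (fun p => f p * Phi i p) = 0) ->
        normL2 f = 0%E].

End RandomParameters.

(* E x' = A x + B u, y = C x with N states, one input and m outputs. *)
Section LinearSystem.
Context {R : realType} {N m : nat}.
Variables (E A : 'M[R]_N) (B : 'cV[R]_N) (C : 'M[R]_(m, N)).

Definition complex_mx a b (M : 'M[R]_(a, b)) : 'M[R[i]]_(a, b) :=
  map_mx (fun x : R => (x +i* 0)%C) M.

Definition pencil (s : R[i]) : 'M[R[i]]_N := s *: complex_mx E - complex_mx A.

Definition regular_pencil : Prop := exists s, \det (pencil s) != 0.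

Definition finite_eigenvalue (s : R[i]) : Prop := \det (pencil s) = 0.

Definition stable_system : Prop :=
  forall s, finite_eigenvalue s -> complex.Re s < 0.

(* invmx is the identity on singular matrices, so the value is meaningful only
   away from the finite eigenvalues. *)
Definition transfer (s : R[i]) : 'cV[R[i]]_m :=
  complex_mx C *m invmx (pencil s) *m complex_mx B.

Definition transfer_limit (L : 'cV[R[i]]_m) : Prop :=
  forall e : R, 0 < e -> exists r : R, forall s : R[i],
    r < ComplexField.Normc.normc s ->
    forall k, ComplexField.Normc.normc (transfer s k 0 - L k 0) < e.

Definition proper_system : Prop := exists L, transfer_limit L.

Definition strictly_proper_system : Prop := transfer_limit 0.

(* Solution with zero initial state for a locally integrable input u.  E may be
   singular and u is only square integrable, so v itself need not be
   differentiable; the differential equation is meant in the sense of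
   Caratheodory for E v: E v is absolutely continuous, vanishes at 0 and has
   derivative A v + B u almost everywhere.  This is written in integrated form. *)
Definition solution (u : R -> R) (v : R -> 'cV[R]_N) (w : R -> 'cV[R]_m) : Prop :=
  [/\ v 0 = 0,
      forall (T : R) k, 0 <= T ->
        (@lebesgue_measure R).-integrable `[0, T] (fun t => (v t k 0)%:E),
      forall (t : R) k, 0 <= t ->
        (E *m v t) k 0 =
        \int[@lebesgue_measure R]_(s in `[0, t]) ((A *m v s + u s *: B) k 0) &
      forall t : R, 0 <= t -> w t = C *m v t].

End LinearSystem.

Section TransferNorms.
Context {R : realType}.
Implicit Type G : R[i] -> R[i].

Definition normHinf G : \bar R :=
  ereal_sup [set (ComplexField.Normc.normc (G (0 +i* omega)%C))%:E
            | omega in [set: R]].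

Definition normH2 G : \bar R :=
  sqrte (((2 * pi)^-1)%:E *
    \int[@lebesgue_measure R]_omega
      ((ComplexField.Normc.normc (G (0 +i* omega)%C)) ^+ 2)%:E)%E.

End TransferNorms.

Section Input.
Context {R : realType} (u : R -> R).

Definition norm_input : \bar R :=
  sqrte (\int[@lebesgue_measure R]_(t in `[0%R, +oo[) (u t ^+ 2)%:E)%E.

Definition input_L2 : Prop :=
  measurable_fun (`[0, +oo[ : set R) u /\ (norm_input < +oo)%E.

End Input.

(* Positions k < m = |I| enumerate the index set I; idx k is the element of I at
   position k, so component k of the output stands for the index idx k. *)
Section Galerkin.
Context {R : realType} (q n : nat).
Variables (Pi : set (q.-tuple R)) (rho : q.-tuple R -> R).
Variables (Phi : nat -> q.-tuple R -> R) (I : {fset nat}).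

Definition idx (k : 'I_#|` I|) : nat := nth 0%N (enum_fset I) k.

Definition galerkin_mx (M : q.-tuple R -> 'M[R]_n) :
    'M[R]_(\sum_(k < #|` I|) n) :=
  \mxblock_(k < #|` I|, l < #|` I|)
    expectation_mx Pi rho (fun p => (Phi (idx k) p * Phi (idx l) p) *: M p).

Definition galerkin_input (B : q.-tuple R -> 'cV[R]_n) :
    'cV[R]_(\sum_(k < #|` I|) n) :=
  \mxcol_(k < #|` I|) expectation_mx Pi rho (fun p => Phi (idx k) p *: B p).

Definition galerkin_output (C : q.-tuple R -> 'rV[R]_n) :
    'M[R]_(#|` I|, \sum_(k < #|` I|) n) :=
  \mxrow_(l < #|` I|) \matrix_(k < #|` I|, b < n)
    expectation Pi rho (fun p => Phi (idx k) p * Phi (idx l) p * C p 0 b).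

Definition galerkin_expectations_exist
    (E A : q.-tuple R -> 'M[R]_n) (B : q.-tuple R -> 'cV[R]_n)
    (C : q.-tuple R -> 'rV[R]_n) : Prop :=
  [/\ forall k l : 'I_#|` I|, has_expectation_mx Pi rho
        (fun p => (Phi (idx k) p * Phi (idx l) p) *: A p),
      forall k l : 'I_#|` I|, has_expectation_mx Pi rho
        (fun p => (Phi (idx k) p * Phi (idx l) p) *: E p),
      forall k l : 'I_#|` I|, has_expectation_mx Pi rho
        (fun p => (Phi (idx k) p * Phi (idx l) p) *: C p) &
      forall k : 'I_#|` I|, has_expectation_mx Pi rho
        (fun p => Phi (idx k) p *: B p)].

Definition yhat (w : R -> 'cV[R]_#|` I|) (t : R) (p : q.-tuple R) : R :=
  \sum_(k < #|` I|) w t k 0 * Phi (idx k) p.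

Definition ytilde (I' : {fset nat}) (w : R -> 'cV[R]_#|` I|)
    (t : R) (p : q.-tuple R) : R :=
  \sum_(k < #|` I| | idx k \in I') w t k 0 * Phi (idx k) p.

End Galerkin.

(* The norm of L2(Omega) x L2[0, oo). *)
Definition normL2L2 {R : realType} q (Pi : set (q.-tuple R))
    (rho : q.-tuple R -> R) (z : R -> q.-tuple R -> R) : \bar R :=
  sqrte (\int[@lebesgue_measure R]_(t in `[0%R, +oo[) sqnormL2 Pi rho (z t))%E.

(* Main.v *)
Require Import Defs.
From HB Require Import structures.
From mathcomp Require Import all_boot all_order all_algebra.
From mathcomp Require Import finmap.
From mathcomp Require Import all_classical all_reals all_analysis.
From mathcomp Require Import complex.
From mathcomp Require Import measurable_realfun ring lra zify.

(** Both bounds reduce, by the orthonormality of the basis functions, to one bound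
    for each component w_k of the output of a stable descriptor system:
    sup |w_k| <= |H_k|_2 |u| in the first part, |w_k| <= |H_k|_oo |u| in the second.
    The textbook proof of these two bounds is Plancherel's theorem for the Fourier
    transform.  The transfer functions being rational, they are obtained here from
    ordinary differential equations and algebra alone.

    Reduction to a scalar equation.  Multiplying the system by the adjugate of the
    pencil s E - A gives a(D) w_k = b_k(D) u with a = det (s E - A) and
    H_k = b_k / a.  The state being only locally integrable, D is avoided: with
    J the primitive that vanishes at 0, the meaningful operators are the J^M p(D)
    with deg p <= M, called diffop below.  Properness bounds the degree of b_k by
    that of a (poly_growth), and the roots of a lie in the left half-plane.  Solving
    a(D) x_0 = u one root at a time and writing x for the d-th derivative of x_0,
    d = deg a, one gets u = J^d a(D) x and, almost everywhere, w_k = J^d b_k(D) x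
    (realisation); uniqueness holds because a stable first-order homogeneous
    equation with zero initial value has no other solution than 0.

    Peak bound (h2_peak_gain).  Removing a root m of a writes H as
    c / (s - m) + (s + m^* ) / (s - m) H', where H' has one pole less.  In the time
    domain, the state J y of the first-order section and the output f of the
    all-pass factor satisfy 2 |Re m| |J y(T)|^2 = int_0^T |u|^2 - int_0^T |f|^2, so
    that by induction |w(T)|^2 <= S int_0^T |u|^2, where S is a sum of the
    |c|^2 / (2 |Re m|).  In the frequency domain, the two terms are orthogonal
    because a stable rational function of relative degree at least 2 has integral 0
    over the imaginary axis (cPV_rational, proved by partial fractions), whence
    2 pi S is the integral of |H|^2.

    Energy bound (hinf_energy_gain).  The derivatives x_0, ..., x_d are square
    integrable, and integrating by parts shows that their Gram matrix is, up to
    signs, a Hankel matrix.  Hence the squared norm of p(D) x_0 is L (p p^#) for one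
    linear functional L on polynomials, where p^# (s) is the conjugate of
    p (- s^* ).  If g > |H|^2 on the imaginary axis, then g a a^# - b b^# is
    positive there and so equals c c^# for some polynomial c
    (spectral_factorization); applying L gives |w|^2 + |c(D) x_0|^2 = g |u|^2. *)

Set Implicit Arguments.
Unset Strict Implicit.
Unset Printing Implicit Defensive.

Import Order.TTheory GRing.Theory Num.Theory.
Import numFieldNormedType.Exports.

Local Open Scope classical_set_scope.
Local Open Scope ring_scope.

(** * Primitives of locally integrable functions *)

Section Primitive.
Context {R : realType}.
Notation mu := (@lebesgue_measure R).
Implicit Types f g : R -> R.

(** Integrability on every interval [0, T]; values at negative times are
    irrelevant, as for [primitive], which is 0 there. *)
Definition locint f := forall T : R, mu.-integrable `[0, T] (EFin \o f).

Definition primitive f (t : R) : R := \int[mu]_(s in `[0, t]) f s.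

Lemma locint_cst c : locint (cst c).
Proof.
move=> T; apply: continuous_compact_integrable; first exact: segment_compact.
by apply: continuous_subspaceT => x; exact: cst_continuous.
Qed.

Lemma locintD f g : locint f -> locint g -> locint (f \+ g).
Proof. by move=> hf hg T; apply: (integrableD _ (hf T) (hg T)). Qed.

Lemma locintZ c f : locint f -> locint (fun t => c * f t).
Proof. by move=> hf T; apply: (integrableZl _ c (hf T)). Qed.

Lemma eq_locint f g : {in `[0, +oo[, f =1 g} -> locint f -> locint g.
Proof.
move=> fg hf T; apply: eq_integrable (hf T) => //= x; rewrite inE/= in_itv/=.
by move=> /andP[x0 _]; rewrite fg// in_itv/= x0.
Qed.

Lemma locint_meas f (T : R) : locint f -> measurable_fun `[0, T] f.
Proof. by move=> /(_ T)/integrableP[/measurable_EFinP]. Qed.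

Lemma eq_primitive f g : {in `[0, +oo[, f =1 g} -> primitive f =1 primitive g.
Proof.
move=> fg t; apply: eq_Rintegral => x; rewrite inE/= in_itv/= => /andP[x0 _].
by rewrite fg// in_itv/= x0.
Qed.

Lemma primitive_lt0 f t : t < 0 -> primitive f t = 0.
Proof.
move=> t0; rewrite /primitive set_itv_ge ?Rintegral_set0//.
by rewrite bnd_simp -ltNge.
Qed.

Lemma primitive0 t : primitive (fun=> 0) t = 0.
Proof. by rewrite /primitive Rintegral_cst// mul0r. Qed.

Lemma primitiveD f g : locint f -> locint g ->
  primitive (f \+ g) = primitive f \+ primitive g.
Proof. by move=> hf hg; apply/funext => t; rewrite /primitive RintegralD. Qed.

Lemma primitiveZ c f : locint f ->
  primitive (fun t => c * f t) = (fun t => c * primitive f t).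
Proof. by move=> hf; apply/funext => t; rewrite /primitive RintegralZl. Qed.

Lemma le_primitive f g t : locint f -> locint g ->
  (forall s, 0 <= s -> f s <= g s) -> primitive f t <= primitive g t.
Proof.
move=> hf hg fg; apply: le_Rintegral => // s /=; rewrite in_itv/= => /andP[s0 _].
exact: fg.
Qed.

Lemma primitive_ge0 f t : (forall s, 0 <= s -> 0 <= f s) -> 0 <= primitive f t.
Proof.
move=> f0; apply: Rintegral_ge0 => s /=; rewrite in_itv/= => /andP[s0 _].
exact: f0.
Qed.

Lemma locint_norm f : locint f -> locint (fun t => `|f t|).
Proof. by move=> hf T; apply: integrable_norm (hf T). Qed.

Lemma primitive_continuous f T : locint f ->
  {within `[0, T], continuous (primitive f)}.
Proof.
move=> hf; have [T0|T0] := leP 0 T.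
  exact: parameterized_integral_continuous.
rewrite set_itv_ge ?bnd_simp -?ltNge//.
exact: continuous_subspace0.
Qed.

Lemma locint_primitive f : locint f -> locint (primitive f).
Proof.
move=> hf T; apply: continuous_compact_integrable; first exact: segment_compact.
exact: primitive_continuous.
Qed.

Lemma locint_mul_bounded f g : locint f ->
  (forall T : R, measurable_fun `[0, T] g) ->
  (forall T : R, exists M : R, forall t, 0 <= t <= T -> `|g t| <= M) ->
  locint (fun t => f t * g t).
Proof.
move=> hf mg bg T; have [M gM] := bg T.
apply: (@le_integrable _ _ _ mu _ _ _ (EFin \o (fun t => M * f t))) => //.
- apply/measurable_EFinP; apply: measurable_funM; [exact: locint_meas|exact: mg].
- move=> t /=; rewrite in_itv/= => t0T; rewrite lee_fin !normrM mulrC.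
  rewrite ler_wpM2r//; apply: (le_trans (gM _ t0T)); exact: ler_norm.
- exact: locintZ.
Qed.

Lemma normr_primitive_le f T t : locint f -> t <= T ->
  `|primitive f t| <= primitive (fun s => `|f s|) T.
Proof.
move=> hf tT; apply: (le_trans (le_normr_Rintegral _ (hf t))) => //.
rewrite /primitive -lee_fin /Rintegral !fineK.
- apply: ge0_subset_integral => //=.
  + by apply/measurable_EFinP/measurableT_comp => //; exact: locint_meas.
  + by move=> s /=; rewrite !in_itv/= => /andP[-> /le_trans->].
- by apply: integrable_fin_num => //; exact: (locint_norm hf).
- by apply: integrable_fin_num => //; exact: (locint_norm hf).
Qed.

Lemma primitive_bounded f : locint f ->
  forall T : R, exists M : R, forall t, 0 <= t <= T -> `|primitive f t| <= M.
Proof.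
move=> hf T; exists (primitive (fun s => `|f s|) T) => t /andP[_].
exact: normr_primitive_le.
Qed.

Lemma locint_mulprimitive f g : locint f -> locint g ->
  locint (fun t => f t * primitive g t).
Proof.
move=> hf hg; apply: locint_mul_bounded => //.
- by move=> T; apply: locint_meas; exact: locint_primitive.
- exact: primitive_bounded.
Qed.

Lemma integrable_mask f (P : R -> bool) :
  measurable_fun setT P -> mu.-integrable setT (EFin \o f) ->
  mu.-integrable setT (fun r => (f r * (P r)%:R)%:E).
Proof.
move=> mP hf; apply: (le_integrable _ _ _ hf) => //.
  apply/measurable_EFinP; apply: measurable_funM => //.
    by apply/measurable_EFinP; exact: (measurable_int mu hf).
  exact: (measurableT_comp (f := fun b : bool => b%:R : R)).
move=> r _ /=; rewrite lee_fin normrM ler_piMr//.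
by case: (P r) => /=; rewrite ?normr1 ?normr0.
Qed.

(** The strict inequality, rather than a weak one, makes this indicator and the one
    of the next lemma two sections of the same subset of the plane. *)
Lemma integral_restrict_lt f (t : R) : locint f -> forall s : R, 0 <= s <= t ->
  (\int[mu]_r (f \_ `[0%R, t] r * (r < s)%R%:R)%:E = (primitive f s)%:E)%E.
Proof.
move=> hf s /andP[s0 st].
transitivity (\int[mu]_(r in `[0%R, s[) (f r)%:E)%E.
  rewrite [RHS]integral_mkcond; apply: eq_integral => r _.
  rewrite !patchE !mem_setE !in_itv/=.
  case: (leP 0 r) => r0; rewrite /= ?mul0r//.
  case: (ltP r s) => rs; rewrite ?mulr0//=.
  by rewrite (le_trans (ltW rs) st) mulr1.
rewrite integral_itv_bndo_bndc; last first.
  apply: (@measurable_funS _ _ _ _ `[0, s]) => //.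
    by apply: subset_itvl; rewrite bnd_simp.
  exact: (measurable_int _ (hf s)).
by rewrite /primitive/Rintegral fineK//; apply: integrable_fin_num.
Qed.

Lemma integral_restrict_gt f (t : R) : locint f -> forall s : R, 0 <= s <= t ->
  (\int[mu]_r (f \_ `[0%R, t] r * (s < r)%R%:R)%:E =
   (primitive f t - primitive f s)%:E)%E.
Proof.
move=> hf s /andP[s0 st].
transitivity (\int[mu]_(r in `]s, t]) (f r)%:E)%E.
  rewrite [RHS]integral_mkcond; apply: eq_integral => r _.
  rewrite !patchE !mem_setE !in_itv/=.
  case: (ltP s r) => rs; rewrite ?mulr0//= mulr1.
  by rewrite (le_trans s0 (ltW rs))/=; case: ifP.
rewrite /primitive (Rintegral_itvB (hf t)) ?bnd_simp//.
rewrite /Rintegral fineK//; apply: integrable_fin_num => //.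
apply: integrableS (hf t) => //.
by apply: subset_itvr; rewrite bnd_simp.
Qed.

(** Integration by parts for functions that have only integrable derivatives:
    Fubini's theorem for f s * g r on the part r < s of the square. *)
Lemma primitiveM f g : locint f -> locint g -> forall t,
  primitive f t * primitive g t =
  primitive (fun s => f s * primitive g s + g s * primitive f s) t.
Proof.
move=> hf hg t; have [t0|t0] := ltP t 0.
  by rewrite !(primitive_lt0 _ t0) mul0r.
have hfg := locint_mulprimitive hf hg; have hgf := locint_mulprimitive hg hf.
have hgf' : locint (fun s => g s * (primitive f t - primitive f s)).
  apply: eq_locint (locintD (locintZ (primitive f t) hg) (locintZ (-1) hgf)).
  by move=> s _ /=; ring.
pose f0 := f \_ `[0%R, t]; pose g0 := g \_ `[0%R, t].
have restr_meas (h : R -> R) : locint h -> measurable_fun setT (h \_ `[0%R, t]).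
  by move=> hh; apply/(measurable_restrictT _ _).1 => //; exact: locint_meas.
have restr_int (h : R -> R) : locint h ->
    mu.-integrable setT (EFin \o (h \_ `[0%R, t])).
  by move=> hh; rewrite -restrict_EFin; apply/integrable_restrict; rewrite ?setTI.
pose S := [set z : R * R | z.2 < z.1].
have mS : measurable S.
  rewrite -[S]setTI; apply: measurable_fun_ltr measurableT [set true] _ => //.
pose F0 (z : R * R) := f0 z.1 * g0 z.2.
have mF0 : measurable_fun setT F0.
  by apply: measurable_funM; apply: measurableT_comp => //; exact: restr_meas.
have iF0 : (mu \x mu)%E.-integrable setT (EFin \o F0).
  apply/(integrable12ltyP _ _ _).2; first exact/measurable_EFinP.
  have /integrableP[_ fy] := restr_int f hf.
  have /integrableP[mg gy] := restr_int g hg.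
  rewrite [ltLHS](_ : _ = \int[mu]_x (`|(EFin \o f0) x| *
      \int[mu]_y `|(EFin \o g0) y|))%E; last first.
    apply: eq_integral => x _; rewrite -ge0_integralZl//; last exact: measurableT_comp.
    by apply: eq_integral => y _; rewrite /F0/= normrM EFinM.
  rewrite ge0_integralZr//; last 2 first.
    by apply: measurableT_comp => //; exact: (measurable_int mu (restr_int f hf)).
    exact: integral_ge0.
  by rewrite lte_mul_pinfty// ?integral_ge0// ge0_fin_numE// integral_ge0.
pose F (z : R * R) : \bar R := (F0 z * (\1_S z : R))%:E.
have iF : (mu \x mu)%E.-integrable setT F.
  apply: le_integrable iF0 => //.
    apply/measurable_EFinP; apply: measurable_funM => //.
  move=> z _ /=; rewrite lee_fin normrM ler_piMr// indicE.
  by case: (_ \in _) => /=; rewrite ?normr1 ?normr0.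
have := Fubini iF.
have -> : (\int[mu]_x \int[mu]_y F (x, y) =
  (primitive (fun s => f s * primitive g s) t)%:E)%E.
  rewrite /primitive/Rintegral fineK; last exact: integrable_fin_num.
  rewrite [RHS]integral_mkcond; apply: eq_integral => x _.
  rewrite patchE; case: ifPn => [|xt]; last first.
    by rewrite integral0_eq// => y _; rewrite /F/F0/= /f0 patchE (negbTE xt) !mul0r.
  rewrite mem_setE in_itv/= => xt.
  rewrite EFinM -(integral_restrict_lt hg xt) -integralZl//; last first.
    by apply: integrable_mask (restr_int _ hg); exact: measurable_fun_ltr.
  apply: eq_integral => y _; rewrite /F /F0/= -EFinM mulrA; congr (_ * _ * _)%:E.
    by rewrite /f0 patchE mem_setE in_itv/= xt.
  by rewrite indicE /S; congr (_%:R); rewrite mem_setE.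
have -> : (\int[mu]_y \int[mu]_x F (x, y) =
  (primitive (fun s => g s * (primitive f t - primitive f s)) t)%:E)%E.
  rewrite /primitive/Rintegral fineK; last first.
    by apply: integrable_fin_num => //; exact: hgf'.
  rewrite [RHS]integral_mkcond; apply: eq_integral => x _.
  rewrite patchE; case: ifPn => [|xt]; last first.
    rewrite integral0_eq// => y _; rewrite /F/F0/= /g0 [X in _ * X * _]patchE.
    by rewrite (negbTE xt) mulr0 mul0r.
  rewrite mem_setE in_itv/= => xt.
  rewrite EFinM -[X in (_ * X%:E)%E]/(_ - primitive f x).
  rewrite -(integral_restrict_gt hf xt) -integralZl//; last first.
    by apply: integrable_mask (restr_int _ hf); exact: measurable_fun_ltr.
  apply: eq_integral => y _; rewrite /F /F0/= -EFinM; congr (_%:E).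
  rewrite mulrA [X in X * _]mulrC; congr (_ * _ * _).
    by rewrite /g0 patchE mem_setE in_itv/= xt.
  by rewrite indicE /S; congr (_%:R); rewrite mem_setE.
move=> [E].
rewrite (primitiveD hfg hgf) /= E.
rewrite -[_ + _]/((_ \+ _) t) -primitiveD//.
rewrite (_ : _ \+ _ = fun s => primitive f t * g s); last first.
  by apply/funext => s/=; ring.
by rewrite primitiveZ.
Qed.

Lemma ae_impl (P Q : R -> Prop) :
  {ae mu, forall x, P x} -> (forall x, P x -> Q x) -> {ae mu, forall x, Q x}.
Proof.
move=> [A [mA muA PA]] imp; exists A; split => // x nQ.
by apply: PA => Px; exact/nQ/imp.
Qed.

(** By Lebesgue's differentiation theorem f is almost everywhere the derivative of
    its primitive. *)
Lemma primitive_eq0_ae f : locint f -> (forall t, primitive f t = 0) ->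
  {ae mu, forall t, 0 <= t -> f t = 0}.
Proof.
move=> hf f0.
have main n : {ae mu, forall t, 0 <= t < n%:R -> f t = 0}.
  pose h := f \_ `[0, n%:R].
  have hh : locally_integrable setT h by exact: integrable_locally (hf n%:R).
  (* The left endpoint lies strictly below 0 because the differentiation theorem
     speaks of points strictly above it. *)
  have inth y : mu.-integrable `[-1, y] (EFin \o h).
    rewrite -restrict_EFin; apply/integrable_restrict => //.
    apply: integrableS (hf n%:R) => //; exact: measurableI.
  apply: ae_impl (FTC1 inth hh) _ => t ht /andP[t0 tn].
  have [|_] := ht; first by rewrite lte_fin (lt_le_trans _ t0)// ltrN10.
  rewrite {2}/h patchE mem_setE in_itv/= t0 (ltW tn)/= => <-.
  rewrite derive1E (near_eq_derive (g := cst 0)) ?derive_cst//.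
  near=> x; rewrite /= -(f0 x) /h -Rintegral_mkcondr.
  congr (Rintegral _ _ _); apply/seteqP; split => s /=; rewrite !in_itv/=.
    by move=> [/andP[_ ->] /andP[->]].
  move=> /andP[s0 sx]; rewrite sx s0 (le_trans _ s0) ?lerN10//; split => //.
  by rewrite (le_trans sx)// ltW//; near: x; exact: lt_nbhsl.
apply: ae_impl (ae_foralln main) _ => t ht t0.
apply: (ht (Num.truncn t).+1); rewrite t0/= truncnS_gt//.
Unshelve. all: by end_near. Qed.

End Primitive.

(** * Primitives of complex-valued functions *)

Section ComplexPrimitive.
Context {R : realType}.
Notation C := R[i].
Notation cRe := (@complex.Re R).
Notation cIm := (@complex.Im R).
Notation mu := (@lebesgue_measure R).
Implicit Types (f g : R -> C) (c : C).

Definition clocint f := locint (cRe \o f) /\ locint (cIm \o f).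

Definition cprim f (t : R) : C :=
  (primitive (cRe \o f) t +i* primitive (cIm \o f) t)%C.

Lemma cReD (x y : C) : cRe (x + y) = cRe x + cRe y.
Proof. by case: x y => [? ?] [? ?]. Qed.
Lemma cImD (x y : C) : cIm (x + y) = cIm x + cIm y.
Proof. by case: x y => [? ?] [? ?]. Qed.
Lemma cReM (x y : C) : cRe (x * y) =
  cRe x * cRe y - cIm x * cIm y.
Proof. by case: x y => [? ?] [? ?]. Qed.
Lemma cImM (x y : C) : cIm (x * y) =
  cRe x * cIm y + cIm x * cRe y.
Proof. by case: x y => [? ?] [? ?]. Qed.

Lemma complex_ext (x y : C) : cRe x = cRe y ->
  cIm x = cIm y -> x = y.
Proof. by case: x y => [? ?] [? ?] /= -> ->. Qed.

Lemma clocintD f g : clocint f -> clocint g -> clocint (fun t => f t + g t).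
Proof.
move=> [f1 f2] [g1 g2]; split.
  by apply: eq_locint (locintD f1 g1) => t _ /=; rewrite cReD.
by apply: eq_locint (locintD f2 g2) => t _ /=; rewrite cImD.
Qed.

Lemma clocintZ c f : clocint f -> clocint (fun t => c * f t).
Proof.
move=> [f1 f2]; split.
  apply: eq_locint (locintD (locintZ (cRe c) f1)
    (locintZ (- cIm c) f2)) => t _ /=; rewrite cReM; ring.
apply: eq_locint (locintD (locintZ (cRe c) f2)
  (locintZ (cIm c) f1)) => t _ /=; by rewrite cImM.
Qed.

Lemma clocint0 : clocint (fun=> 0).
Proof. by split; exact: locint_cst. Qed.

Lemma clocint_sum (I : Type) (s : seq I) (P : pred I) (F : I -> R -> C) :
  (forall i, P i -> clocint (F i)) -> clocint (fun t => \sum_(i <- s | P i) F i t).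
Proof.
move=> hF; elim: s => [|i s IH].
  under eq_fun do rewrite big_nil.
  exact: clocint0.
case Pi: (P i); under eq_fun do rewrite big_cons Pi; last exact: IH.
by apply: clocintD => //; exact: hF.
Qed.

Lemma clocint_conj f : clocint f -> clocint (fun t => ((f t)^*)%C).
Proof.
move=> [f1 f2]; split.
  by apply: eq_locint f1 => t _ /=; case: (f t).
by apply: eq_locint (locintZ (-1) f2) => t _ /=; case: (f t) => a b /=; rewrite mulN1r.
Qed.

Lemma clocint_real (f : R -> R) : locint f -> clocint (fun t => (f t)%:C%C).
Proof. by split => //; exact: locint_cst. Qed.

Lemma clocint_cprim f : clocint f -> clocint (cprim f).
Proof. by move=> [f1 f2]; split; exact: locint_primitive. Qed.

Lemma cprimD f g : clocint f -> clocint g ->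
  cprim (fun t => f t + g t) = (fun t => cprim f t + cprim g t).
Proof.
move=> [f1 f2] [g1 g2]; apply/funext => t; apply: complex_ext => /=.
  transitivity (primitive ((cRe \o f) \+ (cRe \o g)) t).
    by apply: eq_primitive => s _ /=; rewrite cReD.
  by rewrite primitiveD.
transitivity (primitive ((cIm \o f) \+ (cIm \o g)) t).
  by apply: eq_primitive => s _ /=; rewrite cImD.
by rewrite primitiveD.
Qed.

Lemma cprimZ c f : clocint f ->
  cprim (fun t => c * f t) = (fun t => c * cprim f t).
Proof.
move=> [f1 f2]; apply/funext => t; apply: complex_ext; rewrite ?cReM ?cImM /=.
  transitivity (primitive ((fun s => cRe c * cRe (f s)) \+
      (fun s => - cIm c * cIm (f s))) t).
    by apply: eq_primitive => s _ /=; rewrite cReM mulNr.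
  rewrite primitiveD; [|exact: locintZ|exact: locintZ].
  by rewrite /= (primitiveZ _ f1) (primitiveZ _ f2) mulNr.
transitivity (primitive ((fun s => cRe c * cIm (f s)) \+
    (fun s => cIm c * cRe (f s))) t).
  by apply: eq_primitive => s _ /=; rewrite cImM.
rewrite primitiveD; [|exact: locintZ|exact: locintZ].
by rewrite /= (primitiveZ _ f1) (primitiveZ _ f2).
Qed.

Lemma cprim0 : cprim (fun=> 0) = (fun=> 0).
Proof.
by apply/funext => t; apply: complex_ext; rewrite /= /primitive Rintegral_cst// mul0r.
Qed.

Lemma cprim_sum (I : Type) (s : seq I) (P : pred I) (F : I -> R -> C) :
  (forall i, P i -> clocint (F i)) ->
  cprim (fun t => \sum_(i <- s | P i) F i t) =
  (fun t => \sum_(i <- s | P i) cprim (F i) t).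
Proof.
move=> hF; elim: s => [|i s IH].
  under eq_fun do rewrite big_nil.
  under [RHS]eq_fun do rewrite big_nil.
  exact: cprim0.
case Pi: (P i); last first.
  under eq_fun do rewrite big_cons Pi.
  by under [RHS]eq_fun do rewrite big_cons Pi.
under eq_fun do rewrite big_cons Pi.
under [RHS]eq_fun do rewrite big_cons Pi.
rewrite cprimD ?IH//; first exact: hF.
exact: clocint_sum.
Qed.

Lemma cprim_conj f : clocint f ->
  cprim (fun t => ((f t)^*)%C) = (fun t => ((cprim f t)^*)%C).
Proof.
move=> [f1 f2]; apply/funext => t; apply: complex_ext => /=.
  by apply: eq_primitive => s _ /=; case: (f s).
transitivity (primitive (fun s => -1 * cIm (f s)) t).
  by apply: eq_primitive => s _ /=; case: (f s) => a b; rewrite /= mulN1r.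
by rewrite (primitiveZ _ f2) mulN1r.
Qed.

Lemma cprim_lt0 f t : t < 0 -> cprim f t = 0.
Proof. by move=> t0; rewrite /cprim !primitive_lt0. Qed.

Lemma clocint_mulcprim f g : clocint f -> clocint g ->
  clocint (fun t => f t * cprim g t).
Proof.
move=> [f1 f2] [g1 g2]; split.
  apply: eq_locint (locintD (locint_mulprimitive f1 g1)
    (locintZ (-1) (locint_mulprimitive f2 g2))) => t _ /=.
  by rewrite cReM mulN1r.
apply: eq_locint (locintD (locint_mulprimitive f1 g2)
  (locint_mulprimitive f2 g1)) => t _ /=.
by rewrite cImM.
Qed.

(** The real and imaginary parts are sums of real integrations by parts. *)
Lemma cprimM f g : clocint f -> clocint g -> forall t,
  cprim f t * cprim g t = cprim (fun s => f s * cprim g s + g s * cprim f s) t.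
Proof.
move=> hf hg t; have [[f1 f2] [g1 g2]] := (hf, hg).
pose k (x y : R -> R) s := x s * primitive y s + y s * primitive x s.
have lM (x y : R -> R) : locint x -> locint y -> locint (k x y).
  by move=> hx hy; apply: locintD; exact: locint_mulprimitive.
apply: complex_ext; rewrite ?cReM ?cImM /= !primitiveM//.
  transitivity (primitive (k (cRe \o f) (cRe \o g) \+
      (fun s => -1 * k (cIm \o f) (cIm \o g) s)) t).
    rewrite (primitiveD (lM _ _ f1 g1) (locintZ (-1) (lM _ _ f2 g2))).
    by rewrite /= (primitiveZ _ (lM _ _ f2 g2)) mulN1r.
  by apply: eq_primitive => s _ /=; rewrite /k !cReD !cReM /=; ring.
rewrite -[LHS]/((primitive (k _ _) \+ primitive (k _ _)) t) -primitiveD; [|exact: lM f1 g2|exact: lM f2 g1].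
by apply: eq_primitive => s _ /=; rewrite /k !cImD !cImM /=; ring.
Qed.

Lemma Re_cprim f t : cRe (cprim f t) = primitive (cRe \o f) t.
Proof. by []. Qed.

Lemma Im_cprim f t : cIm (cprim f t) = primitive (cIm \o f) t.
Proof. by []. Qed.

End ComplexPrimitive.

(* Otherwise simplification would expose the real and imaginary parts. *)
#[global] Opaque cprim.

(** * First-order linear equations *)

Section FirstOrder.
Context {R : realType}.
Notation C := R[i].
Notation cRe := (@complex.Re R).
Notation cIm := (@complex.Im R).
Notation mu := (@lebesgue_measure R).
Implicit Types (f g h u y : R -> C) (c m z : C).

Definition normsq z : R := cRe z ^+ 2 + cIm z ^+ 2.

Lemma normsq_ge0 z : 0 <= normsq z.
Proof. by rewrite addr_ge0 ?sqr_ge0. Qed.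

Lemma mulConj z : z * (z^*)%C = (normsq z)%:C%C.
Proof. by case: z => a b; apply: complex_ext; rewrite /normsq/=; ring. Qed.

Lemma normsq_eq0 z : normsq z = 0 -> z = 0.
Proof.
case: z => a b /eqP; rewrite /normsq/= paddr_eq0 ?sqr_ge0// !sqrf_eq0.
by move=> /andP[/eqP-> /eqP->].
Qed.

Lemma normsqM z m : normsq (z * m) = normsq z * normsq m.
Proof. by case: z m => [a b] [c d]; rewrite /normsq/=; ring. Qed.

Lemma normsqD_le z m : normsq (z + m) <= 2 * (normsq z + normsq m).
Proof.
case: z m => [a b] [c d]; rewrite /normsq/=.
by rewrite -subr_ge0; have := sqr_ge0 (a - c); have := sqr_ge0 (b - d); nra.
Qed.

Lemma eq_clocint f g : {in `[0, +oo[, f =1 g} -> clocint f -> clocint g.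
Proof.
move=> fg [f1 f2]; split; [apply: eq_locint f1|apply: eq_locint f2] => t t0 /=;
  by rewrite fg.
Qed.

Lemma eq_cprim f g : {in `[0, +oo[, f =1 g} -> cprim f = cprim g.
Proof.
move=> fg; apply/funext => t; apply: complex_ext => /=;
  by apply: eq_primitive => s s0 /=; rewrite fg.
Qed.

(** Energy balance: f is the derivative of cprim f, and |z|^2 has derivative
    2 Re (z' z^* ). *)
Lemma normsq_cprim f t : clocint f -> normsq (cprim f t) =
  primitive (fun s => 2 * cRe (f s * ((cprim f s)^*)%C)) t.
Proof.
move=> hf; have hf' := clocint_conj hf.
have := cprimM hf hf' t; rewrite (cprim_conj hf) mulConj => /(congr1 cRe)/= ->.
apply: eq_primitive => s _ /=; rewrite cReD !cReM /=.
case: (f s) (cprim f s) => [a b] [c d] /=; ring.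
Qed.

Lemma locint_pairing f g : clocint f -> clocint g ->
  locint (fun s => cRe (f s * ((cprim g s)^*)%C)).
Proof.
move=> hf hg; have [+ _] := clocint_mulcprim hf (clocint_conj hg).
by rewrite cprim_conj.
Qed.

Lemma locint_normsq_cprim f : clocint f -> locint (fun s => normsq (cprim f s)).
Proof.
move=> hf; apply: eq_locint (locint_pairing (clocint_cprim hf) hf) => t _.
by rewrite mulConj.
Qed.

(** The state q = cprim f solves q' = m q with q(0) = 0, so |q|^2 is both
    nonnegative and the primitive of the nonpositive function 2 Re m |q|^2. *)
Lemma first_order_inj m f : clocint f -> cRe m < 0 ->
  f = (fun t => m * cprim f t) -> f = (fun=> 0).
Proof.
move=> hf m0 fE.
suff q0 t : cprim f t = 0 by rewrite fE; apply/funext => t; rewrite q0 mulr0.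
apply: normsq_eq0; apply/eqP; rewrite eq_le normsq_ge0 andbT.
rewrite normsq_cprim// -[leRHS](primitive0 t).
apply: le_primitive; [exact/locintZ/locint_pairing|exact: locint_cst|].
move=> s _; rewrite [f s](congr1 (@^~ s) fE) -mulrA mulConj cReM/= mulr0 subr0.
by rewrite mulrA mulr_le0_ge0 ?normsq_ge0// ltW// pmulr_rlt0.
Qed.

Lemma primitive_derive (F f : R -> R) : (forall x : R, is_derive x 1 F (f x)) ->
  continuous f -> forall t, 0 <= t -> primitive f t = F t - F 0.
Proof.
move=> dF cf t; rewrite le_eqVlt => /predU1P[<-|t0].
  by rewrite subrr /primitive set_itv1 Rintegral_set1.
rewrite /primitive /Rintegral (continuous_FTC2 (F := F) t0)//.
- exact: continuous_subspaceT.
- split => [x _| |]; first exact: ex_derive.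
    apply: cvg_at_right_filter; apply/differentiable_continuous/derivable1_diffP.
    exact: ex_derive.
  apply: cvg_at_left_filter; apply/differentiable_continuous/derivable1_diffP.
  exact: ex_derive.
- by move=> x _; rewrite derive1E; exact: derive_val.
Qed.

Definition cexp m (t : R) : C :=
  ((expR (cRe m * t) * cos (cIm m * t)) +i*
   (expR (cRe m * t) * sin (cIm m * t)))%C.

Lemma cexpN m t : cexp m t * cexp (- m) t = 1.
Proof.
have E : expR (cRe m * t) * expR (- (cRe m * t)) = 1.
  by rewrite -expRD subrr expR0.
have := cos2Dsin2 (cIm m * t).
rewrite /cexp; case: m E => a b /= E T.
apply: complex_ext; rewrite ?cReM ?cImM /= !mulNr cosN sinN.
  transitivity ((expR (a * t) * expR (- (a * t))) *
    (cos (b * t) ^+ 2 + sin (b * t) ^+ 2)); first by ring.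
  by rewrite E T mul1r.
ring.
Qed.

Lemma is_derive_continuous (F f : R -> R) :
  (forall x : R, is_derive x 1 F (f x)) -> continuous F.
Proof.
move=> dF x; apply/differentiable_continuous/derivable1_diffP.
exact: ex_derive.
Qed.

Lemma is_derive_cexp a b (x : R) :
  is_derive x 1 (fun t => expR (a * t) * cos (b * t))
    (a * (expR (a * x) * cos (b * x)) - b * (expR (a * x) * sin (b * x))) /\
  is_derive x 1 (fun t => expR (a * t) * sin (b * t))
    (a * (expR (a * x) * sin (b * x)) + b * (expR (a * x) * cos (b * x))).
Proof.
have dl (c : R) : is_derive x 1 (fun t => c * t) c.
  apply: is_derive_eq (is_deriveM (is_derive_cst c x 1) (is_derive_id x 1)) _.
  by rewrite scaler0 addr0 -[RHS]mulr1.
have dE := is_derive1_comp (is_derive_expR (a * x)) (dl a).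
have dc := is_derive1_comp (is_derive_cos (b * x)) (dl b).
have ds := is_derive1_comp (is_derive_sin (b * x)) (dl b).
split.
  apply: is_derive_eq (is_deriveM dE dc) _; rewrite /GRing.scale /=; ring.
apply: is_derive_eq (is_deriveM dE ds) _; rewrite /GRing.scale /=; ring.
Qed.

Lemma continuous_cexp m :
  continuous (fun t => cRe (cexp m t)) /\ continuous (fun t => cIm (cexp m t)).
Proof.
by split; apply: is_derive_continuous => x;
  have [? ?] := is_derive_cexp (cRe m) (cIm m) x.
Qed.

Lemma locint_continuous (g : R -> R) : continuous g -> locint g.
Proof.
move=> cg T; apply: continuous_compact_integrable; first exact: segment_compact.
exact: continuous_subspaceT.
Qed.

Lemma clocint_cexp m : clocint (cexp m).
Proof. by have [? ?] := continuous_cexp m; split; exact: locint_continuous. Qed.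

(** Multiplication by the exponential can thus be studied with [cprimM]. *)
Lemma cexp_cprim m t : 0 <= t -> cexp m t = 1 + cprim (fun s => m * cexp m s) t.
Proof.
move=> t0; have [c1 c2] := continuous_cexp m.
have e0 : cexp m 0 = 1.
  apply: complex_ext; rewrite /= !mulr0 expR0 ?cos0 ?sin0; ring.
apply/eqP; rewrite -subr_eq0 opprD addrA subr_eq0 -e0; apply/eqP.
have eB (x y : C) : complex.Re (x - y) = cRe x - cRe y /\
    complex.Im (x - y) = cIm x - cIm y by case: x y => [? ?] [? ?].
apply: complex_ext; rewrite ?(eB _ _).1 ?(eB _ _).2.
  have dR (x : R) := (is_derive_cexp (cRe m) (cIm m) x).1.
  rewrite -[LHS](primitive_derive dR _ t0)//.
    by apply: eq_primitive => s _ /=; rewrite cReM.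
  by move=> x; apply: cvgB; apply: cvgM; [exact: cvg_cst|exact: c1|exact: cvg_cst|exact: c2].
have dI (x : R) := (is_derive_cexp (cRe m) (cIm m) x).2.
rewrite -[LHS](primitive_derive dI _ t0)//.
  by apply: eq_primitive => s _ /=; rewrite cImM.
by move=> x; apply: cvgD; apply: cvgM; [exact: cvg_cst|exact: c2|exact: cvg_cst|exact: c1].
Qed.

Lemma clocint_mulcexp m f : clocint f -> clocint (fun t => cexp m t * f t).
Proof.
move=> hf; have h := clocint_mulcprim hf (clocintZ m (clocint_cexp m)).
apply: eq_clocint (clocintD hf h) => t; rewrite in_itv/= andbT => t0.
by rewrite (cexp_cprim m t0); ring.
Qed.

(** Variation of constants: y = u + m x with
    x(t) = int_0^t exp (m (t - s)) u(s) ds. *)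
Lemma first_order_exists m u : clocint u ->
  exists2 y, clocint y & (fun t => y t - m * cprim y t) = u.
Proof.
move=> hu; pose g t := cexp (- m) t * u t.
have hg : clocint g by exact: clocint_mulcexp.
pose x t := cexp m t * cprim g t.
have hx : clocint x by apply/clocint_mulcexp/clocint_cprim.
have xE : x = cprim (fun t => u t + m * x t).
  apply/funext => t; have [t0|t0] := ltP t 0.
    by rewrite /x !cprim_lt0// mulr0.
  have he := clocintZ m (clocint_cexp m).
  rewrite {1}/x (cexp_cprim m t0) mulrDl mul1r cprimM//.
  pose e s := m * cexp m s.
  transitivity (cprim (fun s => g s + (e s * cprim g s + g s * cprim e s)) t).
    by rewrite (cprimD hg)//; apply: clocintD; exact: clocint_mulcprim.
  congr (_ t); apply: eq_cprim => s; rewrite in_itv/= andbT => s0.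
  transitivity (m * x s + g s * (1 + cprim e s)).
    by rewrite /x /e; ring.
  by rewrite /e -cexp_cprim// addrC /g mulrAC [cexp (- m) s * _]mulrC cexpN mul1r.
exists (fun t => u t + m * x t); first by apply: clocintD => //; exact: clocintZ.
by rewrite -xE; apply/funext => t; rewrite addrK.
Qed.

End FirstOrder.

(** * Differential operators made integral *)

Section ScaledOperators.
Context {R : realType}.
Notation C := R[i].
Notation cRe := (@complex.Re R).
Notation cIm := (@complex.Im R).
Notation J := (@cprim R).
Implicit Types (f g h u y : R -> C) (c m z : C) (p q : {poly C}) (M K k : nat).

Lemma clocint_iter k f : clocint f -> clocint (iter k J f).
Proof. by move=> hf; elim: k => //= k; exact: clocint_cprim. Qed.

Lemma iter_cprimD k f g c : clocint f -> clocint g ->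
  iter k J (fun t => f t + c * g t) = fun t => iter k J f t + c * iter k J g t.
Proof.
move=> hf hg; elim: k => //= k ->.
rewrite cprimD; [|exact: clocint_iter|exact/clocintZ/clocint_iter].
by rewrite (cprimZ c (clocint_iter k hg)).
Qed.

Lemma iter_cprim_sum k n (a : 'I_n -> C) (F : 'I_n -> R -> C) :
  (forall i, clocint (F i)) ->
  iter k J (fun t => \sum_(i < n) a i * F i t) =
  fun t => \sum_(i < n) a i * iter k J (F i) t.
Proof.
move=> hF; elim: k => //= k ->.
rewrite cprim_sum => [|i _]; last exact/clocintZ/clocint_iter.
apply/funext => t; apply: eq_bigr => i _.
by rewrite (cprimZ _ (clocint_iter k (hF i))).
Qed.

(** The operator J^M p(D) for D the derivative, which makes sense for locally
    integrable functions as soon as p has degree at most M.  Keeping M apart from the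
    degree of p allows both members of a differential equation to be integrated the
    same number of times. *)
Definition diffop M p f (t : R) : C := \sum_(i < M.+1) p`_i * iter (M - i) J f t.

Lemma clocint_diffop M p f : clocint f -> clocint (diffop M p f).
Proof. by move=> hf; apply: clocint_sum => i _; exact/clocintZ/clocint_iter. Qed.

Lemma diffop_polyD M p q c f :
  diffop M (p + c *: q) f = fun t => diffop M p f t + c * diffop M q f t.
Proof.
apply/funext => t; rewrite /diffop mulr_sumr -big_split; apply: eq_bigr => i _ /=.
by rewrite coefD coefZ mulrDl mulrA.
Qed.

Lemma diffop_polyZ M p c f : diffop M (c *: p) f = fun t => c * diffop M p f t.
Proof.
apply/funext => t; rewrite /diffop mulr_sumr; apply: eq_bigr => i _ /=.
by rewrite coefZ mulrA.
Qed.

Lemma diffop_poly_sum M n (P : 'I_n -> {poly C}) f t :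
  diffop M (\sum_(i < n) P i) f t = \sum_(i < n) diffop M (P i) f t.
Proof.
rewrite /diffop exchange_big; apply: eq_bigr => i _ /=.
by rewrite coef_sum mulr_suml.
Qed.

Lemma diffop_MX M p f : diffop M.+1 (p * 'X) f = diffop M p f.
Proof.
apply/funext => t; rewrite /diffop big_ord_recl coefMX/= mul0r add0r.
by apply: eq_bigr => i _; rewrite coefMX.
Qed.

Lemma diffopS M p f : (size p <= M.+1)%N -> diffop M.+1 p f = diffop M p (J f).
Proof.
move=> sp; apply/funext => t; rewrite /diffop big_ord_recr/= nth_default// mul0r addr0.
by apply: eq_bigr => i _; rewrite subSn -1?ltnS// iterSr.
Qed.

Lemma diffopD M p f g c : clocint f -> clocint g ->
  diffop M p (fun t => f t + c * g t) = fun t => diffop M p f t + c * diffop M p g t.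
Proof.
move=> hf hg; apply/funext => t; rewrite /diffop mulr_sumr -big_split.
by apply: eq_bigr => i _ /=; rewrite iter_cprimD//; ring.
Qed.

Lemma diffop_sum M p n (a : 'I_n -> C) (F : 'I_n -> R -> C) :
  (forall i, clocint (F i)) ->
  diffop M p (fun t => \sum_(i < n) a i * F i t) =
  fun t => \sum_(i < n) a i * diffop M p (F i) t.
Proof.
move=> hF; apply/funext => t; rewrite /diffop.
under eq_bigr do rewrite iter_cprim_sum// mulr_sumr.
rewrite exchange_big; apply: eq_bigr => i _ /=; rewrite mulr_sumr.
by apply: eq_bigr => j _; rewrite mulrCA.
Qed.

Lemma diffop_iter M p k f : clocint f -> iter k J (diffop M p f) = diffop M p (iter k J f).
Proof.
move=> hf; rewrite /diffop iter_cprim_sum; last by move=> i; exact: clocint_iter.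
apply/funext => t; apply: eq_bigr => i _; congr (_ * _ t).
by rewrite -!iterD addnC.
Qed.

(** Both operators are polynomials in J. *)
Lemma diffop_comm M p K q f : clocint f -> diffop M p (diffop K q f) = diffop K q (diffop M p f).
Proof.
move=> hf; rewrite [diffop M p f]/diffop diffop_sum; last by move=> i; exact: clocint_iter.
by apply/funext => t; apply: eq_bigr => i _; rewrite diffop_iter.
Qed.

Lemma diffopDS M p f k : (size p <= M.+1)%N -> diffop (M + k) p f = diffop M p (iter k J f).
Proof.
move=> sp; elim: k f => [|k IH] f; first by rewrite addn0.
by rewrite addnS diffopS ?IH -?iterSr// (leq_trans sp)// ltnS leq_addr.
Qed.

Lemma diffop0 f : diffop 0 1 f = f.
Proof. by apply/funext => t; rewrite /diffop big_ord1 coef1/= mul1r. Qed.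

(** Since J D = 1 on functions of the form J g, the factor D - m becomes 1 - m J. *)
Lemma diffop_XsubC M p m f : (size p <= M.+1)%N -> clocint f ->
  diffop M.+1 (('X - m%:P) * p) f = diffop M p (fun t => f t - m * J f t).
Proof.
move=> sp hf; rewrite mulrBl [_ * p]mulrC mul_polyC -scaleNr diffop_polyD.
rewrite (_ : (fun t => f t - m * J f t) = fun t => f t + - m * J f t).
  by rewrite (diffopD M p (- m) hf (clocint_cprim hf)) diffop_MX diffopS.
by apply/funext => t; rewrite mulNr.
Qed.

Definition rootpoly (ms : seq C) : {poly C} := \prod_(m <- ms) ('X - m%:P).

Lemma size_rootpoly ms : size (rootpoly ms) = (size ms).+1.
Proof. by rewrite size_prod_XsubC. Qed.

Definition stable_roots (ms : seq C) := all (fun m => cRe m < 0) ms.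

(** The operator J^d a(D) for the monic polynomial a of degree d with roots ms;
    it is the product of the 1 - m J for m in ms. *)
Definition rootop ms f := diffop (size ms) (rootpoly ms) f.

Lemma rootop_cons_inner m ms f : clocint f ->
  rootop (m :: ms) f = rootop ms (fun t => f t - m * J f t).
Proof. by move=> hf; rewrite /rootop/rootpoly big_cons diffop_XsubC// size_rootpoly. Qed.

Lemma rootop_nil f : rootop [::] f = f.
Proof. by rewrite /rootop /rootpoly big_nil diffop0. Qed.

Lemma clocint_first_order m f : clocint f -> clocint (fun t => f t - m * J f t).
Proof.
move=> hf; have := clocintD hf (clocintZ (- m) (clocint_cprim hf)).
by apply: eq_clocint => t _; rewrite mulNr.
Qed.

Lemma rootop_cons_outer m ms f : clocint f ->
  rootop (m :: ms) f = fun t => rootop ms f t - m * J (rootop ms f) t.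
Proof.
move=> hf; rewrite rootop_cons_inner// (_ : (fun t => f t - m * J f t) =
   fun t => f t + - m * J f t); last by apply/funext => t; rewrite mulNr.
rewrite /rootop (diffopD _ _ (- m) hf (clocint_cprim hf)).
by apply/funext => t; rewrite -(diffop_iter _ _ 1 hf)/= mulNr.
Qed.

(** Each factor 1 - m J is injective. *)
Lemma rootop_inj ms f : stable_roots ms -> clocint f -> rootop ms f = (fun=> 0) ->
  f = fun=> 0.
Proof.
elim: ms f => [|m ms IH] f /=; first by rewrite rootop_nil.
move=> /andP[m0 hms] hf; rewrite rootop_cons_inner// => /IH.
move=> /(_ hms (clocint_first_order m hf)) E.
apply: (first_order_inj hf m0); apply/funext => t; apply/eqP.
by rewrite -subr_eq0; apply/eqP; exact: (congr1 (@^~ t) E).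
Qed.

(** Each factor 1 - m J is surjective. *)
Lemma rootop_exists ms u : clocint u -> exists2 x, clocint x & rootop ms x = u.
Proof.
elim: ms u => [|m ms IH] u hu; first by exists u; rewrite ?rootop_nil.
have [y hy yu] := first_order_exists m hu.
have [x hx xy] := IH _ hy; exists x => //.
by rewrite rootop_cons_outer // xy.
Qed.

End ScaledOperators.

(** * Square-integrable solutions of stable equations *)

Section SquareIntegrable.
Context {R : realType}.
Notation C := R[i].
Notation cRe := (@complex.Re R).
Notation cIm := (@complex.Im R).
Notation J := (@cprim R).
Notation mu := (@lebesgue_measure R).
Implicit Types (f g h u y : R -> C) (c m z : C) (p q : {poly C}) (M K k : nat).

Definition L2loc f := clocint f /\ locint (fun t => normsq (f t)).

Definition energy f (T : R) := primitive (fun t => normsq (f t)) T.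

(** Square integrability on the half-line, stated by bounded energies so that it
    can be read off from energy balances. *)
Definition L2 f := L2loc f /\ exists B, forall T, energy f T <= B.

Lemma locint_le (f g : R -> R) : (forall T : R, measurable_fun `[0, T] f) ->
  locint g -> (forall t, 0 <= t -> `|f t| <= g t) -> locint f.
Proof.
move=> mf hg fg T; apply: le_integrable (hg T) => //; first by apply/measurable_EFinP; exact: mf.
move=> t; rewrite /= in_itv/= => /andP[t0 _]; rewrite lee_fin.
by rewrite (le_trans (fg _ t0))// ler_norm.
Qed.

Lemma measurable_normsq f (D : set R) : measurable_fun D (cRe \o f) ->
  measurable_fun D (cIm \o f) -> measurable_fun D (fun t => normsq (f t)).
Proof.
by move=> m1 m2; apply: measurable_funD; exact: measurable_funX.
Qed.

Lemma locint_normsq f (g : R -> R) : clocint f -> locint g ->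
  (forall t, 0 <= t -> normsq (f t) <= g t) -> locint (fun t => normsq (f t)).
Proof.
move=> [f1 f2] hg fg; apply: locint_le hg _ => [T|t t0].
  by apply: measurable_normsq; exact: locint_meas.
by rewrite ger0_norm ?normsq_ge0// fg.
Qed.

Lemma L2locDZ c f g : L2loc f -> L2loc g -> L2loc (fun t => f t + c * g t).
Proof.
move=> [f1 f2] [g1 g2].
have h : clocint (fun t => f t + c * g t) by apply: clocintD => //; exact: clocintZ.
split => //; have h2 := locintZ 2 (locintD f2 (locintZ (normsq c) g2)).
by apply: locint_normsq h h2 _ => t _ /=; rewrite -normsqM normsqD_le.
Qed.

Lemma L2DZ c f g : L2 f -> L2 g -> L2 (fun t => f t + c * g t).
Proof.
move=> [hf [A fA]] [hg [B gB]]; have h := L2locDZ c hf hg; split => //.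
exists (2 * (A + normsq c * B)) => T.
have [_ f2] := hf; have [_ g2] := hg; have [_ h2] := h.
have k := locintD f2 (locintZ (normsq c) g2).
apply: (@le_trans _ _ (primitive (fun t => 2 * (normsq (f t) + normsq c * normsq (g t))) T)).
  apply: le_primitive => //; first exact: locintZ k.
  by move=> s _; rewrite -normsqM normsqD_le.
rewrite (primitiveZ 2 k) ler_pM2l// (primitiveD f2 (locintZ (normsq c) g2)) /=.
rewrite (primitiveZ _ g2) lerD//; first exact: fA.
by rewrite ler_wpM2l ?normsq_ge0//; exact: gB.
Qed.

Lemma L2_sum n (a : 'I_n -> C) (F : 'I_n -> R -> C) :
  (forall i, L2 (F i)) -> L2 (fun t => \sum_(i < n) a i * F i t).
Proof.
elim: n a F => [|n IH] a F hF.
  have E : (fun t : R => \sum_(i < 0) a i * F i t) = fun=> 0.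
    by apply/funext => t; rewrite big_ord0.
  have E2 : (fun t : R => normsq (0 : C)) = fun=> 0.
    by apply/funext => t; rewrite /normsq/= expr0n/= addr0.
  rewrite E; split; last by exists 0 => T; rewrite /energy E2 primitive0.
  by split; [exact: clocint0|rewrite E2; exact: locint_cst].
rewrite (_ : (fun t => _) = fun t => \sum_(i < n) a (widen_ord (leqnSn n) i) *
   F (widen_ord (leqnSn n) i) t + a ord_max * F ord_max t); last first.
  by apply/funext => t; rewrite big_ord_recr.
by apply: L2DZ => //; exact: IH.
Qed.

(** With q = J y and a = - Re m > 0, the derivative of |q|^2 is
    2 Re (u q^* ) - 2 a |q|^2, at most |u|^2 / a - a |q|^2; integrating bounds the
    energy of q. *)
Lemma first_order_L2 m y u : cRe m < 0 -> clocint y -> L2 u ->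
  (fun t => y t - m * J y t) = u -> L2 (J y) /\ L2 y.
Proof.
move=> m0 hy hu yu; have [[hu1 hu2] [B uB]] := hu.
pose a := - cRe m; have a0 : 0 < a by rewrite oppr_gt0.
have hq := locint_normsq_cprim hy.
have yE t : y t = u t + m * J y t by rewrite -yu subrK.
have bal T : a * energy (J y) T <= a^-1 * B.
  have h1 := locintZ a^-1 hu2; have h2 := locintZ (- a) hq.
  suff : 0 <= primitive (fun s => a^-1 * normsq (u s) + (- a) * normsq (J y s)) T.
    rewrite (primitiveD h1 h2)/= (primitiveZ _ hu2) (primitiveZ _ hq) mulNr subr_ge0.
    by move=> /le_trans -> //; rewrite ler_pM2l ?invr_gt0//; exact: uB.
  apply: (le_trans (normsq_ge0 (J y T))); rewrite normsq_cprim//.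
  apply: le_primitive; [exact/locintZ/locint_pairing|exact: locintD h1 h2|].
  move=> s _; rewrite yE.
  have Y : 0 <= a^-1 * normsq (u s - a%:C%C * J y s).
    by rewrite mulr_ge0 ?normsq_ge0// invr_ge0 ltW.
  rewrite -subr_ge0; apply: le_trans Y _; rewrite le_eqVlt; apply/orP; left.
  apply/eqP; rewrite /normsq /a; move: (u s) (J y s) m0; clear; case: m => c d.
  by move=> [a1 a2] [b1 b2] /= m0; field; rewrite lt_eqF.
have hJ : L2 (J y).
  split; first by split => //; exact: clocint_cprim.
  by exists (a^-1 * (a^-1 * B)) => T; rewrite ler_pdivlMl// bal.
split => //; rewrite (_ : y = fun t => u t + m * J y t); last exact/funext.
exact: L2DZ.
Qed.

(** Removing one root leaves an equation for x with input y = J^(d-1) a'(D) x and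
    the same equation for J x with input J y; both inputs are square integrable. *)
Lemma rootop_L2 ms x : stable_roots ms -> clocint x -> L2 (rootop ms x) ->
  forall j, (j <= size ms)%N -> L2 (iter j J x).
Proof.
elim: ms x => [|m ms IH] x /=.
  by move=> _ _; rewrite rootop_nil => h [|]//.
move=> /andP[m0 hms] hx; rewrite rootop_cons_outer// => h.
have hy : clocint (rootop ms x) by exact: clocint_diffop.
have [hJ hy2] := first_order_L2 m0 hy h erefl.
case => [|j]; first by move=> _; exact: (IH x hms hx hy2 0%N).
move=> js; rewrite iterSr; apply: IH => //; first exact: clocint_cprim.
by rewrite /rootop -(diffop_iter _ _ 1 hx).
Qed.

End SquareIntegrable.

(** * Principal values on the imaginary axis *)

Section PrincipalValue.
Context {R : realType}.
Notation C := R[i].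
Notation cRe := (@complex.Re R).
Notation cIm := (@complex.Im R).
Notation mu := (@lebesgue_measure R).
Implicit Types (f g F : R -> R) (c m z : C) (p q : {poly C}) (k : nat).

Definition sym_integral f (n : nat) : R :=
  \int[mu]_(x in `[- n.+1%:R, n.+1%:R]) f x.

(** Only the integrals over the intervals [-n-1, n+1] are used, and continuity is
    included so that all of them are integrals of integrable functions. *)
Definition PV f (l : R) := continuous f /\ sym_integral f @ \oo --> l.

Lemma sym_integrable f (n : nat) : continuous f ->
  mu.-integrable `[- n.+1%:R, n.+1%:R] (EFin \o f).
Proof.
move=> cf; apply: continuous_compact_integrable; first exact: segment_compact.
exact: continuous_subspaceT.
Qed.

Lemma PVD f g a b : PV f a -> PV g b -> PV (fun x => f x + g x) (a + b).
Proof.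
move=> [cf fa] [cg gb]; split; first by move=> x; apply: cvgD; [exact: cf|exact: cg].
rewrite (_ : sym_integral _ = fun n => sym_integral f n + sym_integral g n).
  exact: cvgD.
by apply/funext => n; rewrite /sym_integral RintegralD//; exact: sym_integrable.
Qed.

Lemma PVZ (k : R) f a : PV f a -> PV (fun x => k * f x) (k * a).
Proof.
move=> [cf fa]; split.
  by move=> x; apply: cvgM; [exact: cvg_cst|exact: cf].
rewrite (_ : sym_integral _ = fun n => k * sym_integral f n).
  by apply: cvgM => //; exact: cvg_cst.
by apply/funext => n; rewrite /sym_integral RintegralZl//; exact: sym_integrable.
Qed.

Lemma PV_antiderivative F f (L : R) :
  (forall x : R, is_derive x 1 F (f x)) -> continuous f ->
  (fun n => F n.+1%:R - F (- n.+1%:R)) @ \oo --> L -> PV f L.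
Proof.
move=> dF cf FL; split => //.
rewrite (_ : sym_integral f = fun n => F n.+1%:R - F (- n.+1%:R))//.
apply/funext => n; rewrite /sym_integral /Rintegral.
have n0 : - n.+1%:R < n.+1%:R :> R by rewrite gtrN// ltr0n.
rewrite (continuous_FTC2 (F := F) n0)//.
- exact: continuous_subspaceT.
- have cF := is_derive_continuous dF.
  split => [x _| |]; first exact: ex_derive.
    exact/cvg_at_right_filter/cF.
  exact/cvg_at_left_filter/cF.
- by move=> x _; rewrite derive1E; exact: derive_val.
Qed.

Definition cPV (f : R -> C) z := PV (cRe \o f) (cRe z) /\ PV (cIm \o f) (cIm z).

Lemma eq_cPV (f g : R -> C) z : f =1 g -> cPV f z -> cPV g z.
Proof. by move=> /funext ->. Qed.

Lemma cPVD (f g : R -> C) a b : cPV f a -> cPV g b -> cPV (fun x => f x + g x) (a + b).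
Proof.
move=> [f1 f2] [g1 g2]; split.
  rewrite cReD (_ : _ \o _ = fun x => cRe (f x) + cRe (g x)); first exact: PVD.
  by apply/funext => x /=; rewrite cReD.
rewrite cImD (_ : _ \o _ = fun x => cIm (f x) + cIm (g x)); first exact: PVD.
by apply/funext => x /=; rewrite cImD.
Qed.

Lemma cPVZ c (f : R -> C) a : cPV f a -> cPV (fun x => c * f x) (c * a).
Proof.
move=> [f1 f2]; split.
  rewrite cReM -mulNr.
  rewrite (_ : _ \o _ = fun x => cRe c * cRe (f x) + - cIm c * cIm (f x)).
    by apply: PVD; exact: PVZ.
  by apply/funext => x /=; rewrite cReM mulNr.
rewrite cImM (_ : _ \o _ = fun x => cRe c * cIm (f x) + cIm c * cRe (f x)).
  by apply: PVD; exact: PVZ.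
by apply/funext => x /=; rewrite cImM.
Qed.

Definition iaxis (w : R) : C := (0 +i* w)%C.

Definition resolvent m (w : R) : C := (iaxis w - m)^-1.

Arguments resolvent : simpl never.

Section SequenceLimits.
Variables (u v : nat -> R) (x y : R).
Hypotheses (ux : u @ \oo --> x) (vy : v @ \oo --> y).
Lemma seq_cvgM : (fun n => u n * v n) @ \oo --> x * y. Proof. exact: cvgM. Qed.
Lemma seq_cvgD : (fun n => u n + v n) @ \oo --> x + y. Proof. exact: cvgD. Qed.
Lemma seq_cvgB : (fun n => u n - v n) @ \oo --> x - y. Proof. exact: cvgB. Qed.
Lemma seq_cvgZ (k : R) : (fun n => k * u n) @ \oo --> k * x.
Proof. by apply: cvgM => //; exact: cvg_cst. Qed.
End SequenceLimits.

Section Explicit.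
Variables (a b : R).
Hypothesis a0 : 0 < a.
Let D (w : R) := a ^+ 2 + (w - b) ^+ 2.

Let D0 w : 0 < D w.
Proof. by rewrite ltr_pwDl ?exprn_gt0// sqr_ge0. Qed.

(** The explicit form of 1 / (i w - m) for m = - a + i b. *)
Lemma resolventE w : resolvent (- a +i* b)%C w =
  ((a / D w) +i* (- (w - b) / D w))%C.
Proof.
have n0 : iaxis w - (- a +i* b)%C != 0.
  by rewrite eq_complex /= sub0r opprK gt_eqF.
apply: (mulfI n0); rewrite divff//.
apply: complex_ext; rewrite ?cReM ?cImM /= /D;
  field; rewrite -/(D w); exact: lt0r_neq0.
Qed.

Let dD (w : R) : is_derive w 1 D (2 * (w - b)).
Proof.
have dl : is_derive w 1 (fun t : R => t - b) 1.
  by apply: is_derive_eq (is_deriveB (is_derive_id w 1) (is_derive_cst b w 1)) _; rewrite subr0.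
apply: is_derive_eq (is_deriveD (is_derive_cst (a ^+ 2) w 1) (is_deriveM dl dl)) _.
by rewrite /GRing.scale /=; ring.
Qed.

Let dDV (w : R) : is_derive w 1 (fun t => (D t)^-1) (- (D w) ^- 2 * (2 * (w - b))).
Proof. by apply: is_derive_eq (is_deriveV _ (dD w)) _ => //; rewrite gt_eqF. Qed.

Lemma is_derive_resolvent (w : R) :
  is_derive w 1 (fun t => cRe (resolvent (- a +i* b)%C t))
    (cRe (- 'i%C * resolvent (- a +i* b)%C w ^+ 2)) /\
  is_derive w 1 (fun t => cIm (resolvent (- a +i* b)%C t))
    (cIm (- 'i%C * resolvent (- a +i* b)%C w ^+ 2)).
Proof.
have dl : is_derive w 1 (fun t : R => - (t - b)) (-1).
  apply: is_derive_eq (is_deriveN (is_deriveB (is_derive_id w 1) (is_derive_cst b w 1))) _.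
  by rewrite subr0.
have Dw : D w != 0 by rewrite gt_eqF.
split.
  rewrite (_ : (fun t => _) = (fun t => a * (D t)^-1)); last first.
    by apply/funext => t; rewrite resolventE.
  apply: is_derive_eq (is_deriveM (is_derive_cst a w 1) (dDV w)) _.
  rewrite resolventE /GRing.scale expr2 ?cReM ?cImM /= /D.
  by field; rewrite -/(D w).
rewrite (_ : (fun t => _) = (fun t => - (t - b) * (D t)^-1)); last first.
  by apply/funext => t; rewrite resolventE.
apply: is_derive_eq (is_deriveM dl (dDV w)) _.
rewrite resolventE /GRing.scale expr2 ?cReM ?cImM /= /D.
  by field; rewrite -/(D w).
Qed.

Let d (e : R) (n : nat) := (a * harmonic n) ^+ 2 + (e - b * harmonic n) ^+ 2.

Let dE (e : R) n : e ^+ 2 = 1 ->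
  D (e * n.+1%:R) = n.+1%:R ^+ 2 * d e n /\ 0 < d e n.
Proof.
move=> e1; have nE : D (e * n.+1%:R) = n.+1%:R ^+ 2 * d e n.
  by rewrite /D /d /harmonic/=; field; rewrite nat1r pnatr_eq0.
split => //; have := D0 (e * n.+1%:R).
by rewrite nE pmulr_rgt0// exprn_gt0// ltr0n.
Qed.

Let cvg_ebh (e : R) : (fun n => e - b * harmonic n) @ \oo --> e.
Proof.
rewrite -[X in _ --> X](_ : e - b * 0 = e); last by rewrite mulr0 subr0.
by apply: seq_cvgB; [exact: cvg_cst|exact/seq_cvgZ/cvg_harmonic].
Qed.

Let cvg_d (e : R) : e ^+ 2 = 1 -> d e @ \oo --> (1 : R).
Proof.
move=> e1; rewrite -[X in _ --> X](_ : (a * 0) * (a * 0) + e * e = 1); last first.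
  by rewrite mulr0 mul0r add0r -expr2.
by apply: seq_cvgD; apply: seq_cvgM; by [exact: cvg_ebh|exact/seq_cvgZ/cvg_harmonic].
Qed.

Let cvg_dV (e : R) : e ^+ 2 = 1 -> (fun n => (d e n)^-1) @ \oo --> (1 : R).
Proof.
by move=> e1; rewrite -[X in _ --> X]invr1; apply: cvgV; rewrite ?oner_neq0//; exact: cvg_d.
Qed.

(** Taking the sign e as a parameter treats both ends of the axis at once. *)
Lemma resolvent_vanish (e : R) : e ^+ 2 = 1 ->
  (fun n => cRe (resolvent (- a +i* b)%C (e * n.+1%:R))) @ \oo --> 0 /\
  (fun n => cIm (resolvent (- a +i* b)%C (e * n.+1%:R))) @ \oo --> 0.
Proof.
move=> e1; have cd := cvg_dV e1; have ch := @cvg_harmonic R.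
have ndn n : d e n != 0 by rewrite gt_eqF// (dE n e1).2.
split.
  rewrite (_ : (fun n => _) = fun n => a * (harmonic n * harmonic n) * (d e n)^-1).
    rewrite -[X in _ --> X](_ : a * (0 * 0) * 1 = 0); last by rewrite !mulr0 mul0r.
    by apply: seq_cvgM => //; apply: seq_cvgZ; exact: seq_cvgM.
  apply/funext => n; rewrite resolventE (dE n e1).1 /harmonic/=; field.
  by rewrite ndn nat1r pnatr_eq0.
rewrite (_ : (fun n => _) =
    fun n => -1 * ((e - b * harmonic n) * harmonic n * (d e n)^-1)).
  rewrite -[X in _ --> X](_ : -1 * (e * 0 * 1) = 0); last by rewrite mulr0 mul0r mulr0.
  by apply: seq_cvgZ; apply: seq_cvgM => //; apply: seq_cvgM.
apply/funext => n; rewrite resolventE (dE n e1).1 /harmonic/=; field.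
by rewrite ndn nat1r pnatr_eq0.
Qed.

(** The real part integrates to an arctangent and the imaginary part to a logarithm
    whose values at both ends cancel in the limit. *)
Lemma cPV_resolvent1 : cPV (resolvent (- a +i* b)%C) (pi%:C)%C.
Proof.
have ca : continuous (fun t => cRe (resolvent (- a +i* b)%C t)).
  by apply: is_derive_continuous => w; have [] := is_derive_resolvent w.
have cb : continuous (fun t => cIm (resolvent (- a +i* b)%C t)).
  by apply: is_derive_continuous => w; have [] := is_derive_resolvent w.
split => /=.
  apply: (@PV_antiderivative (fun t => atan ((t - b) / a))) => //.
    move=> w.
    have dl : is_derive w 1 (fun t : R => (t - b) * a^-1) a^-1.
      apply: is_derive_eq (is_deriveM (is_deriveB (is_derive_id w 1)
        (is_derive_cst b w 1)) (is_derive_cst a^-1 w 1)) _.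
      by rewrite /GRing.scale/= subr0 mulr1 mulr0 add0r.
    apply: is_derive_eq (is_derive1_comp (is_derive1_atan _) dl) _.
    rewrite /comp resolventE /D /=; field.
    by rewrite -/(D w) !gt_eqF//= addrC.
  have key (e : R) : (fun n => atan ((n.+1%:R - e) / a)) @ \oo --> (pi / 2 : R).
    apply: (@cvg_comp _ _ _ (fun n => (n.+1%:R - e) / a) atan _ (+oo)%R); last exact: cvgy_atan.
    apply/cvgryPge => A; near=> n; rewrite ler_pdivlMr// lerBrDr.
    rewrite (@le_trans _ _ n%:R) ?ler_nat//; near: n; exact: nbhs_infty_ger.
  have := seq_cvgD (key b) (key (- b)).
  rewrite -splitr.
  rewrite [X in X @ _ --> _ -> _](_ : _ = fun n => atan ((n.+1%:R - b) / a) - atan ((- n.+1%:R - b) / a))//.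
  apply/funext => n /=; rewrite -atanN; congr (_ + atan _).
  by rewrite -mulNr; congr (_ / _); ring.
apply: (@PV_antiderivative (fun t => - 2^-1 * ln (D t))) => //.
  move=> w.
  have dln := is_derive1_comp (is_derive1_ln (D0 w)) (dD w).
  have dk := is_derive_cst (- 2^-1 : R) w 1.
  have h := is_deriveM dk dln.
  refine (is_derive_eq h _).
  rewrite /comp resolventE /GRing.scale /=; field.
  by rewrite gt_eqF.
have lim (e : R) : e ^+ 2 = 1 -> (fun n => ln (d e n)) @ \oo --> (0 : R).
  move=> e1; rewrite -ln1; apply: continuous_cvg; last exact: cvg_d.
  exact: continuous_ln.
have m1 : (-1) ^+ 2 = 1 :> R by rewrite sqrrN expr1n.
have := seq_cvgZ (k := - 2^-1) (seq_cvgB (lim 1 (expr1n _ _)) (lim (-1) m1)).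
rewrite subr0 mulr0.
rewrite [X in X @ _ --> _ -> _](_ : _ = fun n => - 2^-1 * ln (D n.+1%:R) - - 2^-1 * ln (D (- n.+1%:R)))//.
apply/funext => n /=.
have [E1 p1] := dE n (expr1n R 2); have [E2 p2] := dE n m1.
rewrite mul1r in E1; rewrite mulN1r in E2.
have n2 : 0 < n.+1%:R ^+ 2 :> R by rewrite exprn_gt0// ltr0n.
rewrite E1 E2 !lnM ?posrE//; ring.
Unshelve. all: by end_near. Qed.

End Explicit.

End PrincipalValue.
Arguments resolvent : simpl never.


(** * Principal values of stable rational functions *)

Section RationalPV.
Context {R : realType}.
Notation C := R[i].
Notation cRe := (@complex.Re R).
Notation cIm := (@complex.Im R).
Implicit Types (c m z : C) (p q b : {poly C}) (k : nat) (F f g G : R -> C).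

Definition cderiv F f := forall x : R,
  is_derive x 1 (fun t => cRe (F t)) (cRe (f x)) /\
  is_derive x 1 (fun t => cIm (F t)) (cIm (f x)).

Lemma cderivM F f G g : cderiv F f -> cderiv G g ->
  cderiv (fun x => F x * G x) (fun x => F x * g x + f x * G x).
Proof.
move=> dF dG x; have [F1 F2] := dF x; have [G1 G2] := dG x; split.
  rewrite (_ : (fun t => _) = fun t => cRe (F t) * cRe (G t) - cIm (F t) * cIm (G t)).
    refine (is_derive_eq (is_deriveB (is_deriveM F1 G1) (is_deriveM F2 G2)) _).
    by rewrite /GRing.scale/= cReD !cReM; ring.
  by apply/funext => t; rewrite cReM.
rewrite (_ : (fun t => _) = fun t => cRe (F t) * cIm (G t) + cIm (F t) * cRe (G t)).
  refine (is_derive_eq (is_deriveD (is_deriveM F1 G2) (is_deriveM F2 G1)) _).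
  by rewrite /GRing.scale/= cImD !cImM; ring.
by apply/funext => t; rewrite cImM.
Qed.

Lemma cderivZ c F f : cderiv F f -> cderiv (fun x => c * F x) (fun x => c * f x).
Proof.
move=> dF x; have d0 : cderiv (fun=> c) (fun=> 0).
  by move=> y; split; exact: is_derive_cst.
have [d1 d2] := cderivM d0 dF x; split; [apply: is_derive_eq d1 _|apply: is_derive_eq d2 _];
  by rewrite mul0r addr0.
Qed.

Lemma eq_cderiv F f g : f =1 g -> cderiv F f -> cderiv F g.
Proof. by move=> /funext ->. Qed.

Lemma stable_dec m : cRe m < 0 -> exists (a : R) (v : R), 0 < a /\ m = (- a +i* v)%C.
Proof.
by case: m => a b /= a0; exists (- a), b; rewrite opprK oppr_gt0.
Qed.

Lemma cderiv_resolvent m : cRe m < 0 ->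
  cderiv (resolvent m) (fun w => - 'i%C * resolvent m w ^+ 2).
Proof. by move=> /stable_dec[a [b [a0 ->]]] w; exact: is_derive_resolvent. Qed.

Lemma cderiv_resolventX m k : cRe m < 0 ->
  cderiv (fun w => resolvent m w ^+ k.+1)
    (fun w => k.+1%:R * (- 'i%C * resolvent m w ^+ k.+2)).
Proof.
move=> m0; have d1 := cderiv_resolvent m0; elim: k => [|k IH].
  by apply: eq_cderiv d1 => w; rewrite mul1r.
have := cderivM IH d1.
rewrite (_ : (fun x => resolvent m x ^+ k.+1 * resolvent m x) =
  fun x => resolvent m x ^+ k.+2); last by apply/funext => w; rewrite [RHS]exprSr.
apply: eq_cderiv => w; rewrite -[in RHS]natr1 !exprS; ring.
Qed.

Definition vanishing F := forall e : R, e ^+ 2 = 1 ->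
  (fun n => cRe (F (e * n.+1%:R))) @ \oo --> (0 : R) /\
  (fun n => cIm (F (e * n.+1%:R))) @ \oo --> (0 : R).

Lemma vanishingM F G : vanishing F -> vanishing G -> vanishing (fun x => F x * G x).
Proof.
move=> vF vG e e1; have [F1 F2] := vF e e1; have [G1 G2] := vG e e1; split.
  rewrite (_ : (fun n => _) = fun n =>
    cRe (F (e * n.+1%:R)) * cRe (G (e * n.+1%:R)) -
    cIm (F (e * n.+1%:R)) * cIm (G (e * n.+1%:R))).
    rewrite -[X in _ --> X](_ : 0 * 0 - 0 * 0 = 0); last by rewrite mulr0 subr0.
    by apply: seq_cvgB; exact: seq_cvgM.
  by apply/funext => n; rewrite cReM.
rewrite (_ : (fun n => _) = fun n =>
  cRe (F (e * n.+1%:R)) * cIm (G (e * n.+1%:R)) +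
  cIm (F (e * n.+1%:R)) * cRe (G (e * n.+1%:R))).
  rewrite -[X in _ --> X](_ : 0 * 0 + 0 * 0 = 0); last by rewrite mulr0 addr0.
  by apply: seq_cvgD; exact: seq_cvgM.
by apply/funext => n; rewrite cImM.
Qed.

Lemma vanishingZ c F : vanishing F -> vanishing (fun x => c * F x).
Proof.
move=> vF e e1; have [F1 F2] := vF e e1; split.
  rewrite (_ : (fun n => _) = fun n =>
    cRe c * cRe (F (e * n.+1%:R)) - cIm c * cIm (F (e * n.+1%:R))).
    rewrite -[X in _ --> X](_ : cRe c * 0 - cIm c * 0 = 0); last by rewrite !mulr0 subr0.
    by apply: seq_cvgB; exact: seq_cvgZ.
  by apply/funext => n; rewrite cReM.
rewrite (_ : (fun n => _) = fun n =>
  cRe c * cIm (F (e * n.+1%:R)) + cIm c * cRe (F (e * n.+1%:R))).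
  rewrite -[X in _ --> X](_ : cRe c * 0 + cIm c * 0 = 0); last by rewrite !mulr0 addr0.
  by apply: seq_cvgD; exact: seq_cvgZ.
by apply/funext => n; rewrite cImM.
Qed.

Lemma vanishing_resolventX m k : cRe m < 0 -> vanishing (fun w => resolvent m w ^+ k.+1).
Proof.
move=> m0; have v1 : vanishing (resolvent m).
  by have [a [b [a0 ->]]] := stable_dec m0; move=> e; exact: resolvent_vanish.
elim: k => [//|k IH].
rewrite (_ : (fun w => _) = fun w => resolvent m w * resolvent m w ^+ k.+1); last first.
  by apply/funext => w; rewrite exprS.
exact: vanishingM.
Qed.

Lemma cPV_antiderivative F f : cderiv F f ->
  continuous (fun x => cRe (f x)) -> continuous (fun x => cIm (f x)) ->
  vanishing F -> cPV f 0.
Proof.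
move=> dF c1 c2 vF.
have [p1 p2] := vF 1 (expr1n _ _).
have [n1 n2] := vF (-1) (etrans (sqrrN _) (expr1n _ _)).
have lim (h : R -> R) : (fun n => h (1 * n.+1%:R)) @ \oo --> (0 : R) ->
    (fun n => h (-1 * n.+1%:R)) @ \oo --> (0 : R) ->
    (fun n => h n.+1%:R - h (- n.+1%:R)) @ \oo --> (0 : R).
  move=> h1 h2; rewrite -[X in _ --> X]subr0.
  rewrite (_ : (fun n => _) = fun n => h (1 * n.+1%:R) - h (-1 * n.+1%:R)).
    exact: seq_cvgB.
  by apply/funext => n; rewrite mul1r mulN1r.
split.
  by apply: (PV_antiderivative (fun x => (dF x).1)) => //; exact: (lim (cRe \o F)).
by apply: (PV_antiderivative (fun x => (dF x).2)) => //; exact: (lim (cIm \o F)).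
Qed.

(** The k+2-nd power has the antiderivative i / (k+1) times the k+1-st power, which
    vanishes at infinity. *)
Lemma cPV_resolventX m k : cRe m < 0 -> cPV (fun w => resolvent m w ^+ k.+2) 0.
Proof.
move=> m0.
have d1 : cderiv (fun w => ('i%C / k.+1%:R) * resolvent m w ^+ k.+1)
    (fun w => resolvent m w ^+ k.+2).
  apply: eq_cderiv (cderivZ _ (cderiv_resolventX k m0)) => w.
  transitivity (- 'i%C ^+ 2 * resolvent m w ^+ k.+2).
    by field; rewrite nat1r pnatr_eq0.
  by rewrite sqr_i opprK mul1r.
have d2 := cderiv_resolventX k.+1 m0.
apply: (cPV_antiderivative d1).
- exact: is_derive_continuous (fun x => (d2 x).1).
- exact: is_derive_continuous (fun x => (d2 x).2).
- exact/vanishingZ/vanishing_resolventX.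
Qed.

Definition resolvent_prod (ms : seq C) (w : R) := \prod_(m <- ms) resolvent m w.

Lemma iaxis_neq m w : cRe m < 0 -> iaxis w - m != 0.
Proof.
case: m => a b /= a0; rewrite eq_complex/= sub0r negb_and.
by rewrite gt_eqF// oppr_gt0.
Qed.

(** For two distinct roots m and v,
    1 / ((s - m) (s - v)) = (1 / (s - m) - 1 / (s - v)) / (m - v), which reduces the
    product to two shorter ones with equal principal values; if all roots coincide,
    the product is a power of one resolvent. *)
Lemma cPV_resolvent_prod ms : stable_roots ms -> (0 < size ms)%N ->
  cPV (resolvent_prod ms) (if size ms == 1%N then pi%:C%C else 0).
Proof.
move: {2}(size ms) (erefl (size ms)) => n; elim: n ms => [[]//|n IH] ms sms hms _.
case: n => [|n] in IH sms *.
  case: ms sms hms => [//|m [|//]] _ /=; rewrite andbT => m0.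
  have [a [b [a0 ->]]] := stable_dec m0.
  apply: eq_cPV (cPV_resolvent1 b a0) => w.
  by rewrite /resolvent_prod big_seq1.
rewrite sms/=.
case: ms sms hms => [//|m ms] /= [sms] /andP[m0 hms].
have [/all_pred1P E|/allPn[v vms vm]] := boolP (all (pred1 m) ms).
  apply: eq_cPV (cPV_resolventX n m0) => w.
  rewrite /resolvent_prod big_cons E big_nseq sms exprS.
  by congr (_ * _); rewrite -Monoid.iteropE.
pose rs := rem v ms.
have pms : perm_eq ms (v :: rs) by exact: perm_to_rem.
have v0 : cRe v < 0 by move: (allP hms _ vms).
have hrs : stable_roots rs by apply/allP => x /mem_rem; exact: (allP hms).
have srs : size rs = n by rewrite /rs size_rem// sms.
have cP x : cRe x < 0 -> cPV (resolvent_prod (x :: rs)) (if n.+1 == 1%N then pi%:C%C else 0).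
  move=> x0; have := IH (x :: rs); rewrite /= srs; apply => //.
  by rewrite x0.
have vm' : m - v != 0 by rewrite subr_eq0 eq_sym.
have := cPVZ (m - v)^-1 (cPVD (cP _ m0) (cPVZ (-1) (cP _ v0))).
rewrite mulN1r subrr mulr0; apply: eq_cPV => w.
rewrite /resolvent_prod !big_cons (perm_big _ pms)/= big_cons /resolvent.
move: (\prod_(_ <- _) _) => P; field.
by rewrite vm' !iaxis_neq.
Qed.

Lemma horner_rootpoly ms z : (rootpoly ms).[z] = \prod_(m <- ms) (z - m).
Proof.
rewrite /rootpoly horner_prod; apply: eq_bigr => m _.
by rewrite hornerXsubC.
Qed.

Lemma resolvent_prodE ms w : resolvent_prod ms w = ((rootpoly ms).[iaxis w])^-1.
Proof. by rewrite horner_rootpoly -prodfV. Qed.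

Lemma rootpoly_neq0 ms z : stable_roots ms -> 0 <= cRe z -> (rootpoly ms).[z] != 0.
Proof.
move=> hms z0; rewrite horner_rootpoly prodf_seq_neq0; apply/allP => m /(allP hms) m0.
apply/implyP => _; rewrite subr_eq0; apply/negP => /eqP zm; move: z0; rewrite zm leNgt.
by rewrite m0.
Qed.

(** Cauchy's theorem for a function that is analytic in the right half-plane and
    O(1/s^2) at infinity.  Dividing b by s - m splits off a multiple of 1 / a and
    leaves a function with one pole less. *)
Lemma cPV_rational ms b : stable_roots ms -> (size b < size ms)%N ->
  cPV (fun w => b.[iaxis w] / (rootpoly ms).[iaxis w]) 0.
Proof.
elim: ms b => [//|m ms IH] b /=; rewrite ltnS => /andP[m0 hms] sb.
have [->|b0] := eqVneq b 0.
  have h : cPV (fun w : R => 0 * resolvent m w) 0.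
    by rewrite -[X in cPV _ X](mul0r pi%:C%C); have [x [y [x0 ->]]] := stable_dec m0;
      apply/cPVZ/cPV_resolvent1.
  by apply: eq_cPV h => w; rewrite horner0 !mul0r.
have sb0 : (0 < size b)%N by rewrite size_poly_gt0.
pose c := b.[m]; pose b1 := (b - c%:P) %/ ('X - m%:P).
have bE : b = b1 * ('X - m%:P) + c%:P.
  rewrite /b1 divpK ?subrK// dvdp_XsubCl /root !hornerE subrr//.
have sb1 : (size b1 < size ms)%N.
  rewrite /b1 size_divp ?polyXsubC_eq0// size_XsubC subn1.
  apply: leq_trans sb; rewrite -(prednK sb0) ltnS -!subn1 leq_sub2r//.
  by rewrite (leq_trans (size_polyD _ _))// geq_max leqnn size_polyN (leq_trans (size_polyC_leq1 _)).
have hm : stable_roots (m :: ms) by rewrite /= m0.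
have sms : (size (m :: ms) == 1)%N = false.
  by rewrite /= eqSS; apply/negbTE; rewrite -lt0n (leq_trans sb0).
have P2 := cPV_resolvent_prod hm isT; rewrite sms in P2.
have := cPVD (IH b1 hms sb1) (cPVZ c P2); rewrite mulr0 addr0; apply: eq_cPV => w.
rewrite resolvent_prodE bE /rootpoly big_cons !hornerE; field.
by rewrite -/(rootpoly ms) rootpoly_neq0//= iaxis_neq.
Qed.

End RationalPV.

(** * The peak gain and the H2 norm *)

Section HardyTwo.
Context {R : realType}.
Notation C := R[i].
Notation cRe := (@complex.Re R).
Notation cIm := (@complex.Im R).
Notation J := (@cprim R).
Implicit Types (c m z : C) (p q b : {poly C}) (ms : seq C).

Lemma cPV_resolvent m : cRe m < 0 -> cPV (resolvent m) pi%:C%C.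
Proof. by move=> /stable_dec[a [b [a0 ->]]]; exact: cPV_resolvent1. Qed.

(** Cauchy-Schwarz for (sqrt A, sqrt B) and (sqrt F, sqrt E). *)
Lemma normsqD_weighted z1 z2 (A B E F : R) : 0 <= A -> 0 <= B -> 0 <= E -> 0 <= F ->
  normsq z1 <= A * F -> normsq z2 <= B * E -> normsq (z1 + z2) <= (A + B) * (E + F).
Proof.
move=> A0 B0 E0 F0 h1 h2.
pose c := cRe z1 * cRe z2 + cIm z1 * cIm z2.
have -> : normsq (z1 + z2) = normsq z1 + normsq z2 + 2 * c.
  by rewrite /normsq /c cReD cImD; ring.
suff : 2 * c <= A * E + B * F by nra.
have cs : c ^+ 2 <= (A * E) * (B * F).
  have -> : (A * E) * (B * F) = (A * F) * (B * E) by ring.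
  apply: le_trans (ler_pM (normsq_ge0 _) (normsq_ge0 _) h1 h2).
  rewrite -subr_ge0 (_ : _ - _ = (cRe z1 * cIm z2 - cIm z1 * cRe z2) ^+ 2).
    exact: sqr_ge0.
  by rewrite /normsq /c; ring.
have AE := mulr_ge0 A0 E0; have BF := mulr_ge0 B0 F0.
move: cs AE BF; set p := A * E; set r := B * F => cs p0 r0.
have [//|h] := lerP (2 * c) (p + r).
have : (p + r) * (p + r) < (2 * c) * (2 * c).
  by rewrite ltr_pM// addr_ge0.
have := sqr_ge0 (p - r); nra.
Qed.

Lemma PV0 : PV (fun _ : R => 0) 0.
Proof.
split; first by move=> x; exact: cvg_cst.
rewrite (_ : sym_integral _ = fun=> 0); first exact: cvg_cst.
by apply/funext => n; rewrite /sym_integral Rintegral_cst// mul0r.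
Qed.

(** Division by s + m^*, the numerator of the all-pass factor with pole m: the
    constant c cancels the value at - m^*, where no root of [rootpoly ms] lies. *)
Lemma root_step m ms b : stable_roots (m :: ms) -> (size b <= (size ms).+1)%N ->
  exists c b', (size b' <= size ms)%N /\
    b = ('X - (- (m^*)%C)%:P) * b' + c *: rootpoly ms.
Proof.
move=> /= /andP[m0 hms] sb; pose r : C := - (m^*)%C.
have r0 : 0 <= cRe r by rewrite /r; case: m m0 {r} => x y /= x0; rewrite oppr_ge0 ltW.
have A0 := rootpoly_neq0 hms r0.
pose c := b.[r] / (rootpoly ms).[r]; pose d := b - c *: rootpoly ms.
have dr : 'X - r%:P %| d.
  by rewrite dvdp_XsubCl /root /d !hornerE /c divfK// subrr.
exists c, (d %/ ('X - r%:P)); split; last first.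
  by rewrite mulrC divpK// /d subrK.
rewrite size_divp ?polyXsubC_eq0// size_XsubC subn1.
suff : (size d <= (size ms).+1)%N by case: (size d).
rewrite (leq_trans (size_polyD _ _))// geq_max sb size_polyN.
by rewrite (leq_trans (size_scale_leq _ _))// size_rootpoly.
Qed.

(** The all-pass factor (s + m^* ) / (s - m) preserves energy up to what is stored in
    its state: the difference of the two integrands is the derivative of the left-hand
    side. *)
Lemma allpass_energy m y T : L2loc y ->
  - (2 * cRe m) * normsq (J y T) =
  energy (fun t => y t - m * J y t) T - energy (fun t => y t + (m^*)%C * J y t) T.
Proof.
move=> hy; have [hy1 hy2] := hy.
have hJ : L2loc (J y) by split; [exact: clocint_cprim|exact: locint_normsq_cprim].
have [_ h1] := L2locDZ (- m) hy hJ; have [_ h2] := L2locDZ (m^*)%C hy hJ.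
rewrite (normsq_cprim _ hy1) /energy.
transitivity (primitive ((fun t => normsq (y t + - m * J y t)) \+
    (fun t => -1 * normsq (y t + (m^*)%C * J y t))) T); last first.
  rewrite (primitiveD h1 (locintZ (-1) h2)) /= (primitiveZ _ h2) mulN1r; congr (_ - _).
  by apply: eq_primitive => t _; rewrite mulNr.
rewrite -[LHS]/((fun t => - (2 * cRe m) * primitive _ t) T) -primitiveZ; last first.
  by apply: locintZ; exact: locint_pairing.
apply: eq_primitive => t _ /=.
move: (y t) (J y t) => [y1 y2] [j1 j2]; clear; case: m => m1 m2.
by rewrite /normsq /=; ring.
Qed.

Lemma iaxis_conj m w : iaxis w - - (m^*)%C = - ((iaxis w - m)^*)%C.
Proof. by case: m => x y; apply: complex_ext => /=; ring. Qed.

Lemma energy_ge0 (f : R -> C) T : 0 <= energy f T.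
Proof. by apply: primitive_ge0 => t _; exact: normsq_ge0. Qed.

(** With z = s - m on the imaginary axis, s + m^* = - z^*.  The cross term contains
    h / z, the value of a stable function of relative degree at least 2. *)
Lemma step_normsq (c h z : C) : 0 < cRe z ->
  normsq (((- (z^*)%C) * h + c) / z) =
  normsq c / cRe z * cRe (z^-1) + normsq h + (-2) * cRe ((c^*)%C * (h / z)).
Proof.
case: z c h => [z1 z2] [c1 c2] [h1 h2] /= z0.
have n0 : z1 ^+ 2 + z2 ^+ 2 != 0.
  by rewrite gt_eqF// ltr_pwDl ?exprn_gt0// sqr_ge0.
have E : ((z1 +i* z2)%C)^-1 = ((z1 / (z1 ^+ 2 + z2 ^+ 2)) +i* - (z2 / (z1 ^+ 2 + z2 ^+ 2)))%C by [].
rewrite E /normsq !(cReM, cImM, cReD, cImD) /=; field.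
by rewrite n0 gt_eqF.
Qed.

(** Induction on the poles; the same constant S appears as a gain in the time domain
    and as an integral in the frequency domain. *)
Lemma h2_peak_gain ms b : stable_roots ms -> (size b <= size ms)%N ->
  exists S, [/\ 0 <= S,
    forall x T, clocint x -> L2loc (rootop ms x) ->
      normsq (diffop (size ms) b x T) <= S * energy (rootop ms x) T,
    PV (fun w => normsq (b.[iaxis w] / (rootpoly ms).[iaxis w])) (2 * pi * S) &
    exists K, forall w, normsq (b.[iaxis w]) <= K * normsq (rootpoly ms).[iaxis w]].
Proof.
elim: ms b => [|m ms IH] b hms sb.
  have -> : b = 0 by apply/eqP; rewrite -size_poly_leq0.
  have n0 : normsq (0 : C) = 0 by rewrite /normsq/= expr0n/= addr0.
  exists 0; split => //.
  - move=> x T _ _; rewrite mul0r (_ : diffop _ _ _ _ = 0) ?n0//.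
    by rewrite /diffop big1// => i _; rewrite coef0 mul0r.
  - rewrite mulr0 (_ : (fun w => _) = fun=> 0); first exact: PV0.
    by apply/funext => w; rewrite horner0 mul0r.
  - by exists 0 => w; rewrite horner0 n0 mul0r.
have [c [b' [sb' bE]]] := root_step hms sb.
move: hms => /= /andP[m0 hms].
have [S [S0 time freq [K bound]]] := IH b' hms sb'.
pose a := - cRe m; have a0 : 0 < a by rewrite oppr_gt0.
have Sc : 0 <= normsq c / (2 * a) by rewrite divr_ge0 ?normsq_ge0// mulr_ge0// ltW.
exists (S + normsq c / (2 * a)); split; first exact: addr_ge0.
- move=> x T hx hu.
  pose y := rootop ms x; have hy : clocint y by exact: clocint_diffop.
  have uE : rootop (m :: ms) x = fun t => y t - m * J y t by exact: rootop_cons_outer.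
  have hJ : L2loc (J y) by split; [exact: clocint_cprim|exact: locint_normsq_cprim].
  have hy2 : L2loc y.
    have := L2locDZ m hu hJ; rewrite uE (_ : (fun t => _) = y)//.
    by apply/funext => t; rewrite subrK.
  (* x' solves the equation for the remaining roots, with the output f of the
     all-pass factor as its input. *)
  pose x' t := x t + (m^*)%C * J x t.
  have hx' : clocint x' by apply: clocintD => //; exact/clocintZ/clocint_cprim.
  have fE : rootop ms x' = fun t => y t + (m^*)%C * J y t.
    rewrite /rootop /x' (diffopD _ _ _ hx (clocint_cprim hx)).
    by apply/funext => t; rewrite -(diffop_iter _ _ 1 hx).
  have wE : diffop (size (m :: ms)) b x T = diffop (size ms) b' x' T + c * J y T.
    rewrite bE diffop_polyD diffop_XsubC//; last exact: leqW.
    congr (_ + _ * _).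
      by congr (diffop _ _ _ T); apply/funext => t; rewrite /x' mulNr opprK.
    by rewrite /= diffopS ?size_rootpoly// -(diffop_iter _ _ 1 hx).
  have hf : L2loc (rootop ms x') by rewrite fE; exact: L2locDZ.
  have bal := allpass_energy m T hy2.
  rewrite wE uE -(subrK (energy (rootop ms x') T) (energy _ T)) fE -bal -fE.
  have -> : - (2 * cRe m) = 2 * a by rewrite /a; ring.
  apply: normsqD_weighted => //.
  + by rewrite mulr_ge0 ?normsq_ge0// mulr_ge0// ltW.
  + exact: energy_ge0.
  + exact: time.
  + by rewrite normsqM mulrA divfK// gt_eqF// mulr_gt0.
- have p1 := (cPV_resolvent m0).1.
  have hm : stable_roots (m :: ms) by rewrite /= m0.
  have p2 : cPV (fun w => b'.[iaxis w] / (rootpoly (m :: ms)).[iaxis w]) 0.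
    by apply: cPV_rational => //; exact: leq_ltn_trans sb' _.
  have := PVD (PVD (PVZ (normsq c / a) p1) freq) (PVZ (-2) (cPVZ (c^*)%C p2).1).
  rewrite (_ : (fun x => _) = (fun w => normsq (b.[iaxis w] / (rootpoly (m :: ms)).[iaxis w]))).
    rewrite (_ : _ + _ = 2 * pi * (S + normsq c / (2 * a)))//.
    by rewrite cReM/= !mulr0; field; rewrite gt_eqF.
  apply/funext => w /=; set z := iaxis w - m.
  have z0 : z != 0 by exact: iaxis_neq.
  have A0 := rootpoly_neq0 hms (lexx 0 : 0 <= cRe (iaxis w)).
  have za : cRe z = a by rewrite /z /a; case: (m) => s t /=; rewrite sub0r.
  rewrite bE /rootpoly big_cons -/(rootpoly ms) !(hornerXsubC, hornerM, hornerZ, hornerD) iaxis_conj -/z.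
  rewrite /resolvent -/z -za.
  have -> : (- (z^*)%C * b'.[iaxis w] + c * (rootpoly ms).[iaxis w]) /
     (z * (rootpoly ms).[iaxis w]) =
     (- (z^*)%C * (b'.[iaxis w] / (rootpoly ms).[iaxis w]) + c) / z.
    by field; rewrite z0.
  have -> : b'.[iaxis w] / (z * (rootpoly ms).[iaxis w]) =
     b'.[iaxis w] / (rootpoly ms).[iaxis w] / z by field; rewrite z0.
  by rewrite step_normsq ?za.
- exists (2 * (normsq c / a ^+ 2 + K)) => w; set z := iaxis w - m.
  have za : a ^+ 2 <= normsq z.
    by rewrite /z /a /normsq; case: (m) => s t /=; rewrite sub0r lerDl sqr_ge0.
  rewrite bE /rootpoly big_cons -/(rootpoly ms) !(hornerXsubC, hornerM, hornerZ, hornerD) iaxis_conj -/z.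
  rewrite (le_trans (normsqD_le _ _))// -mulrA ler_pM2l// !normsqM.
  have nc : normsq (- (z^*)%C) = normsq z by rewrite /normsq; case: (z) => s t /=; ring.
  rewrite nc [leLHS]addrC [leRHS]mulrDl lerD//.
    have nA := normsq_ge0 (rootpoly ms).[iaxis w].
    rewrite mulrA ler_wpM2r// -mulrA ler_peMr ?normsq_ge0//.
    by rewrite mulrC ler_pdivlMr ?exprn_gt0// mul1r.
  by rewrite mulrCA ler_wpM2l ?normsq_ge0.
Qed.

End HardyTwo.

(** * Spectral factorization *)

Section SpectralFactorization.
Context {R : realType}.
Notation C := R[i].
Notation cRe := (@complex.Re R).
Notation cIm := (@complex.Im R).
Implicit Types (c z : C) (p q f : {poly C}).

(** The para-Hermitian conjugate: the polynomial s |-> (p (- s^* ))^*, which is the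
    conjugate of p on the imaginary axis. *)
Definition sharp p : {poly C} := map_poly (@conjc R) p \Po (- 'X).

Lemma sharpM p q : sharp (p * q) = sharp p * sharp q.
Proof. by rewrite /sharp rmorphM comp_polyM. Qed.

Lemma sharpD p q : sharp (p + q) = sharp p + sharp q.
Proof. by rewrite /sharp rmorphD comp_polyD. Qed.

Lemma sharpN p : sharp (- p) = - sharp p.
Proof. by rewrite /sharp rmorphN raddfN. Qed.

Lemma sharpC c : sharp c%:P = (c^*)%C%:P.
Proof. by rewrite /sharp map_polyC comp_polyC. Qed.

Lemma sharpX : sharp 'X = - 'X.
Proof. by rewrite /sharp map_polyX comp_polyX. Qed.

Lemma sharpZ c p : sharp (c *: p) = (c^*)%C *: sharp p.
Proof. by rewrite -!mul_polyC sharpM sharpC. Qed.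

Lemma sharpXn n : sharp 'X^n = (-1) ^+ n *: 'X^n.
Proof.
by rewrite -[(-1) ^+ n *: _]mul_polyC polyC_exp /sharp map_polyXn comp_Xn_poly exprNn polyCN.
Qed.

Lemma sharp_sum n (F : 'I_n -> {poly C}) :
  sharp (\sum_(i < n) F i) = \sum_(i < n) sharp (F i).
Proof. by rewrite /sharp rmorph_sum raddf_sum. Qed.

Lemma sharpK p : sharp (sharp p) = p.
Proof.
elim/poly_ind: p => [|p c IH]; first by rewrite /sharp rmorph0 comp_poly0 rmorph0 comp_poly0.
by rewrite !sharpD !sharpM !sharpX !sharpC IH sharpN sharpX opprK conjcK.
Qed.

Lemma size_sharp p : size (sharp p) = size p.
Proof.
have le q : (size (sharp q) <= size q)%N.
  have [->|q0] := eqVneq q 0; first by rewrite /sharp rmorph0 comp_poly0.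
  rewrite /sharp (leq_trans (size_comp_poly_leq _ _))//.
  by rewrite size_polyN size_polyX muln1 size_map_poly prednK ?size_poly_gt0.
by apply/eqP; rewrite eqn_leq le -{1}[p]sharpK le.
Qed.

Lemma horner_sharp p z : (sharp p).[z] = ((p.[- (z^*)%C])^*)%C.
Proof.
rewrite /sharp horner_comp hornerN hornerX -horner_map/= rmorphN/= conjcK//.
Qed.

Lemma horner_sharp_iaxis p (w : R) : (sharp p).[iaxis w] = ((p.[iaxis w])^*)%C.
Proof.
by rewrite horner_sharp; congr ((p.[_])^*)%C; apply: complex_ext; rewrite /= ?oppr0 ?opprK.
Qed.

Lemma sharp_neq0 p : p != 0 -> sharp p != 0.
Proof. by rewrite -!size_poly_eq0 size_sharp. Qed.

(** The roots of a self-conjugate p come in pairs z, - z^* symmetric about the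
    imaginary axis, on which p has none; s - z and its conjugate are split off together
    and the quotient satisfies the same hypotheses. *)
Lemma spectral_factorization p : sharp p = p ->
  (forall w : R, exists2 r : R, 0 < r & p.[iaxis w] = r%:C%C) ->
  exists f, p = f * sharp f.
Proof.
move: {2}(size p) (leqnn (size p)) => n; elim/ltn_ind: n p => n IH p sp pE pos.
have [sp1|sp1] := leqP (size p) 1.
  have [r r0 pr] := pos 0.
  have pC := size1_polyC sp1.
  exists (Num.sqrt r)%:C%C%:P; rewrite sharpC conjc_real -polyCM.
  rewrite pC; congr _%:P; rewrite -[LHS](hornerC _ (iaxis 0)) -pC pr.
  apply: complex_ext; rewrite /= ?mulr0 ?mul0r ?addr0// subr0.
  by rewrite -expr2 sqr_sqrtr// ltW.
have /closed_rootP[z /rootP pz] : size p != 1%N by rewrite gtn_eqF.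
have z0 : cRe z != 0.
  apply/eqP => z0; have [r r0] := pos (cIm z).
  rewrite (_ : iaxis _ = z) ?pz => [/(congr1 cRe)/=|]; last first.
    by apply: complex_ext.
  by move=> rz; rewrite -rz ltxx in r0.
pose f : {poly C} := 'X - z%:P.
have sf : sharp f = - ('X - (- (z^*)%C)%:P).
  by rewrite /f sharpD sharpN sharpX sharpC polyCN opprK opprD.
have /factor_theorem[q pq] : root p z by exact/rootP.
have qz : root q (- (z^*)%C).
  have : p.[- (z^*)%C] = 0.
    by rewrite -pE horner_sharp rmorphN/= conjcK opprK pz conjc0.
  rewrite pq hornerM hornerXsubC => /eqP; rewrite mulf_eq0 => /orP[//|].
  rewrite subr_eq0 => /eqP/(congr1 cRe); case: (z) z0 => a b /= a0 ba.
  by exfalso; move/eqP: a0; apply; lra.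
have /factor_theorem[q1 qq1] := qz.
pose p1 := - q1.
have pp1 : p = f * sharp f * p1.
  by rewrite pq qq1 sf /p1 /f; ring.
have f0 : f != 0 by rewrite polyXsubC_eq0.
have ff0 : f * sharp f != 0 by rewrite mulf_neq0// sharp_neq0.
have p10 : p1 != 0.
  by apply: contraTneq sp1 => p10; rewrite pp1 p10 mulr0 size_poly0.
have p1E : sharp p1 = p1.
  apply: (mulfI ff0); rewrite -pp1 -[RHS]pE [in RHS]pp1 !sharpM sharpK.
  by rewrite [sharp f * f]mulrC.
have [|||c p1c] := IH (size p1) _ p1 _ p1E.
- apply: leq_trans sp; rewrite pp1 size_mul// size_mul ?sharp_neq0//.
  rewrite size_sharp size_XsubC/=.
  by rewrite ltnS.
- by [].
- move=> w; have [r r0] := pos w; rewrite pp1 !hornerM horner_sharp_iaxis mulConj => E.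
  have nf : 0 < normsq f.[iaxis w].
    rewrite lt_def normsq_ge0 andbT; apply: contraTneq r0 => n0.
    by move: E; rewrite n0 mul0r => /(congr1 cRe)/= <-; rewrite ltxx.
  exists (r / normsq f.[iaxis w]); first exact: divr_gt0.
  have nC : (normsq f.[iaxis w])%:C%C != 0 :> C.
    by apply: contraTneq nf => /(congr1 cRe)/= ->; rewrite ltxx.
  by apply: (mulfI nC); rewrite E -rmorphM/= mulrC divfK// gt_eqF.
exists (f * c); rewrite pp1 p1c sharpM; ring.
Qed.

End SpectralFactorization.

(** * Integrals over the half-line *)

Section HalfLine.
Context {R : realType}.
Notation C := R[i].
Notation cRe := (@complex.Re R).
Notation cIm := (@complex.Im R).
Notation J := (@cprim R).
Notation mu := (@lebesgue_measure R).

Definition integrable0y (h : R -> R) := mu.-integrable `[0, +oo[ (EFin \o h).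

Definition int0y (h : R -> R) : R := \int[mu]_(t in `[0, +oo[) h t.

Lemma locint_integrable0y h : integrable0y h -> locint h.
Proof.
move=> hh T; apply: integrableS hh => //.
by move=> t /=; rewrite !in_itv/= andbT => /andP[].
Qed.

(** Otherwise the primitive would be bounded below by a positive constant on a
    half-line. *)
Lemma small_primitive h n : integrable0y (primitive h) ->
  exists T : R, n%:R <= T /\ `|primitive h T| <= n.+1%:R^-1.
Proof.
move=> /integrableP[mh hoo]; apply: contrapT => /forallNP H.
have {}H T : n%:R <= T -> n.+1%:R^-1 <= `|primitive h T|.
  move=> nT; have := H T; rewrite not_andP => -[//|/negP]; rewrite -ltNge.
  exact: ltW.
suff : (+oo <= \int[mu]_(x in `[0%R, +oo[) `|(EFin \o primitive h) x|)%E.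
  by rewrite leye_eq => /eqP E; move: hoo; rewrite E ltxx.
have sub : `[n%:R, +oo[ `<=` (`[0, +oo[ : set R).
  by move=> t /=; rewrite !in_itv/= !andbT; apply: le_trans.
apply: (@le_trans _ _ (\int[mu]_(x in `[n%:R%R, +oo[) (n.+1%:R^-1)%R%:E)%E).
  rewrite integral_cst//= lebesgue_measure_itv/= ltry mulry gtr0_sg ?mul1e//.
apply: (@le_trans _ _ (\int[mu]_(x in `[n%:R%R, +oo[) `|(EFin \o primitive h) x|)%E).
  apply: ge0_le_integral => //.
  - by apply: measurable_funS sub _ => //; exact: measurableT_comp.
  - by move=> x /=; rewrite in_itv/= andbT lee_fin; exact: H.
apply: ge0_subset_integral => //; exact: measurableT_comp.
Qed.

(** A function with integrable derivative has a limit at infinity, namely the integral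
    of its derivative, and this limit is 0 if the function is itself integrable. *)
Lemma int0y_derivative h : integrable0y h -> integrable0y (primitive h) -> int0y h = 0.
Proof.
move=> hh hp.
(* Along a sequence T of times tending to infinity at which the primitive tends
   to 0, dominated convergence gives its other limit. *)
have /choice[T hT] := fun n => small_primitive n hp.
have TP t : exists N, forall n, (N <= n)%N -> t <= T n.
  exists (Num.truncn t).+1 => n Nn; rewrite (le_trans _ (hT n).1)//.
  by rewrite (le_trans (ltW (truncnS_gt t)))// ler_nat.
have primE n : (primitive h (T n))%:E =
    (\int[mu]_(t in `[0%R, +oo[) (h t * (t <= T n)%R%:R)%:E)%E.
  rewrite /primitive/Rintegral fineK; last first.
    by apply: integrable_fin_num => //; exact: locint_integrable0y.
  rewrite integral_mkcond [RHS]integral_mkcond; apply: eq_integral => t _.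
  rewrite !patchE !mem_setE !in_itv/= andbT; case: (0 <= t) => //=.
  by case: (t <= T n); rewrite ?mulr1 ?mulr0.
have lim1 : (fun n => (primitive h (T n))%:E) @ \oo --> (int0y h)%:E.
  rewrite (_ : (int0y h)%:E = \int[mu]_(t in `[0%R, +oo[) (h t)%:E)%E; last first.
    by rewrite /int0y/Rintegral fineK//; exact: integrable_fin_num.
  under eq_fun do rewrite primE.
  apply: (@dominated_cvg _ _ _ mu _ _ _ _ (abse \o (EFin \o h))) => //.
  - move=> n; apply/measurable_EFinP; apply: measurable_funM.
      by apply/measurable_EFinP; exact: (measurable_int mu hh).
    apply: (measurableT_comp (f := fun b : bool => b%:R : R)) => //.
    by apply: measurable_fun_ler => //; exact: measurable_cst.
  - move=> t _; have [N HN] := TP t; apply: cvg_near_cst.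
    by exists N => // n /= Nn; rewrite HN// mulr1.
  - exact: integrable_abse.
  - move=> n t _ /=; rewrite lee_fin normrM ler_piMr//.
    by case: (t <= T n) => /=; rewrite ?normr1 ?normr0.
have lim2 : (fun n => primitive h (T n)) @ \oo --> (0 : R).
  apply/cvgr0Pnorm_le => e e0; near=> n.
  rewrite (le_trans (hT n).2)//.
  rewrite -[e]invrK lef_pV2 ?posrE ?invr_gt0//.
  rewrite (@le_trans _ _ n%:R) ?ler_nat//; near: n; exact: nbhs_infty_ger.
have lim1' : (fun n => primitive h (T n)) @ \oo --> int0y h.
  by have /fine_cvgP[_] := lim1.
exact: (cvg_unique (@Rhausdorff R) lim1' lim2).
Unshelve. all: by end_near. Qed.

Lemma half_line_bigcup : `[0%R, +oo[%classic = \bigcup_n (`[0%R, n%:R]%classic : set R).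
Proof.
apply/seteqP; split => t /=; rewrite in_itv/= ?andbT.
  move=> t0; exists (Num.truncn t).+1 => //=.
  by rewrite in_itv/= t0 ltW// truncnS_gt.
by move=> [n _] /=; rewrite in_itv/= => /andP[].
Qed.

Lemma measurable0y (h : R -> R) : locint h -> measurable_fun (`[0, +oo[ : set R) h.
Proof.
move=> hh; rewrite half_line_bigcup.
by apply/measurable_fun_bigcup => // n; exact: locint_meas.
Qed.

(** Monotone convergence. *)
Lemma bounded_integrable0y h B : locint h -> (forall t, 0 <= t -> 0 <= h t) ->
  (forall T, primitive h T <= B) -> integrable0y h.
Proof.
move=> hh h0 hB; apply/integrableP; split.
  by apply/measurable_EFinP; exact: measurable0y.
rewrite [ltLHS](_ : _ = \int[mu]_(t in `[0%R, +oo[) (EFin \o h) t)%E; last first.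
  apply: eq_integral => t; rewrite inE/= in_itv/= andbT => /h0 ht.
  by rewrite ger0_norm.
apply: (@le_lt_trans _ _ B%:E); last exact: ltry.
rewrite half_line_bigcup.
have cv := @ge0_nondecreasing_set_cvg_integral _ (measurableTypeR R) R
  (fun n => `[0%R, n%:R]%classic : set R) (EFin \o h) mu.
apply: cvge_to_le (cv _ _ _ _) _ => //.
- by move=> i j ij; apply/subsetPset; apply: subset_itvl; rewrite bnd_simp ler_nat.
- by move=> i; apply/measurable_EFinP; exact: locint_meas.
- by move=> i t /=; rewrite in_itv/= lee_fin => /andP[t0 _]; exact: h0.
- near=> n; have := hB n%:R; rewrite -lee_fin /primitive/Rintegral fineK//.
  exact: integrable_fin_num.
Unshelve. all: by end_near. Qed.

Lemma primitive_le_int0y h T : integrable0y h -> (forall t, 0 <= t -> 0 <= h t) ->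
  primitive h T <= int0y h.
Proof.
move=> hh h0; have lh := locint_integrable0y hh.
rewrite -lee_fin /primitive /int0y /Rintegral !fineK; last 2 first.
- exact: integrable_fin_num.
- by apply: integrable_fin_num => //; exact: lh.
apply: ge0_subset_integral => //; first exact: (measurable_int mu hh).
- by move=> t /=; rewrite in_itv/= andbT lee_fin; exact: h0.
- by move=> t /=; rewrite !in_itv/= andbT => /andP[].
Qed.

Lemma int0yD h k : integrable0y h -> integrable0y k ->
  int0y (fun t => h t + k t) = int0y h + int0y k.
Proof. by move=> hh hk; rewrite /int0y RintegralD. Qed.

Lemma int0yZ a h : integrable0y h -> int0y (fun t => a * h t) = a * int0y h.
Proof. by move=> hh; rewrite /int0y RintegralZl. Qed.

Lemma integrable0yD h k : integrable0y h -> integrable0y k ->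
  integrable0y (fun t => h t + k t).
Proof. by move=> hh hk; apply: (integrableD _ hh hk). Qed.

Lemma integrable0yZ a h : integrable0y h -> integrable0y (fun t => a * h t).
Proof. by move=> hh; apply: (integrableZl _ a hh). Qed.

Definition cint0y (f : R -> C) : C := (int0y (cRe \o f) +i* int0y (cIm \o f))%C.

Definition cintegrable0y (f : R -> C) :=
  integrable0y (cRe \o f) /\ integrable0y (cIm \o f).

Lemma cint0yD f g : cintegrable0y f -> cintegrable0y g ->
  cintegrable0y (fun t => f t + g t) /\
  cint0y (fun t => f t + g t) = cint0y f + cint0y g.
Proof.
move=> [f1 f2] [g1 g2].
have E1 : cRe \o (fun t => f t + g t) = fun t => cRe (f t) + cRe (g t).
  by apply/funext => t /=; rewrite cReD.
have E2 : cIm \o (fun t => f t + g t) = fun t => cIm (f t) + cIm (g t).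
  by apply/funext => t /=; rewrite cImD.
split; first by rewrite /cintegrable0y E1 E2; split; exact: integrable0yD.
by apply: complex_ext; rewrite /cint0y ?cReD ?cImD /= ?E1 ?E2 int0yD.
Qed.

Lemma cint0yZ c f : cintegrable0y f ->
  cintegrable0y (fun t => c * f t) /\ cint0y (fun t => c * f t) = c * cint0y f.
Proof.
move=> [f1 f2].
have E1 : cRe \o (fun t => c * f t) = fun t => cRe c * cRe (f t) + - cIm c * cIm (f t).
  by apply/funext => t /=; rewrite cReM mulNr.
have E2 : cIm \o (fun t => c * f t) = fun t => cRe c * cIm (f t) + cIm c * cRe (f t).
  by apply/funext => t /=; rewrite cImM.
split.
  by rewrite /cintegrable0y E1 E2; split; apply: integrable0yD; exact: integrable0yZ.
by apply: complex_ext; rewrite /cint0y ?cReM ?cImM /= ?E1 ?E2 int0yD ?int0yZ ?mulNr//;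
  exact: integrable0yZ.
Qed.

Lemma cint0y_sum n (a : 'I_n -> C) (F : 'I_n -> R -> C) :
  (forall i, cintegrable0y (F i)) ->
  cintegrable0y (fun t => \sum_(i < n) a i * F i t) /\
  cint0y (fun t => \sum_(i < n) a i * F i t) = \sum_(i < n) a i * cint0y (F i).
Proof.
move=> hF; elim: n a F hF => [|n IH] a F hF.
  rewrite big_ord0 (_ : (fun t => _) = fun=> 0); last first.
    by apply/funext => t; rewrite big_ord0.
  have i0 : integrable0y (fun=> 0) by exact: integrable0.
  split; first by split.
  by apply: complex_ext; rewrite /= /int0y Rintegral_cst// mul0r.
rewrite big_ord_recr /= (_ : (fun t => _) = fun t =>
   \sum_(i < n) a (widen_ord (leqnSn n) i) * F (widen_ord (leqnSn n) i) t +
   a ord_max * F ord_max t); last by apply/funext => t; rewrite big_ord_recr.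
have [h1 E1] := IH (fun i => a (widen_ord (leqnSn n) i)) _ (fun i => hF (widen_ord (leqnSn n) i)).
have [h2 E2] := cint0yZ (a ord_max) (hF ord_max).
by have [h3 ->] := cint0yD h1 h2; rewrite E1 E2.
Qed.

Lemma L2_integrable f : L2 f -> integrable0y (fun t => normsq (f t)).
Proof.
move=> [[_ hf] [B fB]]; apply: bounded_integrable0y hf _ fB => t _.
exact: normsq_ge0.
Qed.

Lemma L2_pairing f g : L2 f -> L2 g -> cintegrable0y (fun t => f t * ((g t)^*)%C).
Proof.
move=> hf hg; have h := integrable0yD (L2_integrable hf) (L2_integrable hg).
have [[[f1 f2] _] _] := hf; have [[[g1 g2] _] _] := hg.
have mf1 := measurable0y f1; have mf2 := measurable0y f2.
have mg1 := measurable0y g1; have mg2 := measurable0y g2.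
have bnd (a b c d : R) : `|a * c + b * d| <= a ^+ 2 + b ^+ 2 + (c ^+ 2 + d ^+ 2).
  have := (sqr_ge0 (a + c), sqr_ge0 (a - c), sqr_ge0 (b + d), sqr_ge0 (b - d)).
  by move=> [[[h1 h2] h3] h4]; rewrite ler_norml; apply/andP; split; nra.
split.
  have E : cRe \o (fun t => f t * ((g t)^*)%C) =
      fun t => cRe (f t) * cRe (g t) + cIm (f t) * cIm (g t).
    by apply/funext => t /=; rewrite cReM; case: (g t) => a b /=; rewrite mulrN opprK.
  rewrite E; apply: le_integrable h => //.
    apply/measurable_EFinP; apply: measurable_funD; exact: measurable_funM.
  by move=> t _ /=; rewrite lee_fin (le_trans (bnd _ _ _ _))// ler_norm.
have E : cIm \o (fun t => f t * ((g t)^*)%C) =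
    fun t => - cRe (f t) * cIm (g t) + cIm (f t) * cRe (g t).
  by apply/funext => t /=; rewrite cImM; case: (g t) => a b /=; ring.
rewrite E; apply: le_integrable h => //.
  apply/measurable_EFinP; apply: measurable_funD; apply: measurable_funM => //.
  exact: measurable_funN.
move=> t _ /=; rewrite lee_fin (le_trans (bnd _ _ _ _))// sqrrN addrACA.
by rewrite [X in _ <= `|_ + X|]addrC addrACA ler_norm.
Qed.

Lemma cint0y_derivative f : clocint f -> cintegrable0y f -> cintegrable0y (J f) ->
  cint0y f = 0.
Proof.
move=> hf [f1 f2] [J1 J2]; apply: complex_ext; rewrite /cint0y /=.
  apply: int0y_derivative; first exact: f1.
  by rewrite [primitive _](_ : _ = cRe \o J f)//; apply/funext => t; rewrite /= Re_cprim.
apply: int0y_derivative; first exact: f2.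
by rewrite [primitive _](_ : _ = cIm \o J f)//; apply/funext => t; rewrite /= Im_cprim.
Qed.

Lemma cint0y_normsq f : cint0y (fun t => f t * ((f t)^*)%C) =
  (int0y (fun t => normsq (f t)))%:C%C.
Proof.
apply: complex_ext; rewrite /cint0y /=.
  by congr int0y; apply/funext => t /=; rewrite mulConj.
transitivity (int0y (fun=> 0)); last by rewrite /int0y Rintegral_cst// mul0r.
by congr int0y; apply/funext => t /=; rewrite mulConj.
Qed.

End HalfLine.

(** * The energy gain and the Hinf norm *)

Section HardyInf.
Context {R : realType}.
Notation C := R[i].
Notation cRe := (@complex.Re R).
Notation cIm := (@complex.Im R).
Notation J := (@cprim R).
Notation mu := (@lebesgue_measure R).

Section Hankel.
Variables (d : nat) (x : R -> C).
Hypothesis hx : clocint x.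
Hypothesis xL2 : forall j, (j <= d)%N -> L2 (iter j J x).

Let X k := iter (d - k) J x.

Let XL2 k : L2 (X k). Proof. by apply: xL2; exact: leq_subr. Qed.

(** The Gram matrix of the derivatives x_k = J^(d-k) x of x_0 = J^d x. *)
Definition gram k l : C := cint0y (fun t => X k t * ((X l t)^*)%C).

(** The derivative of x_k x_l^* has integral 0. *)
Lemma gram_shift k l : (k < d)%N -> (l < d)%N -> gram k.+1 l = - gram k l.+1.
Proof.
move=> kd ld; apply/eqP; rewrite -subr_eq0 opprK; apply/eqP.
have XJ i : (i < d)%N -> X i = J (X i.+1).
  by move=> id; rewrite /X -{1}(@subnSK i d)// iterS.
have p1 := L2_pairing (XL2 k.+1) (XL2 l); have p2 := L2_pairing (XL2 k) (XL2 l.+1).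
have [h E] := cint0yD p1 p2; rewrite /gram -E.
have hk : clocint (X k.+1) by exact: clocint_iter.
have hl : clocint (X l.+1) by exact: clocint_iter.
pose f := fun s => X k.+1 s * cprim (fun t => ((X l.+1 t)^*)%C) s +
                   ((X l.+1 s)^*)%C * J (X k.+1) s.
have fE : (fun t => X k.+1 t * ((X l t)^*)%C + X k t * ((X l.+1 t)^*)%C) = f.
  apply/funext => t; rewrite /f (cprim_conj hl) -!XJ//.
  by rewrite [X in _ + X]mulrC.
have Jf : J f = fun t => X k t * ((X l t)^*)%C.
  apply/funext => t; rewrite -cprimM//; last exact: clocint_conj.
  by rewrite (cprim_conj hl) -!XJ.
rewrite fE in h *; apply: cint0y_derivative => //.
- apply: clocintD; apply: clocint_mulcprim => //; exact: clocint_conj.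
- by rewrite Jf; exact: L2_pairing.
Qed.

(** A representative of the anti-diagonal k + l = n, chosen inside the square of size
    d + 1. *)
Definition moment n : C := (-1) ^+ (n - minn n d) * gram (minn n d) (n - minn n d).

(** Repeated shifts move (k, l) along its anti-diagonal to the chosen
    representative. *)
Lemma gramE k l : (k <= d)%N -> (l <= d)%N -> gram k l = (-1) ^+ l * moment (k + l).
Proof.
move: {2}(minn (k + l) d - k)%N (erefl (minn (k + l) d - k)%N) => j.
elim: j k l => [|j IH] k l jE kd ld.
  have E : minn (k + l) d = k.
    by apply/eqP; rewrite eqn_leq -subn_eq0 jE eqxx/= leq_min leq_addr.
  by rewrite /moment E addKn mulrA -exprD addnn -signr_odd odd_double mul1r.
have kl : (k < minn (k + l) d)%N by rewrite -subn_gt0 jE.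
move: kl; rewrite leq_min => /andP[kl kd'].
case: l => [|l] in jE ld kl *; first by rewrite addn0 ltnn in kl.
have -> : gram k l.+1 = - gram k.+1 l by rewrite gram_shift// opprK.
by rewrite IH ?addSnnS ?exprS ?mulN1r ?mulNr// ?subnS ?jE// ltnW.
Qed.

Definition moment_functional (p : {poly C}) : C :=
  \sum_(n < (d + d).+1) p`_n * moment n.

Lemma moment_functionalXn c n : (n <= d + d)%N ->
  moment_functional (c *: 'X^n) = c * moment n.
Proof.
move=> nd; rewrite /moment_functional (bigD1 (Ordinal (nd : (n < (d + d).+1)%N)))//=.
rewrite coefZ coefXn eqxx mulr1 big1 ?addr0// => i ni.
by rewrite coefZ coefXn (negbTE (ni : i != n :> nat)) mulr0 mul0r.
Qed.

Lemma moment_functionalD p q :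
  moment_functional (p + q) = moment_functional p + moment_functional q.
Proof.
rewrite /moment_functional -big_split; apply: eq_bigr => i _ /=.
by rewrite coefD mulrDl.
Qed.

Lemma moment_functionalZ c (p : {poly C}) : moment_functional (c *: p) = c * moment_functional p.
Proof.
rewrite /moment_functional mulr_sumr; apply: eq_bigr => i _ /=.
by rewrite coefZ mulrA.
Qed.

Lemma moment_functional_sum n (F : 'I_n -> {poly C}) :
  moment_functional (\sum_(i < n) F i) = \sum_(i < n) moment_functional (F i).
Proof.
rewrite /moment_functional exchange_big; apply: eq_bigr => i _ /=.
by rewrite coef_sum mulr_suml.
Qed.

(** Expanding both sides, the coefficient of f_i f_j^* is (-1)^j times the moment of
    index i + j on both. *)
Lemma moment_normsq (f : {poly C}) : (size f <= d.+1)%N ->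
  moment_functional (f * sharp f) = (int0y (fun t => normsq (diffop d f x t)))%:C%C.
Proof.
move=> sf; rewrite -cint0y_normsq.
have fE : f = \sum_(i < d.+1) f`_i *: 'X^i.
  rewrite -poly_def; apply/polyP => i; rewrite coef_poly.
  by case: ltnP => // di; rewrite nth_default// (leq_trans sf).
have sE : sharp f = \sum_(i < d.+1) ((f`_i)^*)%C * (-1) ^+ i *: 'X^i.
  rewrite {1}fE sharp_sum; apply: eq_bigr => i _.
  by rewrite sharpZ sharpXn scalerA.
rewrite {1}fE mulr_suml moment_functional_sum.
have cE t : ((diffop d f x t)^*)%C = \sum_(j < d.+1) ((f`_j)^*)%C * ((X j t)^*)%C.
  by rewrite /diffop rmorph_sum; apply: eq_bigr => j _; rewrite rmorphM.
have pL i j := L2_pairing (XL2 i) (XL2 j).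
have inner (i : 'I_d.+1) : cintegrable0y (fun t => X i t * ((diffop d f x t)^*)%C) /\
    cint0y (fun t => X i t * ((diffop d f x t)^*)%C) =
    \sum_(j < d.+1) ((f`_j)^*)%C * gram i j.
  rewrite (_ : (fun t => _) =
      fun t => \sum_(j < d.+1) ((f`_j)^*)%C * (X i t * ((X j t)^*)%C)).
    exact: cint0y_sum.
  by apply/funext => t; rewrite cE mulr_sumr; apply: eq_bigr => j _; rewrite mulrCA.
rewrite (_ : (fun t => _) =
    fun t => \sum_(i < d.+1) f`_i * (X i t * ((diffop d f x t)^*)%C)); last first.
  apply/funext => t; rewrite {1}/diffop mulr_suml; apply: eq_bigr => i _.
  by rewrite mulrA.
have [_ ->] := cint0y_sum (fun i : 'I_d.+1 => f`_i) (fun i => (inner i).1).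
apply: eq_bigr => i _; rewrite (inner i).2 sE mulr_sumr moment_functional_sum.
rewrite mulr_sumr; apply: eq_bigr => j _.
rewrite -scalerAl -scalerAr scalerA -exprD moment_functionalXn; last first.
  by rewrite leq_add// -ltnS.
by rewrite gramE -1?ltnS//; ring.
Qed.

End Hankel.

Lemma moment_functionalN d x (p : {poly C}) : moment_functional d x (- p) = - moment_functional d x p.
Proof. by rewrite -scaleN1r moment_functionalZ mulN1r. Qed.

(** A factorization g a a^# - b b^# = c c^# turns the pointwise bound on the axis into an
    identity between integrals in time. *)
Lemma hinf_energy_gain ms (b : {poly C}) (g : R) x : stable_roots ms -> (size b <= (size ms).+1)%N ->
  0 <= g ->
  (forall w : R, normsq b.[iaxis w] <= g * normsq (rootpoly ms).[iaxis w]) ->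
  clocint x -> L2 (rootop ms x) ->
  L2 (diffop (size ms) b x) /\
  int0y (fun t => normsq (diffop (size ms) b x t)) <=
  g * int0y (fun t => normsq (rootop ms x t)).
Proof.
move=> hms sb g0 bnd hx hu; set d := size ms.
have xL2 := rootop_L2 hms hx hu.
split.
  by apply: L2_sum => i; apply: xL2; exact: leq_subr.
set N := int0y (fun t => normsq (rootop ms x t)).
have N0 : 0 <= N by apply: Rintegral_ge0 => t _; exact: normsq_ge0.
suff key (e : R) : 0 < e -> int0y (fun t => normsq (diffop d b x t)) <= (g + e) * N.
  apply/ler_addgt0Pr => e e0.
  (* The denominator N + 1 covers the case N = 0. *)
  have eN : 0 < e / (N + 1) by rewrite divr_gt0// ltr_wpDl.
  rewrite (le_trans (key _ eN))// mulrDl lerD2l -mulrA ger_pMr//.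
  by rewrite ler_pdivrMl ?mulr1 ?lerDl// ltr_wpDl.
move=> e0; pose A := rootpoly ms.
pose p := (g + e)%:C%C *: (A * sharp A) - b * sharp b.
have pE : sharp p = p.
  rewrite /p sharpD sharpN sharpZ !sharpM !sharpK conjc_real.
  by rewrite [sharp A * _]mulrC [sharp b * _]mulrC.
have pos (w : R) : exists2 r : R, 0 < r & p.[iaxis w] = r%:C%C.
  exists ((g + e) * normsq A.[iaxis w] - normsq b.[iaxis w]).
    rewrite subr_gt0; apply: (le_lt_trans (bnd w)).
    rewrite ltr_pM2r ?ltrDl// lt_def normsq_ge0 andbT.
    apply: contraNneq (rootpoly_neq0 hms (lexx 0 : 0 <= cRe (iaxis w))).
    by move=> /normsq_eq0 ->.
  rewrite /p !(hornerD, hornerN, hornerZ, hornerM) !horner_sharp_iaxis !mulConj.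
  by rewrite -rmorphM -rmorphB.
have [c pc] := spectral_factorization pE pos.
have sA : size A = d.+1 by exact: size_rootpoly.
have sc : (size c <= d.+1)%N.
  have [->|c0] := eqVneq c 0; first by rewrite size_poly0.
  have : (size p <= (d + d).+1)%N.
    have sz (q : {poly C}) : (size q <= d.+1)%N -> (size (q * sharp q)%R <= (d + d).+1)%N.
      move=> sq; rewrite (leq_trans (size_polyMleq _ _))// size_sharp.
      by case: (size q) sq => [|n] nd; rewrite ?addn0// addnS addSn/= ltnS leq_add.
    rewrite /p (leq_trans (size_polyD _ _))// geq_max size_polyN.
    by rewrite (leq_trans (size_scale_leq _ _)) ?sz// sA.
  rewrite pc size_mul ?sharp_neq0// size_sharp.
  by case: (size c) => //= n; lia.
have sA' : (size A <= d.+1)%N by rewrite sA.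
have := congr1 (moment_functional d x) pc.
rewrite /p moment_functionalD moment_functionalN moment_functionalZ.
rewrite !moment_normsq// => /(congr1 cRe)/=; rewrite mul0r subr0.
have c0 : 0 <= int0y (fun t => normsq (diffop d c x t)).
  by apply: Rintegral_ge0 => t _; exact: normsq_ge0.
by move=> E; rewrite -subr_ge0 E.
Qed.

End HardyInf.

(** * Functions that vanish almost everywhere *)

Section AlmostEverywhere.
Context {R : realType}.
Notation C := R[i].
Notation cRe := (@complex.Re R).
Notation cIm := (@complex.Im R).
Notation J := (@cprim R).
Notation mu := (@lebesgue_measure R).

Lemma primitive_ae0 (h : R -> R) : locint h -> {ae mu, forall t, 0 <= t -> h t = 0} ->
  forall t, primitive h t = 0.
Proof.
move=> hh h0 t; rewrite /primitive /Rintegral.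
have -> : (\int[mu]_(s in `[0%R, t]) (h s)%:E = \int[mu]_(s in `[0%R, t]) cst 0 s)%E.
  apply: ae_eq_integral => //; first exact: (measurable_int mu (hh t)).
  by apply: (ae_impl h0) => s hs /=; rewrite in_itv/= => /andP[s0 _]; rewrite hs.
by rewrite integral0.
Qed.

Lemma cprim_ae0 (f : R -> C) : clocint f ->
  {ae mu, forall t, 0 <= t -> f t = 0} -> J f = fun=> 0.
Proof.
move=> [f1 f2] f0; apply/funext => t; apply: complex_ext; rewrite ?Re_cprim ?Im_cprim.
  by apply: primitive_ae0 => //; apply: (ae_impl f0) => s hs s0; rewrite /= hs.
by apply: primitive_ae0 => //; apply: (ae_impl f0) => s hs s0; rewrite /= hs.
Qed.

Lemma ae_and (P Q : R -> Prop) : {ae mu, forall x, P x} -> {ae mu, forall x, Q x} ->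
  {ae mu, forall x, P x /\ Q x}.
Proof.
move=> [A [mA A0 PA]] [B [mB B0 QB]]; exists (A `|` B); split.
- exact: measurableU.
- by apply/eqP; rewrite -measure_le0 (le_trans (measureU2 _ _ _))// [X in (X + _)%E]A0 [X in (_ + X)%E]B0 add0e.
- move=> x; rewrite /= not_andP => -[nP|nQ]; [left; exact: PA|right; exact: QB].
Qed.

Lemma cprim_eq0_ae (f : R -> C) : clocint f -> J f = (fun=> 0) ->
  {ae mu, forall t, 0 <= t -> f t = 0}.
Proof.
move=> [f1 f2] Jf.
have h1 := primitive_eq0_ae f1 (fun t => etrans (esym (Re_cprim f t)) (congr1 (fun g => cRe (g t)) Jf)).
have h2 := primitive_eq0_ae f2 (fun t => etrans (esym (Im_cprim f t)) (congr1 (fun g => cIm (g t)) Jf)).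
apply: (ae_impl (ae_and h1 h2)) => t [a b] t0.
by apply: complex_ext; [exact: a|exact: b].
Qed.

(** Integration by parts writes (J f)^2 as the primitive of 2 f J f, which vanishes
    almost everywhere; this replaces an appeal to the continuity of J f. *)
Lemma cprim_ae0_eq0 (f : R -> C) : clocint f ->
  {ae mu, forall t, 0 <= t -> J f t = 0} -> J f = fun=> 0.
Proof.
move=> hf Jf0; apply/funext => t.
have : J f t * J f t = 0.
  rewrite cprimM// (cprim_ae0 (f := fun s => _))//.
    by apply: clocintD; exact: clocint_mulcprim.
  by apply: (ae_impl Jf0) => s hs s0; rewrite hs// !mulr0 addr0.
by move/eqP; rewrite mulf_eq0 orbb => /eqP.
Qed.

(** Used to remove the surplus integrations in an identity between [diffop]s. *)
Lemma iter_cprim_eq0_ae K (f : R -> C) : clocint f -> iter K J f = (fun=> 0) ->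
  {ae mu, forall t, 0 <= t -> f t = 0}.
Proof.
elim: K f => [|K IH] f hf.
  by move=> /= ->; exists set0; split => // x /=; case.
rewrite iterSr => /(IH _ (clocint_cprim hf)) h.
by apply: cprim_eq0_ae => //; exact: cprim_ae0_eq0.
Qed.

End AlmostEverywhere.

(** * Degrees of polynomials from their growth *)

Section Growth.
Context {R : realType}.
Notation C := R[i].
Notation nm := (@ComplexField.Normc.normc R).
Implicit Types (p q : {poly C}).

Lemma nm_ge0 (z : C) : 0 <= nm z.
Proof. by case: z => a b; exact: sqrtr_ge0. Qed.

Lemma normsq_nm (z : C) : normsq z = nm z ^+ 2.
Proof. by case: z => a b; rewrite /normsq/= sqr_sqrtr// addr_ge0 ?sqr_ge0. Qed.

Lemma nm_nat n : nm n%:R = n%:R.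
Proof.
have -> : n%:R = (n%:R)%:C%C :> C by rewrite rmorph_nat.
by rewrite /= expr0n/= addr0 sqrtr_sqr ger0_norm.
Qed.

Lemma nmX z n : nm (z ^+ n) = nm z ^+ n.
Proof.
elim: n => [|n IH]; first by rewrite !expr0 ComplexField.Normc.normc1.
by rewrite !exprS ComplexField.Normc.normcM IH.
Qed.

Lemma nm_sum n (F : 'I_n -> C) : nm (\sum_(i < n) F i) <= \sum_(i < n) nm (F i).
Proof.
elim/big_ind2: _ => //; first by rewrite ComplexField.Normc.normc0.
by move=> x1 x2 y1 y2 h1 h2; apply: le_trans (le_normcD _ _) _; exact: lerD.
Qed.

(** The factor n on the left allows one form of the bound for all k, including
    k = 0. *)
Lemma nm_horner_le p k n : (size p <= k)%N -> (0 < n)%N ->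
  n%:R * nm p.[n%:R] <= (\sum_(i < k) nm p`_i) * n%:R ^+ k.
Proof.
move=> pk n0; rewrite (horner_coef_wide _ pk).
apply: le_trans (ler_wpM2l _ (nm_sum _)) _ => //.
rewrite mulr_sumr mulr_suml; apply: ler_sum => i _.
rewrite ComplexField.Normc.normcM nmX nm_nat mulrCA -exprS ler_wpM2l ?nm_ge0//.
by rewrite ler_weXn2l// ler1n.
Qed.

(** Polynomials are compared at the natural numbers only, which is where properness
    will be used. *)
Lemma poly_growth p q (K : R) n0 : 0 <= K ->
  (forall n, (n0 <= n)%N -> nm p.[n%:R] <= K * nm q.[n%:R]) ->
  (size p <= size q)%N.
Proof.
move=> K0 h; rewrite leqNgt; apply/negP.
case E : (size p) => [//|k]; rewrite ltnS => qk.
pose p' := \poly_(i < k) p`_i.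
have pE : p = p' + p`_k *: 'X^k.
  apply/polyP => i; rewrite coefD coef_poly coefZ coefXn.
  case: ltngtP => [ik|ki|->]; rewrite ?mulr0 ?mulr1 ?addr0 ?add0r//.
  by rewrite nth_default// E.
have l0 : 0 < nm p`_k.
  rewrite lt_def nm_ge0 andbT; apply/eqP => /ComplexField.Normc.eq0_normc.
  have -> : p`_k = lead_coef p by rewrite lead_coefE E.
  by move/eqP; rewrite lead_coef_eq0 -size_poly_eq0 E.
pose Q := \sum_(i < k) nm q`_i; pose P := \sum_(i < k) nm p'`_i.
have bnd n : (n0 < n)%N -> nm p`_k * n%:R <= K * Q + P.
  move=> nn0; have n1 : (0 < n)%N by exact: leq_ltn_trans nn0.
  have h1 := nm_horner_le qk n1; have h2 := nm_horner_le (size_poly k _ : (size p' <= k)%N) n1.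
  have h3 := h n (ltnW nn0).
  have nk : 0 < n%:R ^+ k :> R by rewrite exprn_gt0// ltr0n.
  rewrite -(ler_pM2r nk); apply: (@le_trans _ _ (n%:R * (nm p.[n%:R] + nm p'.[n%:R]))).
    rewrite [nm _ * _]mulrC -mulrA ler_wpM2l//.
    have -> : nm p`_k * n%:R ^+ k = nm (p.[n%:R] - p'.[n%:R]).
      by rewrite {2}pE hornerD hornerZ hornerXn addrAC subrr add0r
        ComplexField.Normc.normcM nmX nm_nat.
    by rewrite (le_trans (le_normcD _ _))// normcN.
  rewrite mulrDr mulrDl lerD//.
  apply: (@le_trans _ _ (n%:R * (K * nm q.[n%:R]))); first by rewrite ler_wpM2l.
  by rewrite mulrCA -mulrA ler_wpM2l.
have := bnd (maxn n0 (Num.truncn ((K * Q + P) / nm p`_k))).+1.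
rewrite ltnS leq_maxl => /(_ isT); apply/negP; rewrite -ltNge [ltRHS]mulrC -ltr_pdivrMr//.
by apply: (lt_le_trans (truncnS_gt _)); rewrite ler_nat ltnS leq_maxr.
Qed.

(** If the degrees agreed, q minus a multiple of p would have smaller degree and yet
    dominate q. *)
Lemma poly_growth_strict p q : q != 0 ->
  (forall e : R, 0 < e -> exists n0, forall n, (n0 <= n)%N ->
     nm p.[n%:R] <= e * nm q.[n%:R]) ->
  (size p < size q)%N.
Proof.
move=> q0 h; have [n1 h1] := h 1 ltr01.
have := poly_growth ler01 h1; rewrite leq_eqVlt => /orP[/eqP spq|//].
pose k := lead_coef p / lead_coef q; have lq0 : lead_coef q != 0 by rewrite lead_coef_eq0.
have p0 : p != 0 by rewrite -size_poly_eq0 spq size_poly_eq0.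
have k0 : k != 0 by rewrite mulf_neq0 ?invr_eq0// lead_coef_eq0.
pose r := p - k *: q.
have sr : (size r < size q)%N.
  have s0 : (0 < size q)%N by rewrite size_poly_gt0.
  rewrite -(prednK s0) ltnS; apply/leq_sizeP => j; rewrite leq_eqVlt => /orP[/eqP<-|jq].
    rewrite /r coefB coefZ -lead_coefE -spq -lead_coefE /k divfK// subrr//.
  rewrite /r coefB coefZ !nth_default ?mulr0 ?subr0//; first by rewrite -(prednK s0).
  by rewrite spq -(prednK s0).
have nk : 0 < nm k.
  rewrite lt_def nm_ge0 andbT; apply: contraNneq k0 => /ComplexField.Normc.eq0_normc ->.
  by rewrite eqxx.
have [n2 h2] := h (nm k / 2) (divr_gt0 nk (ltr0Sn R 1)).
have : (size q <= size r)%N; last by rewrite leqNgt sr.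
apply: (@poly_growth q r (2 / nm k) n2); first by rewrite divr_ge0// ltW.
move=> n nn; rewrite -(ler_pM2l nk) mulrA mulrCA divff ?gt_eqF// mulr1.
have e1 : nm k * nm q.[n%:R] <= nm p.[n%:R] + nm r.[n%:R].
  rewrite -ComplexField.Normc.normcM -[k * _]hornerZ (_ : k *: q = p - r); last first.
    by rewrite /r opprB addrC subrK.
  by rewrite hornerD hornerN (le_trans (le_normcD _ _))// normcN.
have := h2 n nn; lra.
Qed.

End Growth.

(** * From a descriptor system to scalar equations *)

Section Descriptor.
Context {R : realType} {N m : nat}.
Notation C := R[i].
Notation cRe := (@complex.Re R).
Notation cIm := (@complex.Im R).
Notation J := (@cprim R).
Notation nm := (@ComplexField.Normc.normc R).
Notation mu := (@lebesgue_measure R).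
Variables (E A : 'M[R]_N) (B : 'cV[R]_N) (Cm : 'M[R]_(m, N)).

(** The pencil with an indeterminate in place of the complex number s. *)
Definition pencil_mx : 'M[{poly C}]_N :=
  \matrix_(i, j) ((E i j)%:C%C *: 'X - ((A i j)%:C%C)%:P).

Definition transfer_den : {poly C} := \det pencil_mx.

Definition transfer_num (k : 'I_m) : {poly C} :=
  \sum_l (Cm k l)%:C%C *: \sum_i (B i 0)%:C%C *: (\adj pencil_mx) l i.

Lemma pencilE s : pencil E A s = map_mx (horner_eval s) pencil_mx.
Proof.
apply/matrixP => i j; rewrite !mxE /horner_eval hornerD hornerN hornerZ hornerX hornerC.
by rewrite mulrC.
Qed.

Lemma det_pencil s : \det (pencil E A s) = transfer_den.[s].
Proof. by rewrite pencilE det_map_mx. Qed.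

Lemma transferE s k : transfer_den.[s] != 0 -> transfer E A B Cm s k 0 = (transfer_num k).[s] / transfer_den.[s].
Proof.
move=> d0; rewrite /transfer /invmx unitmxE det_pencil unitfE d0.
rewrite -scalemxAr -scalemxAl mxE mulrC; congr (_ / _).
rewrite -mulmxA mxE /transfer_num horner_sum; apply: eq_bigr => l _.
rewrite hornerZ mxE; congr (_ * _).
rewrite mxE horner_sum; apply: eq_bigr => i _.
by rewrite hornerZ pencilE -map_mx_adj !mxE mulrC.
Qed.

Section Signals.
Variables (u : R -> R) (v : R -> 'cV[R]_N) (w : R -> 'cV[R]_m).
Hypothesis hu : locint u.
Hypothesis sol : solution E A B Cm u v w.

Definition causal (f : R -> R) (t : R) : C := if 0 <= t then (f t)%:C%C else 0.

Lemma clocint_causal f : locint f -> clocint (causal f).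
Proof.
move=> hf; apply: eq_clocint (clocint_real hf) => t; rewrite in_itv/= andbT => t0.
by rewrite /causal t0.
Qed.

Lemma cprim_causal f t : J (causal f) t = (primitive f t)%:C%C.
Proof.
apply: complex_ext; rewrite ?Re_cprim ?Im_cprim /=.
  by apply: eq_primitive => s; rewrite in_itv/= andbT => s0; rewrite /causal/= s0.
rewrite -(primitive0 t); apply: eq_primitive => s; rewrite in_itv/= andbT => s0.
by rewrite /causal/= s0.
Qed.

Let vc j := causal (fun t => v t j 0).
Let uc := causal u.

Let locv j : locint (fun t => v t j 0).
Proof.
have [_ iv _ _] := sol; move=> T; have [T0|T0] := leP 0 T; first exact: iv.
by rewrite set_itv_ge ?bnd_simp -?ltNge//; exact: integrable_set0.
Qed.

Let hvc j : clocint (vc j). Proof. exact: clocint_causal. Qed.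
Let huc : clocint uc. Proof. exact: clocint_causal. Qed.

(** The integrated state equation E v = A J v + B J u, extended to all times by
    causality. *)
Lemma state_equation i t :
  \sum_j ((E i j)%:C%C * vc j t - (A i j)%:C%C * J (vc j) t) =
  (B i 0)%:C%C * J uc t.
Proof.
rewrite sumrB; have [t0|t0] := ltP t 0.
  rewrite cprim_lt0// mulr0 !big1 ?subr0// => j _.
    by rewrite cprim_lt0// mulr0.
  by rewrite /vc /causal leNgt t0 mulr0.
have [_ _ eqv _] := sol; have := eqv t i t0.
have -> : \int[mu]_(s in `[0, t]) (A *m v s + u s *: B) i 0 =
    \sum_j A i j * primitive (fun t => v t j 0) t + B i 0 * primitive u t.
  have sumP n (F : 'I_n -> R -> R) (c : 'I_n -> R) : (forall j, locint (F j)) ->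
      locint (fun s => \sum_j c j * F j s) /\
      primitive (fun s => \sum_j c j * F j s) t = \sum_j c j * primitive (F j) t.
    move=> hF; elim: n F c hF => [|n IH] F c hF.
      rewrite big_ord0 (_ : (fun s => _) = fun=> 0).
        by split; [exact: locint_cst|exact: primitive0].
      by apply/funext => s; rewrite big_ord0.
    rewrite big_ord_recl (_ : (fun s => _) = (fun s => c ord0 * F ord0 s) \+
      (fun s => \sum_(j < n) c (lift ord0 j) * F (lift ord0 j) s)); last first.
      by apply/funext => s; rewrite big_ord_recl.
    have [h1 h2] := IH (fun j => F (lift ord0 j)) (fun j => c (lift ord0 j)) (fun j => hF _).
    split; first by apply: locintD => //; exact: locintZ.
    by rewrite primitiveD//=; [rewrite h2 primitiveZ|exact: locintZ].
  have [h1 <-] := sumP N (fun j t => v t j 0) (fun j => A i j) locv.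
  transitivity (primitive ((fun s => \sum_j A i j * v s j 0) \+
      (fun s => B i 0 * u s)) t).
    by apply: eq_primitive => s _; rewrite !mxE /= [u s * _]mulrC.
  by rewrite (primitiveD h1 (locintZ (B i 0) hu)) /= (primitiveZ _ hu).
rewrite mxE => /(congr1 (fun x => x%:C%C)).
rewrite rmorphD /= !rmorph_sum /= rmorphM => eq.
have -> : \sum_j (E i j)%:C%C * vc j t = \sum_i0 ((E i i0 * v t i0 0)%:C)%C.
  by apply: eq_bigr => j _; rewrite /vc /causal t0 -rmorphM.
rewrite eq cprim_causal (_ : \sum_j (A i j)%:C%C * J (vc j) t =
  \sum_j ((A i j * primitive (fun t => v t j 0) t)%:C)%C).
  by rewrite addrAC subrr add0r.
by apply: eq_bigr => j _; rewrite cprim_causal -rmorphM.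
Qed.

(** Any number large enough for all the polynomials involved would do. *)
Definition degree_bound : nat :=
  maxn (size transfer_den) (\max_l \max_i size ((\adj pencil_mx) l i)).

Lemma size_adj l i : (size ((\adj pencil_mx) l i) <= degree_bound.+1)%N.
Proof.
apply: leqW; rewrite leq_max; apply/orP; right.
apply: (leq_trans _ (leq_bigmax l)).
exact: (leq_bigmax (F := fun i => size ((\adj pencil_mx) l i)) i).
Qed.

Lemma size_den : (size transfer_den <= degree_bound)%N.
Proof. by rewrite leq_max leqnn. Qed.

(** Multiplication of the state equation by the adjugate of the pencil. *)
Lemma diffop_state k :
  diffop degree_bound.+1 transfer_den (vc k) =
  diffop degree_bound.+1 (\sum_i (B i 0)%:C%C *: (\adj pencil_mx) k i) uc.
Proof.
set M := degree_bound; pose D := \adj pencil_mx.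
apply/funext => t.
transitivity (\sum_j diffop M.+1 ((D *m pencil_mx) k j) (vc j) t).
  rewrite mul_adj_mx (bigD1 k)//= mxE eqxx mulr1n big1 ?addr0// => j jk.
  rewrite mxE eq_sym (negbTE jk) mulr0n /diffop big1// => i _.
  by rewrite coef0 mul0r.
transitivity (\sum_i diffop M (D k i) (fun s =>
    \sum_j ((E i j)%:C%C * vc j s - (A i j)%:C%C * J (vc j) s)) t).
  have step i j : diffop M.+1 (D k i * pencil_mx i j) (vc j) t =
      (E i j)%:C%C * diffop M (D k i) (vc j) t - (A i j)%:C%C * diffop M (D k i) (J (vc j)) t.
    rewrite [pencil_mx i j]mxE mulrBr -scalerAr [_ * _%:P]mulrC mul_polyC -scaleNr diffop_polyD.
    by rewrite diffop_polyZ diffop_MX diffopS ?size_adj// mulNr.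
  transitivity (\sum_j \sum_i diffop M.+1 (D k i * pencil_mx i j) (vc j) t).
    by apply: eq_bigr => j _; rewrite [(D *m _) k j]mxE diffop_poly_sum.
  rewrite exchange_big; apply: eq_bigr => i _ /=.
  under eq_bigr do rewrite step.
  rewrite (_ : (fun s => _) = fun s => \sum_j (E i j)%:C%C * vc j s +
      (-1) * \sum_j (A i j)%:C%C * J (vc j) s); last first.
    by apply/funext => s; rewrite sumrB mulN1r.
  have hJ j : clocint (J (vc j)) by exact: clocint_cprim.
  rewrite diffopD; [|by apply: clocint_sum => j _; exact: clocintZ..].
  by rewrite !diffop_sum// sumrB mulN1r.
rewrite diffop_poly_sum; apply: eq_bigr => i _.
rewrite (_ : (fun s => _) = fun s => (B i 0)%:C%C * J uc s); last first.
  by apply/funext => s; exact: state_equation.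
rewrite diffop_polyZ diffopS ?size_adj//.
have := diffop_sum M (D k i) (fun _ : 'I_1 => (B i 0)%:C%C) (fun _ => clocint_cprim huc).
move=> /(congr1 (fun f => f t)); rewrite big_ord1 => <-.
by congr (diffop _ _ _ t); apply/funext => s; rewrite big_ord1.
Qed.

Let wc k := causal (fun t => w t k 0).

Lemma output_causal k : wc k = fun t => \sum_l (Cm k l)%:C%C * vc l t.
Proof.
apply/funext => t; rewrite /wc /vc /causal; case: ifP => t0; last first.
  by rewrite big1// => l _; rewrite mulr0.
have [_ _ _ ->//] := sol; rewrite mxE rmorph_sum; apply: eq_bigr => l _.
by rewrite rmorphM.
Qed.

Lemma clocint_output k : clocint (wc k).
Proof. by rewrite output_causal; apply: clocint_sum => l _; exact: clocintZ. Qed.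

Lemma diffop_output k : diffop degree_bound.+1 transfer_den (wc k) = diffop degree_bound.+1 (transfer_num k) uc.
Proof.
rewrite output_causal diffop_sum//; apply/funext => t; rewrite /transfer_num diffop_poly_sum.
by apply: eq_bigr => l _; rewrite diffop_state diffop_polyZ.
Qed.

End Signals.

Lemma stable_den : stable_system E A -> forall s, transfer_den.[s] = 0 -> cRe s < 0.
Proof. by move=> st s s0; apply: st; rewrite /finite_eigenvalue det_pencil. Qed.

Lemma stable_den_neq0 s : stable_system E A -> 0 <= cRe s -> transfer_den.[s] != 0.
Proof.
move=> st s0; apply/eqP => /(stable_den st); by rewrite ltNge s0.
Qed.

(** Properness bounds b_k / a near infinity. *)
Lemma proper_size k : stable_system E A -> proper_system E A B Cm ->
  (size (transfer_num k) <= size transfer_den)%N.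
Proof.
move=> st [L hL]; have [r hr] := hL 1 ltr01.
apply: (@poly_growth _ _ _ (nm (L k 0) + 1) (Num.truncn r).+1).
  by rewrite addr_ge0// nm_ge0.
move=> n rn; have d0 : transfer_den.[n%:R] != 0.
  apply: stable_den_neq0 => //; have -> : n%:R = (n%:R)%:C%C :> C by rewrite rmorph_nat.
  by [].
have rn' : r < nm n%:R.
  by rewrite nm_nat (lt_le_trans (truncnS_gt _))// ler_nat.
have := hr _ rn' k; rewrite transferE// => h.
have -> : nm (transfer_num k).[n%:R] = nm ((transfer_num k).[n%:R] / transfer_den.[n%:R]) * nm transfer_den.[n%:R].
  by rewrite -ComplexField.Normc.normcM divfK.
rewrite ler_wpM2r ?nm_ge0//.
rewrite -[X in nm X](subrK (L k 0)) (le_trans (le_normcD _ _))// addrC lerD2l ltW//.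
Qed.

Lemma strictly_proper_size k : stable_system E A -> strictly_proper_system E A B Cm ->
  (size (transfer_num k) < size transfer_den)%N.
Proof.
move=> st hL; have dn0 : transfer_den != 0.
  apply: contraTneq (stable_den_neq0 st (lexx 0 : 0 <= cRe 0)) => ->.
  by rewrite horner0 eqxx.
apply: poly_growth_strict => // e e0; have [r hr] := hL e e0.
exists (Num.truncn r).+1 => n rn; have d0 : transfer_den.[n%:R] != 0.
  apply: stable_den_neq0 => //; have -> : n%:R = (n%:R)%:C%C :> C by rewrite rmorph_nat.
  by [].
have rn' : r < nm n%:R.
  by rewrite nm_nat (lt_le_trans (truncnS_gt _))// ler_nat.
have := hr _ rn' k; rewrite transferE// mxE subr0 => h.
have -> : nm (transfer_num k).[n%:R] = nm ((transfer_num k).[n%:R] / transfer_den.[n%:R]) * nm transfer_den.[n%:R].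
  by rewrite -ComplexField.Normc.normcM divfK.
by rewrite ler_wpM2r ?nm_ge0// ltW.
Qed.

End Descriptor.

(** * The norm in the random parameters *)

Section ParameterNorm.
Context {R : realType} (q : nat).
Variables (Pi : set (q.-tuple R)) (rho : q.-tuple R -> R).
Variables (Phi : nat -> q.-tuple R -> R) (I : {fset nat}).
Hypothesis mPi : measurable Pi.
Hypothesis hrho : probability_density Pi rho.
Hypothesis hPhi : complete_orthonormal Pi rho Phi.
Notation leb := (lebesgue_tuple q).

(** |x y| <= x^2 + y^2. *)
Lemma integrable_PhiPhi i j :
  leb.-integrable Pi (fun p => (Phi i p * Phi j p * rho p)%:E).
Proof.
have [mrho rho0 _] := hrho; have [L2Phi _ _] := hPhi.
have mPhi k : measurable_fun Pi (Phi k) by have [] := L2Phi k.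
have isq k : leb.-integrable Pi (fun p => (Phi k p ^+ 2 * rho p)%:E).
  apply/integrableP; split.
    by apply/measurable_EFinP/measurable_funM => //; exact: measurable_funX.
  have [_] := L2Phi k; apply: le_lt_trans; rewrite le_eqVlt; apply/orP; left.
  apply/eqP; apply: eq_integral => p; rewrite inE => /rho0 rp.
  by rewrite gee0_abs// lee_fin mulr_ge0// sqr_ge0.
apply: le_integrable (integrableD mPi (isq i) (isq j)) => //.
  by apply/measurable_EFinP/measurable_funM => //; exact: measurable_funM.
move=> p /rho0 rp; rewrite -EFinD !abse_EFin lee_fin -mulrDl !normrM.
rewrite (ger0_norm rp) ler_wpM2r// -normrM [leRHS]ger0_norm ?addr_ge0 ?sqr_ge0//.
have := (sqr_ge0 (Phi i p + Phi j p), sqr_ge0 (Phi i p - Phi j p)).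
by move=> [h1 h2]; rewrite ler_norml; apply/andP; split; nra.
Qed.

Lemma idx_inj : injective (@idx I).
Proof.
move=> i j; rewrite /idx => /eqP; rewrite nth_uniq ?fset_uniq// => /eqP ij.
exact: val_inj.
Qed.

(** Parseval's identity for a finite orthonormal expansion. *)
Lemma sqnormL2_expansion (P : pred 'I_#|` I|) (c : 'I_#|` I| -> R) :
  sqnormL2 Pi rho (fun p => \sum_(k | P k) c k * Phi (idx k) p) =
  (\sum_(k | P k) c k ^+ 2)%:E.
Proof.
have [_ ortho _] := hPhi.
pose F (kl : 'I_#|` I| * 'I_#|` I|) p : \bar R :=
  ((c kl.1 * c kl.2)%:E * (Phi (idx kl.1) p * Phi (idx kl.2) p * rho p)%:E)%E.
have iF kl : leb.-integrable Pi (F kl) by exact/integrableZl/integrable_PhiPhi.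
transitivity (\int[leb]_(p in Pi) \sum_(kl | P kl.1 && P kl.2) F kl p)%E.
  apply: eq_integral => p _; rewrite /F.
  under [RHS]eq_bigr do rewrite -EFinM.
  rewrite sumEFin -(pair_big P P (fun k l => c k * c l * (Phi (idx k) p * Phi (idx l) p * rho p)))/=.
  congr EFin; rewrite expr2 mulr_suml mulr_suml; apply: eq_bigr => k _.
  rewrite mulr_sumr mulr_suml; apply: eq_bigr => l _; ring.
rewrite (integral_sum mPi iF).
have intF kl : (\int[leb]_(p in Pi) F kl p = (c kl.1 * c kl.2 * (kl.1 == kl.2)%:R)%:E)%E.
  rewrite /F integralZl//; last exact: integrable_PhiPhi.
  rewrite [RHS]EFinM; congr (_ * _)%E.
  rewrite -(inj_eq idx_inj) -(ortho (idx kl.1) (idx kl.2)) /expectation /Rintegral fineK//.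
  by apply: integrable_fin_num => //; exact: integrable_PhiPhi.
under eq_bigr do rewrite intF.
rewrite sumEFin -(pair_big P P (fun k l => c k * c l * (k == l)%:R))/=.
congr EFin; apply: eq_bigr => k Pk.
rewrite (bigD1 k)//= eqxx mulr1 -expr2 big1 ?addr0// => l /andP[_ lk].
by rewrite eq_sym (negbTE lk) mulr0.
Qed.

End ParameterNorm.

(** * Continuity of primitives on the half-line *)

Section HalfLineContinuity.
Context {R : realType}.
Notation mu := (@lebesgue_measure R).

(** Extending f by 0 to [-1, 0] makes every point of the half-line an interior point
    of an interval of integration. *)
Lemma primitive_continuous0y (f : R -> R) : locint f ->
  {within `[0, +oo[, continuous (primitive f)}.
Proof.
move=> hf; apply: continuous_in_subspaceT => x; rewrite inE/= in_itv/= andbT => x0.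
pose h := f \_ `[0, +oo[.
have hE t : primitive f t = \int[mu]_(s in `[-1, t]) h s.
  rewrite /h -Rintegral_mkcondr /primitive; congr (Rintegral _ _ _).
  apply/seteqP; split => s /=; rewrite !in_itv/= ?andbT.
    by move=> /andP[s0 ->]; rewrite s0 andbT (le_trans _ s0)// lerN10.
  by move=> [/andP[_ ->] ->].
have inth : mu.-integrable `[-1, (x + 1)] (EFin \o h).
  rewrite -restrict_EFin; apply/integrable_restrict => //.
  apply: integrableS (hf (x + 1)) => //; first exact: measurableI.
  by move=> s /=; rewrite !in_itv/= andbT => -[/andP[_ ->] ->].
have x1 : -1 < x + 1 by rewrite (lt_le_trans (ltrN10 R))// addr_ge0.
have /(continuous_within_itvP _ x1)[+ _ _] :=
  parameterized_integral_continuous (ltW x1) inth.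
rewrite (_ : (fun t => _) = primitive f); last by apply/funext => t; rewrite hE.
by apply; rewrite in_itv/= (lt_le_trans (ltrN10 R) x0)/= ltrDl.
Qed.

End HalfLineContinuity.

(** * The input signal *)

Section Input.
Context {R : realType}.
Notation C := R[i].
Notation mu := (@lebesgue_measure R).
Variable u : R -> R.
Hypothesis hu : input_L2 u.

Lemma input_integrable : integrable0y (fun t => u t ^+ 2).
Proof.
have [mu_ nu] := hu; apply/integrableP; split.
  by apply/measurable_EFinP; exact: measurable_funX.
rewrite [ltLHS](_ : _ = \int[mu]_(t in `[0%R, +oo[) (u t ^+ 2)%:E)%E; last first.
  by apply: eq_integral => t _; rewrite /= ger0_norm// sqr_ge0.
move: nu; rewrite /norm_input.
by move: (\int[mu]_(t in _) _)%E => [r| |]//= _; rewrite ?ltry ?ltNyr.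
Qed.

Lemma locint_input : locint u.
Proof.
have h : locint (fun t => 1 + u t ^+ 2).
  exact: locintD (locint_cst 1) (locint_integrable0y input_integrable).
apply: locint_le h _ => [T|t _].
  have [mu_ _] := hu; apply: measurable_funS mu_ => //.
  by move=> t /=; rewrite !in_itv/= andbT => /andP[].
have := sqr_ge0 (u t); have := normr_ge0 (u t); rewrite -(real_normK (num_real (u t))).
by move: (`|u t|) => a a0 a2; nra.
Qed.

Definition input_energy : R := int0y (fun t => u t ^+ 2).

Lemma norm_inputE : norm_input u = sqrte input_energy%:E.
Proof.
rewrite /norm_input /input_energy /int0y /Rintegral fineK//.
exact: integrable_fin_num input_integrable.
Qed.

Lemma input_energy_ge0 : 0 <= input_energy.
Proof. by apply: Rintegral_ge0 => t _; exact: sqr_ge0. Qed.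

Lemma normsq_causal f t : 0 <= t -> normsq (causal f t : C) = f t ^+ 2.
Proof. by move=> t0; rewrite /causal t0 /normsq/= expr0n/= addr0. Qed.

Lemma energy_causal_le T : energy (causal u : R -> C) T <= input_energy.
Proof.
rewrite /energy (@eq_primitive _ _ (fun t => u t ^+ 2)).
  by apply: primitive_le_int0y => [|t _]; [exact: input_integrable|exact: sqr_ge0].
by move=> t; rewrite in_itv/= andbT => t0; rewrite normsq_causal.
Qed.

Lemma L2_input : L2 (causal u : R -> C).
Proof.
split; last by exists input_energy => T; exact: energy_causal_le.
split; first exact/clocint_causal/locint_input.
apply: eq_locint (locint_integrable0y input_integrable) => t.
by rewrite in_itv/= andbT => t0; rewrite normsq_causal.
Qed.

Lemma int0y_causal : int0y (fun t => normsq (causal u t : C)) = input_energy.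
Proof.
apply: eq_Rintegral => t; rewrite inE/= in_itv/= andbT => t0.
by rewrite normsq_causal.
Qed.

End Input.

(** * Bounds for one output component *)

Section Channels.
Context {R : realType} {N m : nat}.
Notation C := R[i].
Notation cRe := (@complex.Re R).
Notation cIm := (@complex.Im R).
Notation J := (@cprim R).
Notation nm := (@ComplexField.Normc.normc R).
Notation mu := (@lebesgue_measure R).
Variables (E A : 'M[R]_N) (B : 'cV[R]_N) (Cm : 'M[R]_(m, N)).
Variables (u : R -> R) (v : R -> 'cV[R]_N) (w : R -> 'cV[R]_m).
Hypothesis hu : input_L2 u.
Hypothesis sol : solution E A B Cm u v w.
Hypothesis st : stable_system E A.

Definition channel k s : C := transfer E A B Cm s k 0.

(** The finite eigenvalues of the pencil, with multiplicity. *)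
Definition poles : seq C := sval (closed_field_poly_normal (transfer_den E A)).

Definition numer (k : 'I_m) : {poly C} := (lead_coef (transfer_den E A))^-1 *: transfer_num E A B Cm k.

Lemma den_neq0 : transfer_den E A != 0.
Proof.
apply: contraTneq (stable_den_neq0 st (lexx 0 : 0 <= cRe 0)) => ->.
by rewrite horner0 eqxx.
Qed.

Lemma lead_den_neq0 : lead_coef (transfer_den E A) != 0.
Proof. by rewrite lead_coef_eq0 den_neq0. Qed.

Lemma denE : transfer_den E A = lead_coef (transfer_den E A) *: rootpoly poles.
Proof. exact: svalP (closed_field_poly_normal (transfer_den E A)). Qed.

Lemma size_poles : size (transfer_den E A) = (size poles).+1.
Proof. by rewrite denE size_scale ?lead_den_neq0// size_rootpoly. Qed.

Lemma stable_poles : stable_roots poles.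
Proof.
apply/allP => z zp; apply: (stable_den st); rewrite denE hornerZ.
suff /rootP -> : root (rootpoly poles) z by rewrite mulr0.
by rewrite root_prod_XsubC.
Qed.

Lemma transfer_iaxis k (s : R) : transfer E A B Cm (iaxis s) k 0 =
  (numer k).[iaxis s] / (rootpoly poles).[iaxis s].
Proof.
have d0 : (transfer_den E A).[iaxis s] != 0 by exact: stable_den_neq0.
rewrite transferE// {1}denE !hornerZ; field.
by rewrite lead_den_neq0 rootpoly_neq0// stable_poles.
Qed.

Lemma size_numer k : size (numer k) = size (transfer_num E A B Cm k).
Proof. by rewrite size_scale// invr_eq0 lead_den_neq0. Qed.

(** The state x need not have anything to do with the state v of the descriptor
    system, which may have uncontrollable or unobservable modes and polynomial parts.
    Both sides of the last identity satisfy the same equation after finitely many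
    integrations. *)
Lemma realisation : exists2 x : R -> C, clocint x & rootop poles x = causal u /\
  forall k, (size (numer k) <= (size poles).+1)%N ->
    {ae mu, forall t, 0 <= t -> (w t k 0)%:C%C = diffop (size poles) (numer k) x t}.
Proof.
have lu := locint_input hu.
have hc : clocint (causal u : R -> C) by exact: clocint_causal.
have [x hx xu] := rootop_exists poles hc.
exists x => //; split => // k sk.
set d := size poles in sk *.
pose M := (degree_bound E A).+1.
have dM : (d <= M)%N.
  by rewrite -ltnS -size_poles (leq_trans (size_den E A))// leqW.
(* K is the number of surplus integrations. *)
pose K := (M - d)%N; have MK : M = (d + K)%N by rewrite subnKC.
pose wc : R -> C := causal (fun t => w t k 0).
have hw : clocint wc by exact: (clocint_output sol).
have hsx : clocint (diffop d (numer k) x) by exact: clocint_diffop.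
have e1 : diffop M (rootpoly poles) wc = diffop M (numer k) (causal u).
  have := diffop_output lu sol k; rewrite -/M -/wc {1}denE diffop_polyZ => e.
  apply/funext => t; rewrite /numer diffop_polyZ -e mulrA mulVf ?mul1r//.
  exact: lead_den_neq0.
rewrite MK !diffopDS// ?size_rootpoly// in e1.
have e2 : rootop poles (iter K J wc) = rootop poles (iter K J (diffop d (numer k) x)).
  rewrite /rootop e1 -diffop_iter// -[in RHS]diffop_iter// -xu.
  by rewrite /rootop diffop_comm.
have e3 : iter K J (fun t => wc t + -1 * diffop d (numer k) x t) = fun=> 0.
  apply: (rootop_inj stable_poles).
    by apply: clocint_iter; apply: clocintD => //; exact: clocintZ.
  rewrite iter_cprimD// /rootop diffopD; [|exact: clocint_iter..].
  by apply/funext => t; rewrite [diffop _ _ (iter K J wc)]e2 mulN1r subrr.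
apply: ae_impl (iter_cprim_eq0_ae _ e3) _ => [|t h t0].
  by apply: clocintD => //; exact: clocintZ.
by have /eqP := h t0; rewrite mulN1r subr_eq0 /wc /causal t0 => /eqP.
Qed.

Lemma peak_bound k x : (size (numer k) <= size poles)%N -> clocint x ->
  rootop poles x = causal u ->
  exists S : R, [/\ 0 <= S,
    forall T, normsq (diffop (size poles) (numer k) x T) <= S * input_energy u &
    (S%:E <= normH2 (channel k) ^+ 2)%E].
Proof.
move=> sk hx xu; have [S [S0 time [cont freq] _]] := h2_peak_gain stable_poles sk.
exists S; split => //.
  move=> T; have [hL _] := L2_input hu.
  apply: (le_trans (time x T hx _)); first by rewrite xu.
  by rewrite xu ler_wpM2l// energy_causal_le.
set f := fun w : R => _ in cont freq.
have p0 : 0 < 2 * pi :> R by rewrite mulr_gt0// pi_gt0.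
rewrite /normH2 sqr_sqrte; last first.
  by rewrite mule_ge0// ?lee_fin ?invr_ge0 ?(ltW p0)// integral_ge0// => s _; rewrite lee_fin sqr_ge0.
have -> : (\int[mu]_omega (nm (transfer E A B Cm (0 +i* omega)%C k 0) ^+ 2)%:E =
    \int[mu]_omega (f omega)%:E)%E.
  by apply: eq_integral => s _; rewrite /f normsq_nm -transfer_iaxis.
have f0 s : 0 <= f s by exact: normsq_ge0.
have low : ((2 * pi * S)%:E <= \int[mu]_omega (f omega)%:E)%E.
  have sub n : ((sym_integral f n)%:E <= \int[mu]_omega (f omega)%:E)%E.
    rewrite /sym_integral /Rintegral fineK; last first.
      by apply: integrable_fin_num => //; exact: sym_integrable.
    apply: ge0_subset_integral => //; last by move=> s _; rewrite lee_fin.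
    apply/measurable_EFinP; exact: continuous_measurable_fun.
  move: sub; case: (\int[mu]_omega (f omega)%:E)%E => [r| |] sub.
  - rewrite lee_fin; apply: (cvgr_to_le freq).
    by apply: nearW => n; have := sub n; rewrite lee_fin.
  - by rewrite leey.
  - by have := sub 0%N; rewrite leeNy_eq.
rewrite (_ : S%:E = ((2 * pi)^-1)%:E * (2 * pi * S)%:E)%E; last first.
  by rewrite -EFinM mulrA mulVf ?mul1r// gt_eqF.
by apply: lee_wpmul2l => //; rewrite lee_fin invr_ge0 ltW.
Qed.

(** Subtracting a multiple of the denominator reduces to a strictly proper fraction,
    for which the bound is part of [h2_peak_gain]. *)
Lemma axis_bound (b : {poly C}) : (size b <= (size poles).+1)%N ->
  exists K, forall s : R, normsq b.[iaxis s] <= K * normsq (rootpoly poles).[iaxis s].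
Proof.
move=> sb; set A0 := rootpoly poles; set d := size poles in sb *.
pose b' := b - b`_d *: A0.
have mA : A0`_d = 1.
  have := monic_prod_XsubC poles xpredT id; rewrite monicE => /eqP <-.
  by rewrite lead_coefE size_rootpoly.
have sb' : (size b' <= d)%N.
  apply/leq_sizeP => j; rewrite leq_eqVlt => /orP[/eqP<-|dj].
    by rewrite coefB coefZ mA mulr1 subrr.
  rewrite coefB coefZ [b`_j]nth_default ?(leq_trans sb dj)//.
  by rewrite [A0`_j]nth_default ?size_rootpoly// mulr0 subr0.
have [S [_ _ _ [K hK]]] := h2_peak_gain stable_poles sb'.
exists (2 * (normsq b`_d + K)) => s.
have bE : b = b`_d *: A0 + b' by rewrite addrC subrK.
rewrite {1}bE hornerD hornerZ (le_trans (normsqD_le _ _))// -mulrA ler_pM2l//.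
rewrite [leRHS]mulrDl; apply: lerD; [by rewrite normsqM|exact: hK].
Qed.

(** The supremum that defines the Hinf norm is finite because the transfer function is
    bounded on the axis, so that a real constant g can be used. *)
Lemma energy_bound k x : (size (numer k) <= (size poles).+1)%N -> clocint x ->
  rootop poles x = causal u ->
  exists2 g : R, 0 <= g & [/\ (g%:E = normHinf (channel k) ^+ 2)%E,
    L2 (diffop (size poles) (numer k) x) &
    int0y (fun t => normsq (diffop (size poles) (numer k) x t)) <= g * input_energy u].
Proof.
move=> sk hx xu.
have A0 s : 0 < normsq (rootpoly poles).[iaxis s].
  rewrite lt_def normsq_ge0 andbT.
  apply: contraNneq (rootpoly_neq0 stable_poles (lexx 0 : 0 <= cRe (iaxis s))).
  by move=> /normsq_eq0 ->.
have nmE s : nm (transfer E A B Cm (iaxis s) k 0) ^+ 2 * normsq (rootpoly poles).[iaxis s] =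
    normsq (numer k).[iaxis s].
  rewrite -normsq_nm transfer_iaxis -normsqM divfK//.
  exact: rootpoly_neq0 stable_poles _.
have [K hK] := axis_bound sk.
set G := normHinf _.
have Gge s : ((nm (transfer E A B Cm (iaxis s) k 0))%:E <= G)%E.
  by apply: ereal_sup_ubound; exists s.
have K0 : 0 <= K.
  have := le_trans (normsq_ge0 _) (hK 0); by rewrite pmulr_lge0.
have Gle : (G <= (Num.sqrt K)%:E)%E.
  apply: ge_ereal_sup => _ [s _ <-]; rewrite lee_fin -ler_sqr ?nnegrE ?nm_ge0 ?sqrtr_ge0//.
  by rewrite sqr_sqrtr// -(ler_pM2r (A0 s)) nmE.
have Gfin : G \is a fin_num.
  rewrite ge0_fin_numE; first by rewrite (le_lt_trans Gle)// ltry.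
  by rewrite (le_trans _ (Gge 0))// lee_fin nm_ge0.
exists (fine G ^+ 2); first exact: sqr_ge0.
have hL : L2 (rootop poles x) by rewrite xu; exact: L2_input.
have bnd s : normsq (numer k).[iaxis s] <= fine G ^+ 2 * normsq (rootpoly poles).[iaxis s].
  have gs : nm (transfer E A B Cm (iaxis s) k 0) <= fine G.
    by rewrite -lee_fin fineK.
  rewrite -nmE ler_pM2r// ler_sqr ?nnegrE ?nm_ge0//.
  exact: le_trans (nm_ge0 _) gs.
have [h1 h2] := hinf_energy_gain stable_poles sk (sqr_ge0 _) bnd hx hL.
split => //; first by rewrite EFin_expe fineK.
by rewrite xu int0y_causal in h2.
Qed.

End Channels.

(** * The error of the truncated expansion *)

Lemma ae_forall_ord (R : realType) m (P : 'I_m -> R -> Prop) :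
  (forall k, {ae @lebesgue_measure R, forall t, P k t}) ->
  {ae @lebesgue_measure R, forall t, forall k, P k t}.
Proof.
move=> h; pose Q n t := forall k : 'I_m, nat_of_ord k = n -> P k t.
have hQ n : {ae @lebesgue_measure R, forall t, Q n t}.
  have [nm|mn] := ltnP n m.
    apply: ae_impl (h (Ordinal nm)) _ => t Pt k kn.
    by rewrite (_ : k = Ordinal nm)//; exact: val_inj.
  exists set0; split => // t /=; case=> k kn; move: (ltn_ord k).
  by rewrite kn ltnNge mn.
by apply: ae_impl (ae_foralln hQ) _ => t Qt k; exact: (Qt k k erefl).
Qed.

(** A numerator of degree less than d leaves one integration, which makes the output
    continuous. *)
Lemma diffop_strict (R : realType) d (b : {poly R[i]}) x : clocint x ->
  (size b <= d)%N -> exists2 g, clocint g & diffop d b x = cprim g.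
Proof.
move=> hx; case: d => [|d] sb.
  exists (fun=> 0); first exact: clocint0.
  have /eqP -> : b == 0 by rewrite -size_poly_leq0.
  by rewrite cprim0; apply/funext => t; rewrite /diffop big1// => i _; rewrite coef0 mul0r.
exists (diffop d b x); first exact: clocint_diffop.
by rewrite diffopS// -(diffop_iter _ _ 1 hx).
Qed.

Lemma truncation_error (R : realType) q (Phi : nat -> q.-tuple R -> R)
    (I I' : {fset nat}) (w : R -> 'cV[R]_#|` I|) t p :
  yhat Phi w t p - ytilde Phi I' w t p =
  \sum_(k < #|` I| | idx k \notin I') w t k 0 * Phi (idx k) p.
Proof. by rewrite /yhat /ytilde (bigID (fun k => idx k \in I'))/= addrAC subrr add0r. Qed.

Lemma sqr_Re_le (R : realType) (z : R[i]) : complex.Re z ^+ 2 <= normsq z.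
Proof. by rewrite /normsq lerDl sqr_ge0. Qed.

Lemma sum_sqrte_bound (R : realType) n (P : pred 'I_n) (a S : 'I_n -> R) (U : R)
    (h : 'I_n -> \bar R) :
  0 <= U -> (forall k, 0 <= S k) -> (forall k, a k <= S k * U) ->
  (forall k, (S k)%:E <= h k)%E ->
  (sqrte (\sum_(k | P k) a k)%:E <= sqrte (\sum_(k | P k) h k) * sqrte U%:E)%E.
Proof.
move=> U0 S0 aS Sh.
have h0 : (0 <= \sum_(k | P k) h k)%E.
  by apply: sume_ge0 => k _; apply: le_trans (Sh k); rewrite lee_fin.
rewrite -sqrteM// lee_sqrt; last by rewrite mule_ge0.
apply: (@le_trans _ _ ((\sum_(k | P k) S k)%:E * U%:E)%E).
  by rewrite -EFinM lee_fin mulr_suml ler_sum.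
apply: lee_wpmul2r; first by rewrite lee_fin.
by rewrite -sumEFin; apply: lee_sum.
Qed.

Theorem theorem1 (R : realType) (q n : nat)
  (Pi : set (q.-tuple R)) (rho : q.-tuple R -> R)
  (Phi : nat -> q.-tuple R -> R)
  (E A : q.-tuple R -> 'M[R]_n) (B : q.-tuple R -> 'cV[R]_n)
  (C : q.-tuple R -> 'rV[R]_n)
  (I I' : {fset nat})
  (Ehat Ahat : 'M[R]_(\sum_(k < #|` I|) n))
  (Bhat : 'cV[R]_(\sum_(k < #|` I|) n))
  (Chat : 'M[R]_(#|` I|, \sum_(k < #|` I|) n))
  (u : R -> R)
  (v : R -> 'cV[R]_(\sum_(k < #|` I|) n)) (w : R -> 'cV[R]_#|` I|) :
  measurable Pi -> probability_density Pi rho ->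
  complete_orthonormal Pi rho Phi -> (forall p, Pi p -> Phi 0%N p = 1) ->
  (forall p, Pi p -> regular_pencil (E p) (A p)) ->
  (forall p, Pi p -> stable_system (E p) (A p)) ->
  (I' `<=` I)%fset ->
  galerkin_expectations_exist Pi rho Phi I E A B C ->
  Ehat = galerkin_mx Pi rho Phi I E ->
  Ahat = galerkin_mx Pi rho Phi I A ->
  Bhat = galerkin_input Pi rho Phi I B ->
  Chat = galerkin_output Pi rho Phi I C ->
  regular_pencil Ehat Ahat ->
  input_L2 u ->
  solution Ehat Ahat Bhat Chat u v w ->
  let H k s := transfer Ehat Ahat Bhat Chat s k 0 in
  (stable_system Ehat Ahat -> strictly_proper_system Ehat Ahat Bhat Chat ->
    (* The output is determined by the input up to a null set of times only; the
       supremum over t >= 0 is that of its continuous representative. *)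
    exists wc : R -> 'cV[R]_#|` I|,
    [/\ forall k, {within `[0, +oo[, continuous (fun t => wc t k 0)},
        {ae @lebesgue_measure R, forall t, 0 <= t -> wc t = w t} &
        (ereal_sup [set normL2 Pi rho
            (fun p => (yhat Phi wc t p - ytilde Phi I' wc t p)%R)
          | t in `[0%R, +oo[]
        <= sqrte (\sum_(k < #|` I| | idx k \notin I') normH2 (H k) ^+ 2)
           * norm_input u)%E])
  /\
  (stable_system Ehat Ahat -> proper_system Ehat Ahat Bhat Chat ->
    (normL2L2 Pi rho (fun t p => (yhat Phi w t p - ytilde Phi I' w t p)%R)
     <= sqrte (\sum_(k < #|` I| | idx k \notin I') normHinf (H k) ^+ 2)
        * norm_input u)%E).
Proof.
move=> mPi hrho hPhi _ _ _ _ _ _ _ _ _ _ hu sol H.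
have U0 := input_energy_ge0 u.
split=> st pr.
  have [x hx [xu real]] := realisation hu sol st.
  have sk k : (size (numer Ehat Ahat Bhat Chat k) <= size (poles Ehat Ahat))%N.
    by rewrite size_numer// -ltnS -size_poles// strictly_proper_size.
  have /choice[S hS] := fun k => peak_bound hu st (sk k) hx xu.
  pose y k := diffop (size (poles Ehat Ahat)) (numer Ehat Ahat Bhat Chat k) x.
  exists (fun t => \col_k complex.Re (y k t)); split.
  - move=> k; have [g [hg _] gE] := diffop_strict hx (sk k).
    rewrite (_ : (fun t => _) = primitive (@complex.Re R \o g)).
      exact: primitive_continuous0y.
    by apply/funext => t; rewrite mxE /y gE Re_cprim.
  - have rk k := real k (leqW (sk k)).
    apply: ae_impl (ae_forall_ord rk) _ => t ht t0.
    by apply/matrixP => k j; rewrite mxE ord1 /y -ht.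
  - apply: ge_ereal_sup => _ [t _ <-]; rewrite /normL2.
    under eq_fun do rewrite truncation_error.
    rewrite sqnormL2_expansion// norm_inputE//.
    apply: (sum_sqrte_bound _ (S := S)) => // k; have [S0 Sb Sh] := hS k => //.
    by rewrite mxE (le_trans (sqr_Re_le _))//; exact: Sb.
have [x hx [xu real]] := realisation hu sol st.
have sk k : (size (numer Ehat Ahat Bhat Chat k) <= (size (poles Ehat Ahat)).+1)%N.
  by rewrite size_numer// -size_poles// proper_size.
pose W k := int0y (fun t => normsq (diffop (size (poles Ehat Ahat)) (numer Ehat Ahat Bhat Chat k) x t)).
have mw k : measurable_fun (`[0%R, +oo[ : set R) (fun t => (w t k 0%R ^+ 2)%:E).
  have [/measurable0y + _] := clocint_output sol k.
  move=> mwk; apply/measurable_EFinP; apply: measurable_funX.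
  apply: eq_measurable_fun mwk => t; rewrite inE/= in_itv/= andbT => t0.
  by rewrite /causal t0.
have [|g /all_and4[g0 gH gL gW]] := @choice _ _ (fun k (g : R) =>
    [/\ 0 <= g, (g%:E = normHinf (H k) ^+ 2)%E,
      L2 (diffop (size (poles Ehat Ahat)) (numer Ehat Ahat Bhat Chat k) x) &
      W k <= g * input_energy u]).
  by move=> k; have [g g0 [gH gL gW]] := energy_bound hu st (sk k) hx xu; exists g.
have wW k : (\int[@lebesgue_measure R]_(t in `[0%R, +oo[) (w t k 0%R ^+ 2)%:E = (W k)%:E)%E.
  have iy := L2_integrable (gL k).
  rewrite /W /int0y /Rintegral fineK; last exact: integrable_fin_num.
  apply: ae_eq_integral => //; [exact: mw|exact: (measurable_int (@lebesgue_measure R) iy)|].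
  apply: ae_impl (real k (sk k)) _ => t ht; rewrite /= in_itv/= andbT => t0.
  by rewrite -ht// /normsq/= expr0n/= addr0.
rewrite /normL2L2 norm_inputE//.
rewrite (_ : \int[_]_(t in _) _ = (\sum_(k < #|` I| | idx k \notin I') W k)%:E)%E.
  by apply: (sum_sqrte_bound _ (S := g)) => // k; rewrite gH.
rewrite -sumEFin -big_filter; under eq_bigr do rewrite -wW.
rewrite -ge0_integral_sum//; last by move=> k t _; rewrite lee_fin sqr_ge0.
apply: eq_integral => t _; under [X in sqnormL2 _ _ X]eq_fun do rewrite truncation_error.
by rewrite sqnormL2_expansion// big_filter sumEFin.
Qed.
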